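(* Let $n\geq 2$ and $1\leq k\leq n-1$ be integers, and let $N_k^n=\mathbb{P}(\mathcal{O}(0)\oplus\mathcal{O}(k))$ be endowed with its unique $U(n)$-invariant gradient shrinking Kähler Ricci soliton structure, with Riemannian metric $g$ and potential function $f$. For each $0<r<\infty$, the inclusion map $\iota_r:L(k\,;1)(r)\hookrightarrow N_k^n$ of the lens space of radius $r$ is a compact self-similar solution. Furthermore, there exists a unique radius $r_2\in(0,\infty)$ which satisfies the following. (i) If $r<r_2$, $\iota_r:L(k\,;1)(r)\hookrightarrow N_k^n$ is a non-minimal self-shrinker. (ii) If $r=r_2$, $\iota_r:L(k\,;1)(r)\hookrightarrow N_k^n$ is a minimal embedding. (iii) If $r>r_2$, $\iota_r:L(k\,;1)(r)\hookrightarrow N_k^n$ is a non-minimal self-expander.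
   Context: Ambient manifold. Fix integers $n\ge 2$, $1\le k\le n-1$. $\mathcal{O}(k)$ is the $k$-th tensor power of the hyperplane bundle over $\mathbb{P}^{n-1}$ and $\pi:N_k^n:=\mathbb{P}(\mathcal{O}(0)\oplus\mathcal{O}(k))\to\mathbb{P}^{n-1}$ is the associated projective-line bundle. Over $U_j=\{z^j\ne0\}\subset\mathbb{P}^{n-1}$ the fiber coordinates of $\mathcal{O}(k)$ satisfy $y^i=(z^i/z^j)^k y^j$ on $U_i\cap U_j$, and $\pi^{-1}(U_j)\cong U_j\times\mathbb{P}^1$. $S_0$ and $S_\infty$ are the images of the $0$-section (fiber coordinate $(1:0)$) and the $\infty$-section (fiber coordinate $(0:1)$). The map $z=(z^1,\dots,z^n)\mapsto((z^1:\cdots:z^n),(1:(z^j)^k))$ (for $z^j\neq0$) induces an open dense embedding $(\mathbb{C}^n\setminus\{0\})/\mathbb{Z}_k\hookrightarrow N_k^n$ with complement $S_0\sqcup S_\infty$, where $\mathbb{Z}_k$ acts by $[\ell]\cdot z=e^{2\pi i\ell/k}z$; we identify $(\mathbb{C}^n\setminus\{0\})/\mathbb{Z}_k$ with its image. Soliton structure. By a theorem of Cao there is exactly one pair $(u,c)$ of a smooth function $u:\mathbb{R}\to\mathbb{R}$ and a constant $c\in\mathbb{R}$ such that: $u'>0$, $u''>0$; $u(s)=(n-k)s+a_1e^{ks}+a_2e^{2ks}+\cdots$ as $s\to-\infty$ and $u(s)=(n+k)s+b_1e^{-ks}+b_2e^{-2ks}+\cdots$ as $s\to\infty$ with $a_1,b_1>0$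 (in the sense that $u(s)-(n-k)s$, resp. $u(s)-(n+k)s$, is a smooth function of $e^{ks}$, resp. $e^{-ks}$, up to the value $0$, so the expansions may be differentiated); and $\frac{u'''}{u''}+\left(\frac{n-1}{u'}-c\right)u''=n-u'$. Moreover $0<c<1$. With $\Phi(z)=u(\log|z|^2)$, the form $\omega=\sqrt{-1}\,\frac{\partial^2\Phi}{\partial z^\alpha\partial\bar z^\beta}dz^\alpha\wedge d\bar z^\beta$ on $(\mathbb{C}^n\setminus\{0\})/\mathbb{Z}_k$ extends to a Kähler form on $N_k^n$; $g$ is its associated Riemannian metric, and $f(z)=P(\log|z|^2)$ with $P(s)=-ns+(n-1)\log u'(s)+\log u''(s)+u(s)$ extends to a smooth function on $N_k^n$. One has $\mathrm{Ric}(g)+\mathrm{Hess}f=g$, and $(g,f)$ is the unique $U(n)$-invariant gradient shrinking Kähler Ricci soliton structure on $N_k^n$. Lens space. $L(k\,;1)(r)$ is the quotient of the sphere $S^{2n-1}(r)\subset\mathbb{C}^n$ of radius $r$ by the $\mathbb{Z}_k$-action $[\ell]\cdot z=e^{2\pi i\ell/k}z$; it is embedded in $(\mathbb{C}^n\setminus\{0\})/\mathbb{Z}_k\subset N_k^n$, with inclusion map $\iota_r$. Self-similar solutions. An immersion $F:M\to N$ into a gradient shrinking Ricci soliton $(N,g,f)$ is a self-similar solution with coefficient $\lambda\in\mathbb{R}$ if its mean curvature vector field (trace of the second fundamental form) satisfies $H_g(F)=\lambda\,\nabla f^{\perp}$, where $\perp$ denotes the normal component. It is a self-shrinker if $\lambda<0$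 and a self-expander if $\lambda>0$; it is minimal if $H_g(F)=0$. *)

(* Defs.v *)
From HB Require Import structures.
From mathcomp Require Import all_boot all_order all_algebra.
From mathcomp Require Import complex.
From mathcomp Require Import all_classical all_reals all_analysis.

Set Implicit Arguments.
Unset Strict Implicit.
Unset Printing Implicit Defensive.

Import Order.TTheory GRing.Theory Num.Theory.
Import numFieldNormedType.Exports.

Local Open Scope ring_scope.
Local Open Scope complex_scope.
Local Open Scope classical_set_scope.
Local Open Scope quotient_scope.

Section Calculus.
Variable R : realType.

Definition partial m (V : normedModType R) (i : 'I_m) (f : 'rV[R]_m -> V)
    (x : 'rV[R]_m) : V :=
  'D_(delta_mx 0 i) f x.

(* [U] is meant to be open: differentiability is required on full
   neighbourhoods of the points of [U]. *)
Fixpoint Ck_on m (V : normedModType R) (l : nat) (U : set 'rV[R]_m)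
    (f : 'rV[R]_m -> V) : Prop :=
  if l is l'.+1 then
    (forall x, U x -> differentiable f x) /\
    (forall i, Ck_on l' U (partial i f))
  else forall x, U x -> {for x, continuous f}.

Definition smooth_on m (V : normedModType R) (U : set 'rV[R]_m)
    (f : 'rV[R]_m -> V) : Prop :=
  forall l, Ck_on l U f.

Definition smooth1 (h : R -> R) : Prop :=
  forall l s, derivable (derive1n l h) s 1.

End Calculus.

(** [G y] is the Gram matrix of the metric at [y]. Row [i] of the library's
    Jacobian ['J X x] is the tangent vector [partial i X x]. *)

Section LocalGeometry.
Variables (R : realType) (m : nat) (G : 'rV[R]_m -> 'M[R]_m).

Definition inner (y v w : 'rV[R]_m) : R := (v *m G y *m w^T) 0 0.

Definition christoffel (a b c : 'I_m) (y : 'rV[R]_m) : R :=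
  2^-1 * \sum_d invmx (G y) a d *
    (partial b (fun t => G t d c) y + partial c (fun t => G t d b) y
     - partial d (fun t => G t b c) y).

Definition ricci (b c : 'I_m) (y : 'rV[R]_m) : R :=
  \sum_a partial a (christoffel a b c) y
  - \sum_a partial c (christoffel a a b) y
  + \sum_a \sum_d christoffel a a d y * christoffel d b c y
  - \sum_a \sum_d christoffel a c d y * christoffel d a b y.

Definition hessian (f : 'rV[R]_m -> R) (b c : 'I_m) (y : 'rV[R]_m) : R :=
  partial b (partial c f) y - \sum_a christoffel a b c y * partial a f y.

Definition gradient (f : 'rV[R]_m -> R) (y : 'rV[R]_m) : 'rV[R]_m :=
  (\row_b partial b f y) *m invmx (G y).

Variables (p : nat) (X : 'rV[R]_p -> 'rV[R]_m).

Definition induced (x : 'rV[R]_p) : 'M[R]_p :=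
  'J X x *m G (X x) *m ('J X x)^T.

Definition normal_part (x : 'rV[R]_p) (v : 'rV[R]_m) : 'rV[R]_m :=
  v - \sum_i \sum_j (invmx (induced x) i j * inner (X x) v (partial i X x))
                      *: partial j X x.

(* the ambient covariant derivative of [partial j X] along [partial i X] *)
Definition covariant (i j : 'I_p) (x : 'rV[R]_p) : 'rV[R]_m :=
  partial i (partial j X) x
  + \row_a \sum_b \sum_c christoffel a b c (X x)
             * partial i X x 0 b * partial j X x 0 c.

Definition second_fundamental (i j : 'I_p) (x : 'rV[R]_p) : 'rV[R]_m :=
  normal_part x (covariant i j x).

Definition mean_curvature (x : 'rV[R]_p) : 'rV[R]_m :=
  \sum_i \sum_j invmx (induced x) i j *: second_fundamental i j x.

End LocalGeometry.

(** A space with an atlas of local parametrizations [par i] of open sets, each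
    injective on the open set [dom i]. The record holds only the data; the
    notions below are required in all charts of the atlas. *)

Record charted (R : realType) (m : nat) := Charted {
  space :> topologicalType;
  chart : Type;
  dom : chart -> set 'rV[R]_m;
  par : chart -> 'rV[R]_m -> space }.

Section Manifolds.
Variable R : realType.

(* inverse of [par i] on the image of [dom i] *)
Definition coord m (M : charted R m) (i : chart M) (q : M) : 'rV[R]_m :=
  xget 0 [set x | dom i x /\ par i x = q].

Definition loc_dom p m (M : charted R p) (N : charted R m) (F : M -> N)
    (i : chart M) (j : chart N) : set 'rV[R]_p :=
  [set x | dom i x /\ (par j @` dom j) (F (par i x))].

Definition loc p m (M : charted R p) (N : charted R m) (F : M -> N)
    (i : chart M) (j : chart N) (x : 'rV[R]_p) : 'rV[R]_m :=
  coord j (F (par i x)).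

Definition smooth_map p m (M : charted R p) (N : charted R m) (F : M -> N) :=
  continuous F /\ forall i j, smooth_on (loc_dom F i j) (loc F i j).

Definition smooth_function m (M : charted R m) (f : M -> R) :=
  forall i : chart M, smooth_on (dom i) (f \o par i).

Definition immersion p m (M : charted R p) (N : charted R m) (F : M -> N) :=
  smooth_map F /\
  forall i j x, loc_dom F i j x -> \rank ('J (loc F i j) x) = p.

Definition embedding p m (M : charted R p) (N : charted R m) (F : M -> N) :=
  [/\ immersion F, injective F &
      forall U : set M, open U ->
        exists2 V : set N, open V & F @` U = V `&` range F].

Definition tensor2 m (M : charted R m) : Type :=
  chart M -> 'rV[R]_m -> 'M[R]_m.

Definition is_pullback p m (M : charted R p) (N : charted R m) (F : M -> N)
    (gM : tensor2 M) (gN : tensor2 N) : Prop :=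
  forall i j x, loc_dom F i j x ->
    gM i x = 'J (loc F i j) x *m gN j (loc F i j x) *m ('J (loc F i j) x)^T.

(* the third clause is the transformation rule under changes of charts *)
Definition riemannian m (M : charted R m) (g : tensor2 M) : Prop :=
  [/\ forall i, smooth_on (dom i) (g i),
      forall i x, dom i x ->
        (g i x)^T = g i x /\ (forall v, v != 0 -> 0 < inner (g i) x v v)
    & is_pullback (fun q : M => q) g g].

(* gradient shrinking Ricci soliton: Ric(g) + Hess f = g *)
Record shrinking_soliton m (N : charted R m) := ShrinkingSoliton {
  metric : tensor2 N;
  potential : N -> R;
  metric_riemannian : riemannian metric;
  potential_smooth : smooth_function potential;
  soliton_equation : forall j y, dom j y -> forall b c,
    ricci (metric j) b c y + hessian (metric j) (potential \o par j) b c y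
    = metric j y b c }.

Section SelfSimilar.
Variables (p m : nat) (M : charted R p) (N : charted R m).
Variables (S : shrinking_soliton N) (F : M -> N).

Definition self_similar (lam : R) : Prop :=
  immersion F /\
  forall i j x, loc_dom F i j x ->
    mean_curvature (metric S j) (loc F i j) x =
    lam *: normal_part (metric S j) (loc F i j) x
             (gradient (metric S j) (potential S \o par j) (loc F i j x)).

Definition self_shrinker : Prop := exists2 lam, lam < 0 & self_similar lam.
Definition self_expander : Prop := exists2 lam, 0 < lam & self_similar lam.

Definition minimal : Prop :=
  immersion F /\
  forall i j x, loc_dom F i j x ->
    mean_curvature (metric S j) (loc F i j) x = 0.

End SelfSimilar.
End Manifolds.

(** [x : 'rV[R]_(n + n)] stands for the point of C^n with coordinates
    [z^j = x_j + i x_(n+j)]. *)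

Section ComplexCoordinates.
Variable R : realType.

Definition zc n (j : 'I_n) (x : 'rV[R]_(n + n)) : R[i] :=
  x 0 (lshift n j) +i* x 0 (rshift n j).

Definition of_zc n (w : 'I_n -> R[i]) : 'rV[R]_(n + n) :=
  row_mx (\row_j complex.Re (w j)) (\row_j complex.Im (w j)).

Definition mulJ n (x : 'rV[R]_(n + n)) : 'rV[R]_(n + n) :=
  of_zc (fun j => 'i * zc j x).

(* |z|^2; the library norm on ['rV[R]_m] is the sup norm *)
Definition sqnorm m (x : 'rV[R]_m) : R := \sum_i x 0 i ^+ 2.

Lemma of_zcK n (w : 'I_n -> R[i]) j : zc j (of_zc w) = w j.
Proof. by rewrite /zc row_mxEl row_mxEr !mxE; case: (w j). Qed.

Lemma zc0 n (j : 'I_n) : zc j 0 = 0.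
Proof. by rewrite /zc !mxE. Qed.

Lemma of_zc_neq0 n (w : 'I_n -> R[i]) j : w j != 0 -> of_zc w != 0.
Proof. by apply: contraNneq => w0; rewrite -(of_zcK w) w0 zc0. Qed.

(* d^2 Phi / dz^a dzbar^b, as (d/dx^a - i d/dy^a)(d/dx^b + i d/dy^b) Phi / 4 *)
Definition wirtinger n (Phi : 'rV[R]_(n + n) -> R) (a b : 'I_n)
    (x : 'rV[R]_(n + n)) : R[i] :=
  let dx (c : 'I_n) (f : 'rV[R]_(n + n) -> R) := partial (lshift n c) f in
  let dy (c : 'I_n) (f : 'rV[R]_(n + n) -> R) := partial (rshift n c) f in
  ((dx a (dx b Phi) x + dy a (dy b Phi) x) / 4%:R)
  +i* ((dx a (dy b Phi) x - dy a (dx b Phi) x) / 4%:R).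

(* i d^2Phi/dz^a dzbar^b dz^a /\ dzbar^b evaluated on the vectors v, w *)
Definition kahler_form n (Phi : 'rV[R]_(n + n) -> R)
    (x v w : 'rV[R]_(n + n)) : R[i] :=
  'i * \sum_a \sum_b wirtinger Phi a b x *
    (zc a v * (zc b w)^* - zc a w * (zc b v)^*).

(* Gram matrix of g(v, w) = omega(v, J w) *)
Definition kahler_metric n (Phi : 'rV[R]_(n + n) -> R)
    (x : 'rV[R]_(n + n)) : 'M[R]_(n + n) :=
  \matrix_(a, b)
    complex.Re (kahler_form Phi x (delta_mx 0 a) (mulJ (delta_mx 0 b))).

End ComplexCoordinates.

(** The charts of C^n \ {0} are the identity maps of its open subsets: [ppar] is
    a total function whose values matter on [pdom] only. *)

Section PuncturedSpace.
Variables (R : realType) (n : nat).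

Definition punctured_set : set 'rV[R]_(n + n) := [set z | z != 0].

Record punctured_chart := PuncturedChart {
  pdom : set 'rV[R]_(n + n);
  ppar : 'rV[R]_(n + n) -> punctured_set;
  pdom_open : open pdom;
  pparE : forall x, pdom x -> set_val (ppar x) = x }.

Definition punctured : charted R (n + n) :=
  @Charted R (n + n) punctured_set punctured_chart pdom ppar.

End PuncturedSpace.

(** N = P(O(0) + O(k)). A point is a class [z; (a, b)] with z in C^n \ {0}, (a, b) in C^2 \ {0}
    and [z; (a, b)] = [mu z; (nu mu^k a, nu b)]. Over {z^j <> 0} the fibre
    coordinate is (1 : y^j) = (a : (z^j)^k b), so y^i = (z^i/z^j)^k y^j; S_0 and
    S_oo are the loci b = 0 and a = 0. *)

Section ProjectiveBundle.
Variables (R : realType) (n k : nat).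

Definition bundle_set : set ('rV[R]_(n + n) * 'rV[R]_(2 + 2)) :=
  [set p | p.1 != 0 /\ p.2 != 0].

Definition bundle_rel (p q : bundle_set) : bool :=
  `[< exists mu nu : R[i], [/\ mu != 0, nu != 0,
        forall j, zc j (set_val q).1 = mu * zc j (set_val p).1,
        zc 0 (set_val q).2 = nu * mu ^+ k * zc 0 (set_val p).2
      & zc 1 (set_val q).2 = nu * zc 1 (set_val p).2] >].

Lemma bundle_relP : equiv_class_of bundle_rel.
Proof.
split.
- move=> p; apply/asboolP; exists 1, 1; split; rewrite ?oner_neq0//.
  + by move=> j; rewrite mul1r.
  + by rewrite expr1n !mul1r.
  + by rewrite mul1r.
- have sym p q : bundle_rel p q -> bundle_rel q p.
    move=> /asboolP[mu [nu [mu0 nu0 h1 h2 h3]]]; apply/asboolP.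
    exists mu^-1, nu^-1; split; rewrite ?invr_eq0//.
    + by move=> j; rewrite h1 mulKf.
    + by rewrite h2 exprVn -invfM mulKf// mulf_neq0// expf_neq0.
    + by rewrite h3 mulKf.
  by move=> p q; apply/idP/idP; exact: sym.
- move=> q p s /asboolP[mu [nu [mu0 nu0 h1 h2 h3]]].
  move=> /asboolP[mu' [nu' [mu'0 nu'0 h1' h2' h3']]]; apply/asboolP.
  exists (mu' * mu), (nu' * nu); split; rewrite ?mulf_neq0//.
  + by move=> j; rewrite h1' h1 mulrA.
  + by rewrite h2' h2 exprMn !mulrA [nu' * mu' ^+ k * nu]mulrAC.
  + by rewrite h3' h3 mulrA.
Qed.

Canonical bundle_equiv := EquivRelPack bundle_relP.

Definition bundle_space : topologicalType :=
  quotient_topology {eq_quot bundle_rel}.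

Definition fibre_vec (a b : R[i]) : 'rV[R]_(2 + 2) :=
  of_zc (fun i : 'I_2 => if i == 0 then a else b).

Lemma fibre_vec_neq0 (a b : R[i]) : (a != 0) || (b != 0) -> fibre_vec a b != 0.
Proof.
by case/orP => h; [apply: (@of_zc_neq0 _ _ _ 0)|apply: (@of_zc_neq0 _ _ _ 1)].
Qed.

Definition bundle_pt (z : 'rV[R]_(n + n)) (z0 : z != 0) (a b : R[i])
    (ab0 : (a != 0) || (b != 0)) : bundle_space :=
  \pi_(quotient_topology {eq_quot bundle_rel})
    (SigSub (mem_set (conj z0 (fibre_vec_neq0 ab0) :
                        bundle_set (z, fibre_vec a b)))).

Definition affine (j : 'I_n) (w : 'rV[R]_(n + n)) : 'rV[R]_(n + n) :=
  of_zc (fun i => if i == j then 1 else zc i w).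

Lemma affine_neq0 j w : affine j w != 0.
Proof. by apply: (@of_zc_neq0 _ _ _ j); rewrite eqxx oner_neq0. Qed.

Lemma one_l (w : R[i]) : (1 != 0 :> R[i]) || (w != 0).
Proof. by rewrite oner_neq0. Qed.

Lemma one_r (w : R[i]) : (w != 0) || (1 != 0 :> R[i]).
Proof. by rewrite oner_neq0 orbT. Qed.

(* The base coordinates z^i/z^j are the w^i for i != j; the remaining
   coordinate w^j is the fibre coordinate y^j, or 1/y^j in the chart
   [(j, true)]. *)
Definition bundle_par (jb : 'I_n * bool) (w : 'rV[R]_(n + n)) : bundle_space :=
  let: (j, b) := jb in
  if b then bundle_pt (affine_neq0 j w) (one_r (zc j w))
  else bundle_pt (affine_neq0 j w) (one_l (zc j w)).

Definition Nnk : charted R (n + n) :=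
  @Charted R (n + n) bundle_space ('I_n * bool)%type (fun=> setT) bundle_par.

(* z |-> (z^1 : ... : z^n), (1 : (z^j)^k) *)
Definition emb (z : punctured R n) : Nnk :=
  bundle_pt (set_mem (valP z) : set_val z != 0) (one_l 1).

End ProjectiveBundle.

Section LensSpace.
Variables (R : realType) (n k : nat) (r : {posnum R}).

Definition sphere : set 'rV[R]_(n + n) := [set x | sqnorm x = r%:num ^+ 2].

Definition root_of_unity (l : int) : R[i] :=
  let t := 2 * pi * l%:~R / k%:R in cos t +i* sin t.

Definition lens_rel (x y : sphere) : bool :=
  `[< exists l : int, forall j,
        zc j (set_val y) = root_of_unity l * zc j (set_val x) >].

Lemma root_of_unity0 : root_of_unity 0 = 1.
Proof. by rewrite /root_of_unity mulr0 mul0r cos0 sin0. Qed.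

Lemma root_of_unityD l l' :
  root_of_unity (l + l') = root_of_unity l * root_of_unity l'.
Proof.
rewrite /root_of_unity intrD mulrDr mulrDl cosD sinD; apply/eqP.
by rewrite eq_complex/= eqxx/= addrC.
Qed.

Lemma lens_relP : equiv_class_of lens_rel.
Proof.
split.
- by move=> x; apply/asboolP; exists 0 => j; rewrite root_of_unity0 mul1r.
- have sym x y : lens_rel x y -> lens_rel y x.
    move=> /asboolP[l h]; apply/asboolP; exists (- l) => j.
    by rewrite h mulrA -root_of_unityD addNr root_of_unity0 mul1r.
  by move=> x y; apply/idP/idP; exact: sym.
- move=> y x z /asboolP[l h] /asboolP[l' h']; apply/asboolP.
  by exists (l' + l) => j; rewrite h' h mulrA root_of_unityD.
Qed.

Canonical lens_equiv := EquivRelPack lens_relP.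

Definition lens_space : topologicalType :=
  quotient_topology {eq_quot lens_rel}.

Definition lens_proj (x : sphere) : lens_space :=
  \pi_(quotient_topology {eq_quot lens_rel}) x.

(* local parametrizations of the submanifold S^(2n-1)(r) of R^(2n) on which
   the projection to the quotient is injective *)
Record lens_chart := LensChart {
  ldom : set 'rV[R]_(n + n).-1;
  lpar : 'rV[R]_(n + n).-1 -> sphere;
  ldom_open : open ldom;
  lpar_smooth : smooth_on ldom (fun x => set_val (lpar x));
  lpar_regular : forall x, ldom x ->
    \rank ('J (fun x => set_val (lpar x)) x) = (n + n).-1;
  lpar_inj : {in ldom &, injective (lens_proj \o lpar)} }.

Definition lens : charted R (n + n).-1 :=
  @Charted R (n + n).-1 lens_space lens_chart ldom
    (fun i => lens_proj \o lpar i).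

Lemma sphere_punctured (x : sphere) : punctured_set (set_val x).
Proof.
apply/eqP => x0; have := set_mem (valP x); rewrite /sphere/= set_valE in x0 *.
rewrite x0 /sqnorm big1 => [/esym/eqP|i _]; last by rewrite mxE expr0n.
by rewrite sqrf_eq0 gt_eqF.
Qed.

Definition sphere_incl (x : sphere) : punctured R n :=
  SigSub (mem_set (sphere_punctured x)).

Definition lens_incl (q : lens) : Nnk R n k :=
  emb k (sphere_incl (repr (q : lens_space))).

End LensSpace.

Arguments lens_incl {R} n k r q.

Section CaoSoliton.
Variables (R : realType) (n k : nat).

(* The expansions at -oo and +oo state that u(s) - (n - k) s and
   u(s) - (n + k) s are smooth functions, up to the value 0, of e^(ks) and
   e^(-ks), with zero constant term and first coefficients a_1, b_1 > 0. By
   Borel's lemma such functions extend smoothly past 0, to the whole of R. *)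
Record cao_profile (u : R -> R) (c : R) : Prop := {
  cao_smooth : smooth1 u;
  cao_d1 : forall s, 0 < derive1 u s;
  cao_d2 : forall s, 0 < derive1n 2 u s;
  cao_minus : exists h : R -> R,
    [/\ smooth1 h, h 0 = 0, 0 < derive1 h 0 &
        forall s, u s = (n%:R - k%:R) * s + h (expR (k%:R * s))];
  cao_plus : exists h : R -> R,
    [/\ smooth1 h, h 0 = 0, 0 < derive1 h 0 &
        forall s, u s = (n%:R + k%:R) * s + h (expR (- (k%:R * s)))];
  cao_ode : forall s,
    derive1n 3 u s / derive1n 2 u s
    + ((n%:R - 1) / derive1 u s - c) * derive1n 2 u s
    = n%:R - derive1 u s }.

Definition kahler_potential (u : R -> R) (z : 'rV[R]_(n + n)) : R :=
  u (ln (sqnorm z)).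

Definition soliton_potential (u : R -> R) (s : R) : R :=
  - (n%:R * s) + (n%:R - 1) * ln (derive1 u s) + ln (derive1n 2 u s) + u s.

(* The embedded copy of (C^n \ {0})/Z_k is dense, so these conditions determine
   the metric and the potential on the whole of N. *)
Definition is_cao_soliton (u : R -> R) (S : shrinking_soliton (Nnk R n k)) :=
  is_pullback (emb k : punctured R n -> Nnk R n k)
    (fun=> kahler_metric (kahler_potential u)) (metric S) /\
  forall z : punctured R n,
    potential S (emb k z) = soliton_potential u (ln (sqnorm (set_val z))).

End CaoSoliton.

(* Main.v *)
Require Import Defs.
From mathcomp Require Import all_boot all_order all_algebra.
From mathcomp Require Import complex.
From mathcomp Require Import all_classical all_reals all_analysis.
From mathcomp Require Import ring lra.

Set Implicit Arguments.
Unset Strict Implicit.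
Unset Printing Implicit Defensive.

Import Order.TTheory GRing.Theory Num.Theory.
Import numFieldNormedType.Exports.

Local Open Scope ring_scope.
Local Open Scope complex_scope.
Local Open Scope classical_set_scope.
Local Open Scope quotient_scope.

(** Write s = ln |z|^2 on C^n minus the origin. There the metric has the radial
    potential u(s), and the position field E(z) = z satisfies g(E, w) = u''(s) ds(w),
    so E is a multiple of grad s and is normal to every sphere |z| = r. The profile
    equation says precisely that the potential P of the soliton has P' = c u'';
    hence grad f = c E. The mean curvature vector H of a sphere is normal as well,
    so H and grad f are proportional along the sphere, with a factor that depends on s
    only: every lens space is self-similar.

    The factor comes from the first variation of area. If a normal field nu of a
    hypersurface X is the restriction of a linear field of the ambient coordinates,
    differentiating g(dX, nu) = 0 and inserting the Koszul formula gives
    g(H, nu) = - (1/2) tr (h^-1 L_nu g), with h the induced metric and L_nu the Lie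
    derivative ([mean_curvature_lie]). This applies in the charts of the bundle:
    the dilation by t fixes the base coordinates and multiplies the fibre coordinate
    by t^k or t^-k, so E is linear there ([bundle_coordZ]). Moreover L_E g is the
    derivative at t = 1 of t^2 g(t z) ([lie_pullback]), which is read off from the
    explicit form of g ([kahler_metricE]). Up to the factor 2/|z|^2 the
    metric h of the sphere is u'' times the euclidean one along J E and u' times it
    on the complement, of dimension 2n - 2, and the trace ([mxtrace_sphere]) yields
      H = - Q / (2 u'') E,  Q = (2n - 2) u''/u' + u'''/u'',
    so that lambda = - Q / (2 c u'').

    It remains to find the signs of c and Q. Were c <= 0, comparison of
    u'^(n-1) e^(-c u') u'' with a primitive of (n - u') u'' would give a function that
    decreases strictly although its limits at both ends agree ([cao_const_gt0]).
    Finally Q / (u'^(n-1) e^(c u')) is strictly decreasing, while Q tends to k at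
    -oo and to -k at +oo, so Q has exactly one zero ([log_volume_rate_sign]); it
    gives the radius r2.

    That the inclusion is an embedding rests on compactness and on a continuous map
    from the bundle to a space of matrices, built from the monomials of degree k in
    z, which separates the points of the lens space ([sepN_inj]). Non-minimality is
    a statement about charts; stereographic coordinates near a pole supply one
    ([lens_chart_exists]). *)

(** * Smooth functions on open sets *)

Section NearEq.
Variables (R : realType) (V W : normedModType R).

Lemma near_eq_differentiable (f g : V -> W) x :
  (\near x, f x = g x) -> differentiable f x -> differentiable g x.
Proof.
move=> fg df; have [cdf fE] := (diff_locallyP x f).1 df.
have gE : g \o shift x = cst (g x) + 'd f x +o_ 0 id.
  apply/eqaddoP => e e0.
  have /eqaddoP/(_ e e0) := fE.
  have : \forall h \near 0, f (h + x) = g (h + x).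
    by move: fg; rewrite (near_shift 0)/= subr0; apply: filterS => y.
  apply: filterS2 => h fgh /=.
  rewrite !fctE /= (nbhs_singleton fg) fgh; apply.
have dgE := diff_unique cdf gE.
by apply/diff_locallyP; rewrite dgE.
Qed.

End NearEq.

Section SmoothCalculus.
Variables (R : realType) (p : nat).
Implicit Types (V : normedModType R) (U : set 'rV[R]_p).

Lemma eq_on_near V U (f g : 'rV[R]_p -> V) x :
  open U -> {in U, f =1 g} -> U x -> \near x, f x = g x.
Proof.
move=> oU fg Ux; have := open_nbhs_nbhs (conj oU Ux).
by apply: filterS => y Uy; apply: fg; rewrite inE.
Qed.

Lemma Ck_on_eq V l U (f g : 'rV[R]_p -> V) :
  open U -> {in U, f =1 g} -> Ck_on l U f -> Ck_on l U g.
Proof.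
move=> oU; elim: l f g => [|l IH] f g fg /=.
  move=> cf x Ux; have fgx := eq_on_near oU fg Ux.
  have := cf x Ux; rewrite /prop_for /continuous_at (fg x (mem_set Ux)) => cfx.
  apply: cvg_trans cfx; apply: (@near_eq_cvg _ _ (nbhs x)).
  by move: fgx; apply: filterS => y ->.
move=> [df pf]; split=> [x Ux|i].
  by apply: near_eq_differentiable (df x Ux); exact: eq_on_near oU fg Ux.
apply: IH (pf i) => x; rewrite inE => Ux.
exact/near_eq_derive/(eq_on_near oU fg Ux).
Qed.

Lemma Ck_on_pred V l U (f : 'rV[R]_p -> V) : Ck_on l.+1 U f -> Ck_on l U f.
Proof.
elim: l f => [|l IH] f [df pf] /=; last by split=> // i; exact: IH.
by move=> x Ux; exact/differentiable_continuous/df.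
Qed.

Lemma Ck_on_sub V l U U' (f : 'rV[R]_p -> V) :
  U' `<=` U -> Ck_on l U f -> Ck_on l U' f.
Proof.
move=> sU; elim: l f => [|l IH] f /=; first by move=> cf x /sU; exact: cf.
by move=> [df pf]; split=> [x /sU|i]; [exact: df|exact: IH].
Qed.

Lemma Ck_on_cst V l U (a : V) : Ck_on l U (cst a : 'rV[R]_p -> V).
Proof.
elim: l a => [|l IH] a /=; first by move=> x _; exact: cst_continuous.
split=> [x _|i]; first exact: differentiable_cst.
have -> : partial i (cst a : 'rV[R]_p -> V) = cst 0.
  by apply/funext => x; rewrite /partial derive_cst.
exact: IH.
Qed.

Lemma Ck_onD V l U (f g : 'rV[R]_p -> V) :
  open U -> Ck_on l U f -> Ck_on l U g -> Ck_on l U (fun x => f x + g x).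
Proof.
move=> oU; elim: l f g => [|l IH] f g /=.
  by move=> cf cg x Ux; apply: continuousD; [exact: cf|exact: cg].
move=> [df pf] [dg pg]; split=> [x Ux|i].
  by apply: differentiableD; [exact: df|exact: dg].
apply: Ck_on_eq (IH _ _ (pf i) (pg i)) => // x; rewrite inE => Ux.
by rewrite /partial deriveD//; apply: diff_derivable; [exact: df|exact: dg].
Qed.

Lemma Ck_onZ V l U (f : 'rV[R]_p -> R) (v : V) :
  open U -> Ck_on l U f -> Ck_on l U (fun x => f x *: v).
Proof.
move=> oU; elim: l f => [|l IH] f /=.
  by move=> cf x Ux; apply: continuousZl; exact: cf.
move=> [df pf]; split=> [x Ux|i].
  by apply: differentiableZl; exact: df.
apply: Ck_on_eq (IH _ (pf i)) => // x; rewrite inE => Ux.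
have dfx := df x Ux.
rewrite /partial (deriveE _ (differentiableZl v dfx)) (deriveE _ dfx).
by rewrite diffZl.
Qed.

Lemma Ck_onM l U (f g : 'rV[R]_p -> R) :
  open U -> Ck_on l U f -> Ck_on l U g -> Ck_on l U (fun x => f x * g x).
Proof.
move=> oU; elim: l f g => [|l IH] f g /=.
  by move=> cf cg x Ux; apply: continuousM; [exact: cf|exact: cg].
move=> cf cg; have [df pf] := cf; have [dg pg] := cg; split=> [x Ux|i].
  by apply: differentiableM; [exact: df|exact: dg].
have cf' := Ck_on_pred cf; have cg' := Ck_on_pred cg.
apply: Ck_on_eq (Ck_onD oU (IH _ _ cf' (pg i)) (IH _ _ cg' (pf i))) => // x.
rewrite inE => Ux; rewrite /partial deriveM//; apply: diff_derivable.
  exact: df.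
exact: dg.
Qed.

(** Induction on the order: the derivative of 1/f is - f' (1/f)^2, a product of
    functions of which the induction hypothesis and [Ck_onM] give the regularity. *)
Lemma Ck_onV l U (f : 'rV[R]_p -> R) :
  open U -> (forall x, U x -> f x != 0) ->
  Ck_on l U f -> Ck_on l U (fun x => (f x)^-1).
Proof.
move=> oU f0; elim: l => [|l IH] /=.
  by move=> cf x Ux; apply: continuousV; [exact: f0|exact: cf].
move=> cf; have [df pf] := cf; split=> [x Ux|i].
  by apply: differentiableV; [exact: df|exact: f0].
have ciV := IH (Ck_on_pred cf).
have := Ck_onM oU (Ck_on_cst l U (-1 : R)) (Ck_onM oU (Ck_onM oU ciV ciV) (pf i)).
apply: Ck_on_eq => // x; rewrite inE => Ux.
rewrite /partial deriveV ?f0//; last exact/diff_derivable/df.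
by rewrite -expr2 mulN1r scaleNr exprVn.
Qed.

Lemma smooth_on_eq V U (f g : 'rV[R]_p -> V) :
  open U -> {in U, f =1 g} -> smooth_on U f -> smooth_on U g.
Proof. by move=> oU fg sf l; exact: Ck_on_eq oU fg (sf l). Qed.

Lemma smooth_on_sub V U U' (f : 'rV[R]_p -> V) :
  U' `<=` U -> smooth_on U f -> smooth_on U' f.
Proof. by move=> sU sf l; exact: Ck_on_sub sU (sf l). Qed.

Lemma smooth_on_differentiable V U (f : 'rV[R]_p -> V) x :
  smooth_on U f -> U x -> differentiable f x.
Proof. by move=> /(_ 1%N)[df _]; exact: df. Qed.

Lemma smooth_on_partial V U (f : 'rV[R]_p -> V) i :
  smooth_on U f -> smooth_on U (partial i f).
Proof. by move=> sf l; have [_ pf] := sf l.+1; exact: pf. Qed.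

Lemma smooth_on_cst V U (a : V) : smooth_on U (cst a : 'rV[R]_p -> V).
Proof. by move=> l; exact: Ck_on_cst. Qed.

Lemma smooth_onD V U (f g : 'rV[R]_p -> V) : open U ->
  smooth_on U f -> smooth_on U g -> smooth_on U (fun x => f x + g x).
Proof. by move=> oU sf sg l; exact: Ck_onD. Qed.

Lemma smooth_onM U (f g : 'rV[R]_p -> R) : open U ->
  smooth_on U f -> smooth_on U g -> smooth_on U (fun x => f x * g x).
Proof. by move=> oU sf sg l; exact: Ck_onM. Qed.

Lemma smooth_onV U (f : 'rV[R]_p -> R) : open U ->
  (forall x, U x -> f x != 0) ->
  smooth_on U f -> smooth_on U (fun x => (f x)^-1).
Proof. by move=> oU f0 sf l; exact: Ck_onV. Qed.

Lemma smooth_onN U (f : 'rV[R]_p -> R) : open U ->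
  smooth_on U f -> smooth_on U (fun x => - f x).
Proof.
move=> oU sf; have := smooth_onM oU (smooth_on_cst U (-1 : R)) sf.
by apply: smooth_on_eq => // x _; rewrite mulN1r.
Qed.

Lemma smooth_on_sum V I (s : seq I) U (f : I -> 'rV[R]_p -> V) : open U ->
  (forall i, smooth_on U (f i)) -> smooth_on U (fun x => \sum_(i <- s) f i x).
Proof.
move=> oU sf; elim: s => [|i s IH].
  by under eq_fun do rewrite big_nil; exact: smooth_on_cst.
by under eq_fun do rewrite big_cons; exact: smooth_onD.
Qed.

Lemma smooth_on_rowP m U (f : 'rV[R]_p -> 'rV[R]_m) : open U ->
  smooth_on U f <-> (forall j, smooth_on U (fun x => f x 0 j)).
Proof.
move=> oU; split=> [sf j l|sf].
  have := sf l; elim: l f {sf} => [|l IH] f /=.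
    by move=> cf x Ux; apply: (@continuous_comp _ _ _ f (fun v : 'rV_m => v 0 j));
      [exact: cf|exact: coord_continuous].
  move=> [df pf]; split=> [x Ux|i].
    apply: (@differentiable_comp _ _ _ _ f (fun v : 'rV_m => v 0 j : R)).
      exact: df.
    exact: differentiable_coord.
  apply: Ck_on_eq (IH _ (pf i)) => // x; rewrite inE => Ux.
  by rewrite /partial derive_mx ?mxE//; exact/diff_derivable/df.
have -> : f = fun x => \sum_(j < m) f x 0 j *: delta_mx 0 j.
  by apply/funext => x; rewrite [LHS]row_sum_delta.
by apply: smooth_on_sum => // j l; apply: Ck_onZ => //; exact: sf.
Qed.

Lemma smooth_on_coord m (f : 'rV[R]_p -> 'rV[R]_m) U j : open U ->
  smooth_on U f -> smooth_on U (fun x => f x 0 j).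
Proof. by move=> oU /(smooth_on_rowP f oU); exact. Qed.

Lemma smooth_on_id_coord U j : open U -> smooth_on U (fun x : 'rV[R]_p => x 0 j).
Proof.
move=> oU; apply: smooth_on_coord => // -[|l] /=; first by move=> x _; exact: cvg_id.
split=> [x _|i]; first exact: (@ex_diff _ _ _ _ _ _ _ (is_diff_id x)).
have -> : partial i (fun x : 'rV[R]_p => x) = cst (delta_mx 0 i).
  by apply/funext => x; rewrite /partial derive_id.
exact: Ck_on_cst.
Qed.

End SmoothCalculus.

(** * Calculus on the real line *)

Section DeriveOnR.
Variable R : realType.
Implicit Types (f g : R -> R) (x : R).

Lemma is_derive_fcomp f g x df dg :
  is_derive x (1 : R) f df -> is_derive (f x) (1 : R) g dg ->
  is_derive x (1 : R) (fun y => g (f y)) (dg * df).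
Proof. by move=> hf hg; exact: (is_derive1_comp hg hf). Qed.

Lemma is_derive1M f g s df dg : is_derive s (1 : R) f df ->
  is_derive s (1 : R) g dg ->
  is_derive s (1 : R) (fun x => f x * g x) (df * g s + f s * dg).
Proof.
move=> hf hg; apply: (is_derive_eq (is_deriveM hf hg)).
by rewrite /GRing.scale/= addrC; congr (_ + _); rewrite mulrC.
Qed.

Lemma is_derive1D f g s df dg : is_derive s (1 : R) f df ->
  is_derive s (1 : R) g dg ->
  is_derive s (1 : R) (fun x => f x + g x) (df + dg).
Proof. exact: is_deriveD. Qed.

Lemma is_derive1B f g s df dg : is_derive s (1 : R) f df ->
  is_derive s (1 : R) g dg ->
  is_derive s (1 : R) (fun x => f x - g x) (df - dg).
Proof. exact: is_deriveB. Qed.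

Lemma is_derive1_cst (a : R) s : is_derive s (1 : R) (fun=> a) 0.
Proof. exact: is_derive_cst. Qed.

Lemma is_derive1Z (a : R) f s df : is_derive s (1 : R) f df ->
  is_derive s (1 : R) (fun x => a * f x) (a * df).
Proof.
move=> hf; apply: (is_derive_eq (is_derive1M (is_derive1_cst a s) hf)).
by rewrite mul0r add0r.
Qed.

Lemma is_derive1V f s df : f s != 0 -> is_derive s (1 : R) f df ->
  is_derive s (1 : R) (fun x => (f x)^-1) (- df / f s ^+ 2).
Proof.
move=> f0 [fD <-]; apply: DeriveDef; first exact: derivableV.
by rewrite deriveV// /GRing.scale/= mulNr mulrC mulNr mulrC.
Qed.

Lemma is_derive_expR_natl (k : R) s :
  is_derive s (1 : R) (fun s => expR (k * s)) (k * expR (k * s)).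
Proof.
have h : is_derive s (1 : R) (fun s => k * s) k.
  by apply: is_derive_eq; rewrite [LHS]mulr1.
by have := is_derive_fcomp h (is_derive_expR _); rewrite mulrC.
Qed.

Lemma smooth1_is_derive f l s :
  smooth1 f -> is_derive s (1 : R) (derive1n l f) (derive1n l.+1 f s).
Proof. by move=> sf; apply: DeriveDef; [exact: sf|rewrite -derive1E]. Qed.

Lemma smooth1_continuous f l : smooth1 f -> continuous (derive1n l f).
Proof.
by move=> sf s; apply/differentiable_continuous/derivable1_diffP; exact: sf.
Qed.

Lemma cvg_expR_Ny (k : nat) : (0 < k)%N -> expR (k%:R * s) @[s --> -oo] --> (0 : R).
Proof.
move=> k0; apply/cvgNy_compNP.
have -> : (fun s : R => expR (k%:R * s)) \o -%R = fun s : R => expR (- s) ^+ k.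
  by apply/funext => s /=; rewrite expRM_natl.
have := continuous_cvg _ (@exprn_continuous R k 0) (@cvgr_expR R).
by rewrite expr0n gtn_eqF// => /(_ _); exact.
Qed.

Lemma cvg_expRN_y (k : nat) : (0 < k)%N -> expR (- (k%:R * s)) @[s --> +oo] --> (0 : R).
Proof.
move=> k0; have /cvgNy_compNP := cvg_expR_Ny k0.
have -> : (fun s : R => expR (k%:R * s)) \o -%R = fun s : R => expR (- (k%:R * s)).
  by apply/funext => s /=; rewrite mulrN.
by [].
Qed.

(** The profile has the form a s + h (e^(b s)) near each end, with (a, b) equal to
    (n - k, k) or (n + k, - k); this lemma and the next give its first two
    derivatives. *)
Lemma is_derive_end (a b : R) h s : smooth1 h ->
  is_derive s (1 : R) (fun s => a * s + h (expR (b * s)))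
   (a + b * (expR (b * s) * derive1n 1 h (expR (b * s)))).
Proof.
move=> sh; have h1 := is_derive_fcomp (is_derive_expR_natl b s)
  (smooth1_is_derive 0 (expR (b * s)) sh).
apply: is_derive_eq; rewrite [X in X + _ = _]mulr1; congr (_ + _).
by rewrite mulrCA mulrA [LHS]mulrC mulrCA.
Qed.
Lemma is_derive_end2 (a b : R) h s : smooth1 h ->
  is_derive s (1 : R) (fun s => a + b * (expR (b * s) * derive1n 1 h (expR (b * s))))
   (b ^+ 2 * (expR (b * s) * (derive1n 1 h (expR (b * s)) +
        expR (b * s) * derive1n 2 h (expR (b * s))))).
Proof.
move=> sh; have h0 := is_derive_expR_natl b s.
have h1 := is_derive_fcomp h0 (smooth1_is_derive 1 (expR (b * s)) sh).
by apply: is_derive_eq; rewrite add0r /GRing.scale/=; ring.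
Qed.

Lemma is_derive_continuous f df s : is_derive s (1 : R) f df -> {for s, continuous f}.
Proof. by move=> [fD _]; apply/differentiable_continuous/derivable1_diffP. Qed.

Lemma is_derive_decr f df a b : (forall s, is_derive s (1 : R) f (df s)) ->
  (forall s, a < s < b -> df s < 0) -> a < b -> f b < f a.
Proof.
move=> fD df0 ab; apply: (@ltr0_derive1_decr R f a b) => //.
- by move=> x; rewrite in_itv/= => /df0; rewrite derive1E derive_val.
- by apply: continuous_subspaceT => x; exact: is_derive_continuous (fD x).
Qed.

Lemma is_derive_nincr f df a b : (forall s, is_derive s (1 : R) f (df s)) ->
  (forall s, df s <= 0) -> a <= b -> f b <= f a.
Proof.
move=> fD df0 ab; apply: (@ler0_derive1_nincr R f a b) => //.
- by move=> x; rewrite in_itv/= derive1E derive_val.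
- by apply: continuous_subspaceT => x; exact: is_derive_continuous (fD x).
Qed.

End DeriveOnR.

(** * The profile equation *)

Section CaoProfile.
Variables (R : realType) (n k : nat) (u : R -> R) (c : R).
Hypotheses (hn : (2 <= n)%N) (hk : (1 <= k <= n - 1)%N).
Hypothesis hu : cao_profile n k u c.

Let u1 : R -> R := derive1 u.
Let u2 : R -> R := derive1n 2 u.
Let u3 : R -> R := derive1n 3 u.

Let du1 s : is_derive s (1 : R) u (u1 s).
Proof. exact: smooth1_is_derive 0 s (cao_smooth hu). Qed.
Let du2 s : is_derive s (1 : R) u1 (u2 s).
Proof. exact: smooth1_is_derive 1 s (cao_smooth hu). Qed.
Let du3 s : is_derive s (1 : R) u2 (u3 s).
Proof. exact: smooth1_is_derive 2 s (cao_smooth hu). Qed.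

Let u1_gt0 s : 0 < u1 s. Proof. exact: cao_d1 hu s. Qed.
Let u2_gt0 s : 0 < u2 s. Proof. exact: cao_d2 hu s. Qed.
Let u1_neq0 s : u1 s != 0. Proof. by rewrite gt_eqF. Qed.
Let u2_neq0 s : u2 s != 0. Proof. by rewrite gt_eqF. Qed.

(* the profile equation, solved for u''' *)
Let u3E s : u3 s = u2 s * (n%:R - u1 s - ((n%:R - 1) / u1 s - c) * u2 s).
Proof.
have /(canRL (addrK _)) E := cao_ode hu s.
by rewrite -/(u1 s) -/(u2 s) -/(u3 s) in E; rewrite -E mulrC divfK.
Qed.

(** u' tends to the slope of the asymptote and u'' to 0: both corrections carry a
    factor e^(b s), which tends to 0. *)
Lemma profile_end_cvg (a b : R) h (F : set_system R) : ProperFilter F ->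
  smooth1 h -> u = (fun s => a * s + h (expR (b * s))) ->
  expR (b * s) @[s --> F] --> (0 : R) ->
  u1 s @[s --> F] --> a /\ u2 s @[s --> F] --> (0 : R).
Proof.
move=> FF sh uE E0.
have u1E : u1 = fun s => a + b * (expR (b * s) * derive1n 1 h (expR (b * s))).
  apply/funext => s; rewrite /u1 derive1E uE.
  by have /@derive_val := @is_derive_end R a b h s sh.
have u2E : u2 = fun s => b ^+ 2 * (expR (b * s) * (derive1n 1 h (expR (b * s)) +
        expR (b * s) * derive1n 2 h (expR (b * s)))).
  apply/funext => s; rewrite -[u2 s]/(derive1 u1 s) derive1E u1E.
  by have /@derive_val := @is_derive_end2 R a b h s sh.
have hc l : (derive1n l h) (expR (b * s)) @[s --> F] --> (derive1n l h 0).
  exact: (continuous_cvg _ (smooth1_continuous sh (x:=0)) E0).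
split.
- rewrite u1E; have : (a + b * (expR (b * s) * derive1n 1 h (expR (b * s)))) @[s --> F]
      --> a + b * (0 * derive1n 1 h 0).
    by apply: cvgD; [exact: cvg_cst|apply: cvgM; [exact: cvg_cst|exact: cvgM]].
  by rewrite mul0r mulr0 addr0.
- rewrite u2E; have : (b ^+ 2 * (expR (b * s) * (derive1n 1 h (expR (b * s)) +
      expR (b * s) * derive1n 2 h (expR (b * s))))) @[s --> F]
      --> b ^+ 2 * (0 * (derive1n 1 h 0 + 0 * derive1n 2 h 0)).
    apply: cvgM; first exact: cvg_cst.
    by apply: cvgM => //; apply: cvgD => //; exact: cvgM.
  by rewrite !mul0r mulr0.
Qed.

Lemma profile_cvg_Ny :
  u1 s @[s --> -oo] --> (n%:R - k%:R : R) /\ u2 s @[s --> -oo] --> (0 : R).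
Proof.
have [h [sh _ _ uE]] := cao_minus hu.
apply: (@profile_end_cvg _ k%:R _ _ _ sh); first exact/funext.
by apply: cvg_expR_Ny; case/andP: hk.
Qed.

Lemma profile_cvg_y :
  u1 s @[s --> +oo] --> (n%:R + k%:R : R) /\ u2 s @[s --> +oo] --> (0 : R).
Proof.
have [h [sh _ _ uE]] := cao_plus hu.
apply: (@profile_end_cvg _ (- k%:R) _ _ _ sh).
  by apply/funext => s; rewrite uE mulNr.
under eq_fun do rewrite mulNr.
by apply: cvg_expRN_y; case/andP: hk.
Qed.

(* With x = u' as variable and y = u'', the profile equation is linear and [kap] is
   its integrating factor: d (kap y) / dx = (n - x) kap. *)
Let kap (x : R) := x ^+ (n - 1) * expR (- (c * x)).

Lemma is_derive_kap x : x != 0 ->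
  is_derive x (1 : R) kap (kap x * ((n%:R - 1) / x - c)).
Proof.
move=> x0; have hl : is_derive x (1 : R) (fun x => - c * x) (- c).
  by apply: is_derive_eq; rewrite [LHS]mulr1.
have he := is_derive_fcomp hl (is_derive_expR _).
have -> : kap = fun x => x ^+ (n - 1) * expR (- c * x).
  by apply/funext => y; rewrite mulNr.
have -> : n%:R - 1 = (n - 1)%:R :> R by rewrite natrB// (leq_trans _ hn).
have : (0 < n - 1)%N by rewrite subn_gt0.
case: (n - 1)%N he => [//|m] he _.
have hp : is_derive x (1 : R) (fun x => x ^+ m.+1) (m.+1%:R * x ^+ m).
  apply: DeriveDef; first exact: exprn_derivable.
  by rewrite exp_derive /GRing.scale/= mulr1.
apply: (is_derive_eq (is_deriveM hp he)); rewrite /GRing.scale/= !exprS.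
by field.
Qed.

Lemma profile_weight s : is_derive s (1 : R) (fun s => kap (u1 s) * u2 s)
  (kap (u1 s) * u2 s * (n%:R - u1 s)).
Proof.
have h := is_derive_fcomp (du2 s) (is_derive_kap (u1_neq0 s)).
apply: (is_derive_eq (is_deriveM h (du3 s))).
rewrite /GRing.scale/= u3E; field.
exact: u1_neq0.
Qed.

(* for c <= 0 both factors of the weight are nondecreasing *)
Let kap_incr x y : c <= 0 -> 0 < x -> x < y -> kap x < kap y.
Proof.
move=> c0 x0 xy; have y0 := lt_trans x0 xy.
have nx : x ^+ (n - 1) < y ^+ (n - 1).
  by rewrite ltr_pXn2r ?nnegrE ?ltW ?subn_gt0.
have ex : expR (- (c * x)) <= expR (- (c * y)).
  by rewrite ler_expR lerN2 ler_wnM2l// ltW.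
apply: (@lt_le_trans _ _ (y ^+ (n - 1) * expR (- (c * x)))).
  by rewrite ltr_pM2r ?expR_gt0.
by rewrite ler_pM2l// exprn_gt0.
Qed.

Let kap_continuous x : x != 0 -> {for x, continuous kap}.
Proof.
by move=> x0; exact: is_derive_continuous (is_derive_kap x0).
Qed.

Let n_gt0 : 0 < n%:R :> R. Proof. by rewrite ltr0n (leq_trans _ hn). Qed.
Let k_gt0 : 0 < k%:R :> R. Proof. by rewrite ltr0n; case/andP: hk. Qed.
Let k_ltn : k%:R < n%:R :> R.
Proof.
rewrite ltr_nat; case/andP: hk => _ kn; apply: leq_ltn_trans kn _.
by rewrite ltn_subrL (leq_trans _ hn).
Qed.

(** If c <= 0 then [kap] is increasing, so (kap (u') - kap n) (n - u') <= 0 and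
    kap (u') u'' - kap n (n u' - u'^2 / 2) is nonincreasing. Its limits at the ends
    are - kap n times the values of n x - x^2 / 2 at n - k and n + k, which agree
    because that polynomial is symmetric about n; but it decreases strictly
    wherever u' > n. *)
Lemma cao_const_gt0 : 0 < c.
Proof.
rewrite ltNge; apply/negP => c0.
pose K0 := kap n%:R.
pose M s := kap (u1 s) * u2 s - K0 * (n%:R * u1 s - u1 s * u1 s / 2).
have dM s : is_derive s (1 : R) M
    ((kap (u1 s) - K0) * u2 s * (n%:R - u1 s)).
  have h2 : is_derive s (1 : R) (fun s => K0 * (n%:R * u1 s - u1 s * u1 s / 2))
      (K0 * u2 s * (n%:R - u1 s)).
    have h1 := is_derive1M (du2 s) (du2 s).
    have := is_derive1Z K0 (is_derive1B (is_derive1Z n%:R (du2 s))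
      (is_derive1M h1 (is_derive1_cst 2^-1 s))).
    by move/is_derive_eq; apply; field.
  apply: (is_derive_eq (is_derive1B (profile_weight s) h2)).
  by rewrite -mulrBl -mulrBl.
have dM_lt0 s : u1 s != n%:R -> (kap (u1 s) - K0) * u2 s * (n%:R - u1 s) < 0.
  move=> un; have [lt|gt|/eqP] := ltgtP (u1 s) n%:R; last by rewrite (negPf un).
    rewrite nmulr_rlt0 ?subr_gt0// nmulr_rlt0 ?u2_gt0// subr_lt0.
    exact: kap_incr.
  rewrite nmulr_llt0 ?subr_lt0// mulr_gt0// subr_gt0.
  exact: kap_incr.
have dM_le0 s : (kap (u1 s) - K0) * u2 s * (n%:R - u1 s) <= 0.
  by have [->|/dM_lt0/ltW//] := eqVneq (u1 s) n%:R; rewrite [n%:R - _]subrr mulr0.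
have M_cvg a (F : set_system R) : ProperFilter F -> a != 0 ->
    u1 s @[s --> F] --> a -> u2 s @[s --> F] --> (0 : R) ->
    M s @[s --> F] --> - (K0 * (n%:R * a - a * a / 2)).
  move=> FF a0 h1 h2.
  have : M s @[s --> F] --> kap a * 0 - (K0 * (n%:R * a - a * a / 2)).
    apply: cvgB.
      by apply: cvgM => //; exact: (continuous_cvg _ (kap_continuous a0) h1).
    apply: cvgM; first exact: cvg_cst.
    apply: cvgB; first by apply: cvgM => //; exact: cvg_cst.
    by apply: cvgM; [exact: cvgM|exact: cvg_cst].
  by rewrite mulr0 sub0r.
have [u1y u2y] := profile_cvg_y; have [u1N u2N] := profile_cvg_Ny.
have MN := M_cvg _ _ _ _ u1N u2N.
have My := M_cvg _ _ _ _ u1y u2y.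
have [s1 s1n] : exists s, forall t, s <= t -> n%:R < u1 t.
  have : \forall s \near +oo, n%:R < u1 s.
    by apply: cvgr_gt u1y _ _; rewrite ltrDl.
  by case=> s [_ sP]; exists (s + 1) => t st; apply: sP; rewrite (lt_le_trans _ st)// ltrDl.
(* beyond s1, u' > n and the decrease is strict *)
have lt1 : M (s1 + 1) < M s1.
  apply: (is_derive_decr dM); last by rewrite ltrDl.
  by move=> s /andP[/ltW/s1n nu _]; apply: dM_lt0; rewrite gt_eqF.
have leN : M s1 <= - (K0 * (n%:R * (n%:R - k%:R) - (n%:R - k%:R) * (n%:R - k%:R) / 2)).
  apply: (cvgr_to_ge (MN _ _)); rewrite ?gt_eqF ?subr_gt0//.
  exists s1; split; first exact: num_real.
  by move=> s ss1; apply: (is_derive_nincr dM) => //; exact: ltW.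
have ley : - (K0 * (n%:R * (n%:R + k%:R) - (n%:R + k%:R) * (n%:R + k%:R) / 2))
    <= M (s1 + 1).
  apply: (cvgr_to_le (My _ _)); rewrite ?gt_eqF ?addr_gt0//.
  exists (s1 + 1); split; first exact: num_real.
  by move=> s ss1; apply: (is_derive_nincr dM) => //; exact: ltW.
have := le_lt_trans ley (lt_le_trans lt1 leN).
apply/negP; rewrite -leNgt le_eqVlt; apply/orP; left; apply/eqP; congr (- (_ * _)).
by field.
Qed.

(** The logarithmic derivative of u'^(2n-2) u'', which is proportional to the
    determinant of the induced metric of the spheres. *)
Definition log_volume_rate s := (2 * n%:R - 2) * u2 s / u1 s + u3 s / u2 s.
Let Q := log_volume_rate.

Let QE s : Q s = (n%:R - 1) * u2 s / u1 s + n%:R - u1 s + c * u2 s.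
Proof. by rewrite /Q /log_volume_rate u3E; field; rewrite u1_neq0 u2_neq0. Qed.

(** By the profile equation Q' = a Q - b with a = A'/A, A = u'^(n-1) e^(c u'), and
    b > 0 (here c > 0 enters). So (Q / A)' = - b / A < 0, and Q / A has the sign
    of Q; at the ends Q tends to k and to - k. *)
Lemma log_volume_rate_sign : exists s0, [/\ Q s0 = 0,
  forall s, s < s0 -> 0 < Q s & forall s, s0 < s -> Q s < 0].
Proof.
have c_gt0 := cao_const_gt0.
pose A s := u1 s ^+ (n - 1) * expR (c * u1 s).
pose a s := u2 s * ((n%:R - 1) / u1 s + c).
pose b s := (2 * n%:R - 2) * (u2 s ^+ 2 / u1 s) * ((n%:R - 1) / u1 s + c)
   + (n%:R - 1) * (u2 s / u1 s) ^+ 2 + u2 s.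
have n1 : 0 < n%:R - 1 :> R by rewrite subr_gt0 ltr1n.
have b_gt0 s : 0 < b s.
  have q1 : 0 <= 2 * n%:R - 2 :> R by have := n1; lra.
  have q2 : 0 <= u2 s ^+ 2 / u1 s by rewrite divr_ge0 ?sqr_ge0 ?ltW.
  have q3 : 0 <= (n%:R - 1) / u1 s + c by rewrite addr_ge0 ?divr_ge0 ?ltW.
  rewrite /b; apply: ltr_wpDl => //; apply: addr_ge0.
    exact: mulr_ge0 (mulr_ge0 q1 q2) q3.
  by apply: mulr_ge0; [exact: ltW|exact: sqr_ge0].
have A_gt0 s : 0 < A s by rewrite mulr_gt0 ?expR_gt0 ?exprn_gt0.
have dA s : is_derive s (1 : R) A (A s * a s).
  have hx : is_derive (u1 s) (1 : R) (fun x : R => x ^+ (n - 1))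
      ((n - 1)%:R * u1 s ^+ (n - 1).-1).
    apply: DeriveDef; first exact: exprn_derivable.
    by rewrite exp_derive /GRing.scale/= mulr1.
  have he := is_derive_fcomp (is_derive1Z c (du2 s)) (is_derive_expR _).
  apply: (is_derive_eq (is_derive1M (is_derive_fcomp (du2 s) hx) he)).
  rewrite /A /a natrB 1?(leq_trans _ hn)//.
  have : (0 < n - 1)%N by rewrite subn_gt0.
  by case: (n - 1)%N => // m _; rewrite exprS/=; field.
have dQ s : is_derive s (1 : R) Q (a s * Q s - b s).
  have h1 := is_derive1M (is_derive1Z (n%:R - 1) (du3 s))
    (is_derive1V (u1_neq0 s) (du2 s)).
  have h2 := is_derive1D (is_derive1B (is_derive1D h1 (is_derive1_cst n%:R s))
     (du2 s)) (is_derive1Z c (du3 s)).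
  have -> : Q = fun s => (n%:R - 1) * u2 s / u1 s + n%:R - u1 s + c * u2 s.
    exact/funext.
  apply: (is_derive_eq h2); rewrite u3E /a /b; field.
  exact: u1_neq0.
pose N s := Q s / A s.
have dN s : is_derive s (1 : R) N (- (b s / A s)).
  have hV := is_derive1V (lt0r_neq0 (A_gt0 s)) (dA s).
  apply: (is_derive_eq (is_derive1M (dQ s) hV)).
  by field; rewrite gt_eqF.
have N_decr s t : s < t -> N t < N s.
  apply: (is_derive_decr dN) => x _.
  by rewrite oppr_lt0 divr_gt0.
have QN s : Q s = N s * A s by rewrite divfK// gt_eqF.
have [u1y u2y] := profile_cvg_y; have [u1N u2N] := profile_cvg_Ny.
have Q_cvg x (F : set_system R) : ProperFilter F -> x != 0 ->
    u1 s @[s --> F] --> x -> u2 s @[s --> F] --> (0 : R) ->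
    Q s @[s --> F] --> n%:R - x.
  move=> FF x0 h1 h2.
  have -> : Q = fun s => (n%:R - 1) * u2 s / u1 s + n%:R - u1 s + c * u2 s.
    exact/funext.
  have : ((n%:R - 1) * u2 s / u1 s + n%:R - u1 s + c * u2 s) @[s --> F] -->
    (n%:R - 1) * 0 / x + n%:R - x + c * 0.
    have hc (y : R) : y @[_ --> F] --> y by exact: cvg_cst.
    apply: cvgD; last exact: cvgM.
    apply: cvgB => //; apply: cvgD => //; apply: cvgM; first exact: cvgM.
    exact: cvgV.
  by rewrite !mulr0 mul0r add0r addr0.
have [s1 s1Q] : exists s, Q s < 0.
  have : \forall s \near +oo, Q s < 0.
    apply: cvgr_lt (Q_cvg _ _ _ _ u1y u2y) _ _; first by rewrite gt_eqF// addr_gt0.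
    by rewrite opprD addrA subrr sub0r oppr_lt0.
  by case=> s [_ sP]; exists (s + 1); apply: sP; rewrite ltrDl.
have [s2 s2Q] : exists s, 0 < Q s.
  have : \forall s \near -oo, 0 < Q s.
    apply: cvgr_gt (Q_cvg _ _ _ _ u1N u2N) _ _; first by rewrite gt_eqF// subr_gt0.
    by rewrite opprB addrC subrK.
  by case=> s [_ sP]; exists (s - 1); apply: sP; rewrite gtrDl oppr_lt0.
have N_gt0 s : (0 < Q s) = (0 < N s) by rewrite QN pmulr_lgt0.
have N_lt0 s : (Q s < 0) = (N s < 0) by rewrite QN pmulr_llt0.
have s21 : s2 <= s1.
  rewrite leNgt; apply/negP => /N_decr; rewrite N_gt0 in s2Q; rewrite N_lt0 in s1Q.
  by move=> /lt_trans/(_ s1Q)/(lt_trans s2Q); rewrite ltxx.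
have [s0 _ s0Q] : exists2 s, s \in `[s2, s1]%R & Q s = 0.
  apply: (@IVT R Q s2 s1 0) => //.
    by apply: continuous_subspaceT => x; exact: is_derive_continuous (dQ x).
  move: (ltW s1Q) (ltW s2Q); move: (Q s1) (Q s2) => q1 q2 q1_le0 q2_ge0.
  by rewrite ge_min le_max q1_le0 q2_ge0 orbT.
have s0N : N s0 = 0 by rewrite /N s0Q mul0r.
exists s0; split; first exact: s0Q.
  by move=> s /N_decr; rewrite s0N => Ns; rewrite (N_gt0 s).
by move=> s /N_decr; rewrite s0N => Ns; rewrite (N_lt0 s).
Qed.

(** This is where the profile equation becomes geometry: P' = c u'' will give
    grad f = c E. *)
Lemma derive_soliton_potential s :
  is_derive s (1 : R) (soliton_potential n u) (c * u2 s).
Proof.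
have h1 := is_derive_fcomp (du2 s) (is_derive1_ln (u1_gt0 s)).
have h2 := is_derive_fcomp (du3 s) (is_derive1_ln (u2_gt0 s)).
have h0 := is_derive1Z (- n%:R) (is_derive_id s (1 : R)).
have := is_derive1D (is_derive1D (is_derive1D h0 (is_derive1Z (n%:R - 1) h1)) h2) (du1 s).
rewrite (_ : (fun x => _) = soliton_potential n u).
  move/is_derive_eq; apply; rewrite u3E; field.
  by rewrite u1_neq0 u2_neq0.
by apply/funext => x; rewrite /soliton_potential mulNr.
Qed.

End CaoProfile.

(** * The metric of a radial Kaehler potential *)

Lemma mx11_trE (R : Type) (M : 'M[R]_1) : M 0 0 = M^T 0 0.
Proof. by rewrite mxE. Qed.

Lemma dot_delta (R : pzSemiRingType) m (y : 'rV[R]_m) l :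
  (y *m (delta_mx 0 l : 'rV[R]_m)^T) 0 0 = y 0 l.
Proof. by rewrite trmx_delta -colE mxE. Qed.

Lemma mulmx_entry (R : pzSemiRingType) p m (J : 'M[R]_(p, m)) (v : 'rV[R]_m) i :
  (J *m v^T) i 0 = ((delta_mx 0 i : 'rV[R]_p) *m J *m v^T) 0 0.
Proof. by rewrite -rowE -row_mul [RHS]mxE. Qed.

Section Radial.
Variables (R : realType) (m : nat).
Implicit Types (x v : 'rV[R]_m).

Lemma smooth_on_sqnorm (U : set 'rV[R]_m) : open U -> smooth_on U (@sqnorm R m).
Proof.
move=> oU; rewrite /sqnorm; apply: smooth_on_sum => // i.
under eq_fun do rewrite expr2.
by apply: smooth_onM => //; exact: smooth_on_id_coord.
Qed.

Lemma differentiable_sqnorm x : differentiable (@sqnorm R m) x.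
Proof. exact: smooth_on_differentiable (smooth_on_sqnorm openT) _. Qed.

Lemma is_derive_coord (i : 'I_m) x v :
  is_derive x v (fun y : 'rV[R]_m => y 0 i : R) (v 0 i).
Proof.
have dx : derivable (id : 'rV[R]_m -> 'rV[R]_m) x v by exact: derivable_id.
apply: DeriveDef; first by have /derivable_mxP := dx; exact.
by have := derive_mx dx; rewrite derive_id => /matrixP/(_ 0 i); rewrite mxE.
Qed.

Lemma is_derive_sqnorm x v :
  is_derive x v (@sqnorm R m) (2 * (x *m v^T) 0 0).
Proof.
have dX i : is_derive x v (fun y : 'rV[R]_m => y 0 i ^+ 2 : R) (2 * (x 0 i * v 0 i)).
  have h := is_deriveM (is_derive_coord i x v) (is_derive_coord i x v).
  by apply: (is_derive_eq h); rewrite /GRing.scale/=; ring.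
have := is_derive_sum dX.
rewrite (_ : \sum_(i < m) _ = @sqnorm R m); last first.
  by apply/funext => y; rewrite fct_sumE.
move/is_derive_eq; apply; rewrite mxE mulr_sumr; apply: eq_bigr => i _.
by rewrite mxE.
Qed.

Lemma is_derive_compR (V : normedModType R) (f : V -> R) (g : R -> R) y w dg :
  differentiable f y -> is_derive (f y) (1 : R) g dg ->
  is_derive y w (fun t => g (f t)) (dg * 'D_w f y).
Proof.
move=> df [gD dgE]; have gd : differentiable g (f y) by apply/derivable1_diffP.
have cd := differentiable_comp df gd.
apply: DeriveDef; first exact: diff_derivable.
rewrite (deriveE _ cd) diff_comp//= (deriveE _ df) (deriv1E gD) derive1E dgE.
by rewrite /GRing.scale/= mulrC.
Qed.

Lemma is_derive_radial (g : R -> R) x v dg :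
  is_derive (sqnorm x) (1 : R) g dg ->
  is_derive x v (fun y => g (sqnorm y)) (dg * (2 * (x *m v^T) 0 0)).
Proof.
move=> hg; have := is_derive_compR v (differentiable_sqnorm x) hg.
by have /@derive_val -> := is_derive_sqnorm x v.
Qed.

Lemma sqnorm_ge0 x : 0 <= sqnorm x.
Proof. by apply: sumr_ge0 => i _; exact: sqr_ge0. Qed.

Lemma sqnorm_gt0 x : (0 < sqnorm x) = (x != 0).
Proof.
rewrite lt_def sqnorm_ge0 andbT; congr (~~ _).
rewrite psumr_eq0; last by move=> i _; exact: sqr_ge0.
apply/allP/eqP => [h|-> i _]; last by rewrite mxE expr0n eqxx implybT.
apply/rowP => i; rewrite mxE; apply/eqP.
by have := h i (mem_index_enum _); rewrite /= sqrf_eq0.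
Qed.

Lemma sqnormE x : sqnorm x = (x *m x^T) 0 0.
Proof. by rewrite mxE; apply: eq_bigr => i _; rewrite mxE expr2. Qed.

Lemma sqnormZ a x : sqnorm (a *: x) = a ^+ 2 * sqnorm x.
Proof. by rewrite mulr_sumr; apply: eq_bigr => i _; rewrite mxE exprMn. Qed.

Lemma open_punctured : open [set x : 'rV[R]_m | x != 0].
Proof.
have -> : [set x : 'rV[R]_m | x != 0] = @sqnorm R m @^-1` [set t | 0 < t].
  by apply/seteqP; split=> x; rewrite /= sqnorm_gt0.
apply: open_comp; last exact: open_gt.
by move=> x _; exact/differentiable_continuous/differentiable_sqnorm.
Qed.

Lemma partial_radial2 (g g' : R -> R) (dg' : R) x i j : x != 0 ->
  (forall t : R, 0 < t -> is_derive t (1 : R) g (g' t)) ->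
  is_derive (sqnorm x) (1 : R) g' dg' ->
  partial j (partial i (fun y => g (sqnorm y))) x =
  4 * dg' * (x 0 j * x 0 i) + 2 * g' (sqnorm x) * (i == j)%:R.
Proof.
move=> x0 hg hg'.
have E : \near x, g' (sqnorm x) * (2 * x 0 i) = partial i (fun y => g (sqnorm y)) x.
  have := open_nbhs_nbhs (conj open_punctured x0); apply: filterS => y /= y0.
  rewrite /partial; rewrite -sqnorm_gt0 in y0.
  by have /@derive_val -> := is_derive_radial (delta_mx 0 i) (hg _ y0); rewrite dot_delta.
rewrite {1}/partial -(near_eq_derive _ E).
have h1 := is_derive_radial (delta_mx 0 j) hg'.
have h2 := is_deriveZ 2 (is_derive_coord i x (delta_mx 0 j)).
have /@derive_val := is_deriveM h1 h2; rewrite /GRing.scale/= => ->.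
by rewrite dot_delta mxE eqxx/= /GRing.scale/=; ring.
Qed.

End Radial.

Section KahlerMetric.
Variables (R : realType) (n : nat).
Implicit Types (x v w : 'rV[R]_(n + n)).

Lemma mulJl x (a : 'I_n) : mulJ x 0 (lshift n a) = - x 0 (rshift n a).
Proof. by rewrite row_mxEl mxE /zc/= mul0r mul1r add0r. Qed.

Lemma mulJr x (a : 'I_n) : mulJ x 0 (rshift n a) = x 0 (lshift n a).
Proof. by rewrite row_mxEr mxE /zc/= mul0r mul1r add0r. Qed.

Lemma mulJ_sqnorm x : sqnorm (mulJ x) = sqnorm x.
Proof.
rewrite /sqnorm !big_split_ord/= addrC; congr (_ + _); apply: eq_bigr => i _.
  by rewrite mulJr.
by rewrite mulJl sqrrN.
Qed.

Lemma mulJZ a x : mulJ (a *: x) = a *: mulJ x.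
Proof.
apply/rowP => i; rewrite [in RHS]mxE -(splitK i); case: (fintype.split i) => j /=.
  by rewrite !mulJl mxE mulrN.
by rewrite !mulJr mxE.
Qed.

Lemma dot_split v w : (v *m w^T) 0 0 =
  \sum_a (v 0 (lshift n a) * w 0 (lshift n a) + v 0 (rshift n a) * w 0 (rshift n a)).
Proof.
rewrite mxE big_split_ord/= -big_split; apply: eq_bigr => a _.
by rewrite !mxE.
Qed.

Lemma mulJ_orth x : (x *m (mulJ x)^T) 0 0 = 0.
Proof. by rewrite dot_split big1// => a _; rewrite mulJl mulJr; ring. Qed.

Let dotJ x v : (mulJ x *m v^T) 0 0 =
  \sum_a (x 0 (lshift n a) * v 0 (rshift n a) - x 0 (rshift n a) * v 0 (lshift n a)).
Proof.
by rewrite dot_split; apply: eq_bigr => a _; rewrite mulJl mulJr; ring.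
Qed.

(** For W_ab = Psi conj(z_a) z_b + G delta_ab the form is
    2 Re (G sum_a v_a conj(w_a) + Psi (sum_a conj(z_a) v_a) conj(sum_b conj(z_b) w_b)),
    and sum_a conj(z_a) v_a has real part (z, v) and imaginary part (J z, v). *)
Lemma Re_kahler_form (Phi : 'rV[R]_(n + n) -> R) (G Psi : R) x v w :
  (forall a b, wirtinger Phi a b x =
    (Psi * (x 0 (lshift n a) * x 0 (lshift n b) + x 0 (rshift n a) * x 0 (rshift n b))
      + G * (a == b)%:R) +i*
    (Psi * (x 0 (lshift n a) * x 0 (rshift n b) - x 0 (rshift n a) * x 0 (lshift n b)))) ->
  complex.Re (kahler_form Phi x v (mulJ w)) =
    2 * (G * (v *m w^T) 0 0 +
    Psi * ((x *m v^T) 0 0 * (x *m w^T) 0 0 + (mulJ x *m v^T) 0 0 * (mulJ x *m w^T) 0 0)).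
Proof.
move=> WE; rewrite /kahler_form.
pose P1 v a := x 0 (lshift n a) * v 0 (lshift n a) + x 0 (rshift n a) * v 0 (rshift n a).
pose P2 v a := x 0 (lshift n a) * v 0 (rshift n a) - x 0 (rshift n a) * v 0 (lshift n a).
have ReS (f : 'I_n -> R[i]) : complex.Re (\sum_a f a) = \sum_a complex.Re (f a).
  exact: raddf_sum.
rewrite mulr_sumr ReS.
under eq_bigr do rewrite mulr_sumr ReS.
have E a b : complex.Re ('i * (wirtinger Phi a b x *
      (zc a v * (zc b (mulJ w))^* - zc a (mulJ w) * (zc b v)^*))) =
    Psi * (P1 v a * P1 w b + P2 v a * P2 w b) + Psi * (P1 w a * P1 v b + P2 w a * P2 v b)
    + (a == b)%:R * (2 * G * (v 0 (lshift n a) * w 0 (lshift n a)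
                              + v 0 (rshift n a) * w 0 (rshift n a))).
  rewrite WE /zc !mulJl !mulJr /P1 /P2/=.
  by case: eqVneq => [<-|_] /=; ring.
under eq_bigr do under eq_bigr do rewrite E.
under eq_bigr do rewrite !big_split/=.
rewrite !big_split/=.
have S1 (f g : 'I_n -> R) : \sum_a \sum_b f a * g b = (\sum_a f a) * \sum_b g b.
  by rewrite big_distrlr.
have S2 (v' w' : 'rV[R]_(n + n)) :
    \sum_a \sum_b Psi * (P1 v' a * P1 w' b + P2 v' a * P2 w' b) =
    Psi * ((x *m v'^T) 0 0 * (x *m w'^T) 0 0 + (mulJ x *m v'^T) 0 0 * (mulJ x *m w'^T) 0 0).
  under eq_bigr do rewrite -mulr_sumr big_split/=.
  by rewrite -mulr_sumr big_split/= !S1 !dotJ !(dot_split x).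
rewrite !S2.
have -> : \sum_a \sum_b (a == b)%:R * (2 * G * (v 0 (lshift n a) * w 0 (lshift n a)
      + v 0 (rshift n a) * w 0 (rshift n a)))
   = 2 * G * (v *m w^T) 0 0.
  rewrite dot_split mulr_sumr; apply: eq_bigr => a _.
  rewrite (bigD1 a)//= eqxx mul1r big1 ?addr0// => b ba.
  by rewrite eq_sym (negPf ba) mul0r.
by ring.
Qed.

Variables (u : R -> R).
Hypothesis su : smooth1 u.

(** The first and second derivatives of u (ln t), the potential as a function of
    t = |z|^2. *)
Definition radial1 (t : R) : R := derive1 u (ln t) / t.
Definition radial2 (t : R) : R := (derive1n 2 u (ln t) - derive1 u (ln t)) / t ^+ 2.

Lemma is_derive_uln (t : R) : 0 < t ->
  is_derive t (1 : R) (fun t => u (ln t)) (radial1 t).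
Proof.
move=> t0.
have h : is_derive (ln t) (1 : R) u (derive1 u (ln t)) := smooth1_is_derive 0 _ su.
exact: is_derive_fcomp (is_derive1_ln t0) h.
Qed.

Lemma is_derive_radial1 (t : R) : 0 < t ->
  is_derive t (1 : R) radial1 (radial2 t).
Proof.
move=> t0; have h1 : is_derive (ln t) (1 : R) (derive1 u) (derive1n 2 u (ln t)).
  exact: smooth1_is_derive 1 _ su.
have h := is_derive_fcomp (is_derive1_ln t0) h1.
have hV := is_derive1V (lt0r_neq0 t0) (is_derive_id t (1 : R)).
apply: (is_derive_eq (is_derive1M h hV)); rewrite /radial2.
by field; rewrite gt_eqF.
Qed.

Lemma wirtinger_radial a b x : x != 0 ->
  wirtinger (kahler_potential u) a b x =
  (radial2 (sqnorm x) * (x 0 (lshift n a) * x 0 (lshift n b)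
                         + x 0 (rshift n a) * x 0 (rshift n b))
      + radial1 (sqnorm x) * (a == b)%:R) +i*
    (radial2 (sqnorm x) * (x 0 (lshift n a) * x 0 (rshift n b)
                           - x 0 (rshift n a) * x 0 (lshift n b))).
Proof.
move=> x0.
have q0 : 0 < sqnorm x by rewrite sqnorm_gt0.
have pE i j : partial j (partial i (kahler_potential u)) x =
    4 * radial2 (sqnorm x) * (x 0 j * x 0 i) + 2 * radial1 (sqnorm x) * (i == j)%:R.
  exact: (partial_radial2 _ _ x0 is_derive_uln (is_derive_radial1 q0)).
rewrite /wirtinger; cbv zeta beta.
congr (_ +i* _).
  rewrite [X in X + _](pE _ _) [X in _ + X](pE _ _).
  rewrite (inj_eq (@lshift_inj _ _)) (inj_eq (@rshift_inj _ _)) (eq_sym b a).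
  by field.
rewrite [X in X - _](pE _ _) [X in _ - X](pE _ _) eq_lrshift eq_rlshift.
by field.
Qed.

Lemma kahler_metricE x : x != 0 ->
  kahler_metric (kahler_potential u) x =
  (2 * radial1 (sqnorm x))%:M +
  (2 * radial2 (sqnorm x)) *: (x^T *m x + (mulJ x)^T *m mulJ x).
Proof.
move=> x0; apply/matrixP => i j; rewrite mxE.
rewrite (Re_kahler_form _ _ (fun a b => wirtinger_radial a b x0)).
have tE (y : 'rV[R]_(n + n)) : (y^T *m y) i j = y 0 i * y 0 j.
  by rewrite mxE big_ord1 mxE.
rewrite !dot_delta.
have KE (r1 r2 : R) : (r1%:M + r2 *: (x^T *m x + (mulJ x)^T *m mulJ x)) i j =
    r1 * (i == j)%:R + r2 * (x 0 i * x 0 j + mulJ x 0 i * mulJ x 0 j).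
  rewrite mxE; congr (_ + _); first by rewrite mxE mulr_natr.
  by rewrite mxE mxE !tE.
rewrite KE [(delta_mx _ _ : 'rV_(n + n)) _ _]mxE eqxx/= (eq_sym j).
by ring.
Qed.

End KahlerMetric.

(** * Mean curvature of a hypersurface with a linear normal field *)

Section MatrixDerivative.
Variables (R : realType) (V : normedModType R).

Lemma is_derive_mxP a b (f : V -> 'M[R]_(a, b)) x v df :
  is_derive x v f df <-> forall i j, is_derive x v (fun y => f y i j : R) (df i j).
Proof.
split=> [[fD <-] i j|fD].
  by apply: DeriveDef; [move/derivable_mxP: fD; exact|rewrite derive_mx// mxE].
have fd : derivable f x v.
  by apply/derivable_mxP => i j; exact: (@ex_derive _ _ _ _ _ _ _ (fD i j)).
apply: DeriveDef => //; rewrite derive_mx//; apply/matrixP => i j; rewrite mxE.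
by have /@derive_val := fD i j.
Qed.

Lemma is_derive_mulmx a b c (f : V -> 'M[R]_(a, b)) (g : V -> 'M[R]_(b, c))
    x v df dg :
  is_derive x v f df -> is_derive x v g dg ->
  is_derive x v (fun y => f y *m g y) (df *m g x + f x *m dg).
Proof.
move=> /is_derive_mxP fD /is_derive_mxP gD; apply/is_derive_mxP => i j.
have h k : is_derive x v (fun y => f y i k * g y k j : R)
    (df i k * g x k j + f x i k * dg k j).
  apply: (is_derive_eq (is_deriveM (fD i k) (gD k j))).
  by rewrite /GRing.scale/= addrC; congr (_ + _); rewrite mulrC.
have := is_derive_sum h.
rewrite (_ : \sum_(k < b) _ = fun y => (f y *m g y) i j); last first.
  by apply/funext => y; rewrite fct_sumE mxE.
by move/is_derive_eq; apply; rewrite big_split/= !mxE.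
Qed.

Lemma is_derive_trmx a b (f : V -> 'M[R]_(a, b)) x v df :
  is_derive x v f df -> is_derive x v (fun y => (f y)^T) df^T.
Proof.
move=> /is_derive_mxP fD; apply/is_derive_mxP => i j; rewrite mxE.
rewrite (_ : (fun y => (f y)^T i j) = (fun y => f y j i))//.
by apply/funext => y; rewrite mxE.
Qed.

Lemma is_derive_mulmxr a b c (f : V -> 'M[R]_(a, b)) (B : 'M[R]_(b, c)) x v df :
  is_derive x v f df -> is_derive x v (fun y => f y *m B) (df *m B).
Proof.
move=> fD; apply: (is_derive_eq (is_derive_mulmx fD (is_derive_cst B x v))).
by rewrite mulmx0 addr0.
Qed.

Lemma is_derive_mulmxl a b c (f : V -> 'M[R]_(b, c)) (B : 'M[R]_(a, b)) x v df :
  is_derive x v f df -> is_derive x v (fun y => B *m f y) (B *m df).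
Proof.
move=> fD; apply: (is_derive_eq (is_derive_mulmx (is_derive_cst B x v) fD)).
by rewrite mul0mx add0r.
Qed.

Lemma is_derive_diff (W : normedModType R) (f : V -> W) x v :
  differentiable f x -> is_derive x v f ('D_v f x).
Proof. by move=> df; apply: DeriveDef => //; exact: diff_derivable. Qed.

Lemma is_derive_diffcomp (W U : normedModType R) (f : V -> W) (g : W -> U) x v :
  differentiable f x -> differentiable g (f x) ->
  is_derive x v (fun y => g (f y)) ('D_('D_v f x) g (f x)).
Proof.
move=> df dg; have dgf := differentiable_comp df dg.
apply: (is_derive_eq (is_derive_diff v dgf)).
by rewrite !deriveE// diff_comp.
Qed.

End MatrixDerivative.

Section Submanifold.
Variables (R : realType).

Lemma row_jacobian p m (X : 'rV[R]_p -> 'rV[R]_m) x i :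
  differentiable X x -> row i ('J X x) = partial i X x.
Proof. by move=> dX; rewrite /partial deriveEjacobian// -rowE. Qed.

Lemma derive_linear_sum p (V : normedModType R) (F : 'rV[R]_p -> V) y v :
  differentiable F y -> 'D_v F y = \sum_b v 0 b *: partial b F y.
Proof.
move=> dF; rewrite deriveE// {1}[v]row_sum_delta linear_sum; apply: eq_bigr => b _.
by rewrite linearZ /partial deriveE.
Qed.

Variables (m : nat) (G : 'rV[R]_m -> 'M[R]_m).

Lemma derive_entry y v d c : differentiable G y ->
  ('D_v G y) d c = \sum_b v 0 b * partial b (fun t => G t d c) y.
Proof.
move=> dG; rewrite derive_linear_sum// summxE; apply: eq_bigr => b _.
by rewrite mxE /partial derive_mx ?mxE//; exact: diff_derivable.
Qed.

Hypothesis symG : forall y, (G y)^T = G y.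
Hypothesis posG : forall y v, v != 0 -> 0 < inner G y v v.

Lemma inner_mulmx y k l (A : 'M[R]_(k, m)) (B : 'M[R]_(l, m)) i j :
  inner G y (row i A) (row j B) = (A *m G y *m B^T) i j.
Proof.
rewrite /inner -row_mul [LHS]mxE [RHS]mxE.
by apply: eq_bigr => a _; rewrite !mxE.
Qed.

Lemma inner_sym y v w : inner G y v w = inner G y w v.
Proof.
by rewrite /inner [LHS]mx11_trE !trmx_mul trmxK symG mulmxA.
Qed.

Lemma innerDl y v v' w : inner G y (v + v') w = inner G y v w + inner G y v' w.
Proof. by rewrite /inner !mulmxDl mxE. Qed.

Lemma innerZl y a v w : inner G y (a *: v) w = a * inner G y v w.
Proof. by rewrite /inner -!scalemxAl mxE. Qed.

Lemma metric_unit y : G y \in unitmx.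
Proof.
rewrite -row_free_unit -kermx_eq0; apply/eqP/row_matrixP => i; rewrite row0.
apply/eqP/negPn/negP => /(posG y).
by rewrite /inner -row_mul mulmx_ker row0 mul0mx mxE ltxx.
Qed.

Lemma metric_inv_sym y : (invmx (G y))^T = invmx (G y).
Proof. by rewrite trmx_inv symG. Qed.

Variables (p : nat) (X : 'rV[R]_p -> 'rV[R]_m).
Variable x : 'rV[R]_p.
Hypothesis dX : differentiable X x.
Let T := 'J X x.
Let h := Defs.induced G X x.

Lemma induced_sym : h^T = h.
Proof. by rewrite /h /Defs.induced !trmx_mul trmxK symG mulmxA. Qed.

Lemma normal_partE v :
  normal_part G X x v = v - v *m G (X x) *m T^T *m invmx h *m T.
Proof.
congr (_ - _); rewrite mulmx_sum_row exchange_big/=; apply: eq_bigr => j _.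
rewrite row_jacobian// -scaler_suml; congr (_ *: _).
rewrite mxE; apply: eq_bigr => i _; rewrite mulrC; congr (_ * _).
by rewrite -row_jacobian// -{1}[v](row_id 0) inner_mulmx.
Qed.

Hypothesis rankX : \rank T = p.

Lemma induced_unit : h \in unitmx.
Proof.
rewrite -row_free_unit -kermx_eq0; apply/eqP/row_matrixP => i; rewrite row0.
set a := row i _.
have ah : a *m h = 0 by rewrite /a -row_mul mulmx_ker row0.
have aT : a *m T = 0.
  apply/eqP/negPn/negP => /(posG (X x)).
  have -> : inner G (X x) (a *m T) (a *m T) = (a *m h *m a^T) 0 0.
    by rewrite /inner trmx_mul /h /Defs.induced !mulmxA.
  by rewrite ah mul0mx mxE ltxx.
have fT : row_free T by rewrite /row_free rankX.
by rewrite -(mulmxKp fT a) aT mul0mx.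
Qed.

Variable nu : 'rV[R]_m.
Hypothesis nu0 : nu != 0.
Hypothesis nuT : T *m G (X x) *m nu^T = 0.
Hypothesis pm : p.+1 = m.

(** The vectors orthogonal to the tangent space form the kernel of a matrix of rank
    p = m - 1, hence a line; [nu] spans it. *)
Lemma normal_part_line v :
  normal_part G X x v = (inner G (X x) v nu / inner G (X x) nu nu) *: nu.
Proof.
set w := normal_part _ _ _ _.
have nn := posG (X x) nu0.
have wT : w *m (G (X x) *m T^T) = 0.
  rewrite /w normal_partE mulmxBl -(mulmxA _ T).
  have -> : T *m (G (X x) *m T^T) = h by rewrite mulmxA.
  by rewrite mulmxKV ?induced_unit// mulmxA subrr.
have nuT' : nu *m (G (X x) *m T^T) = 0.
  apply: trmx_inj; rewrite trmx0 !trmx_mul trmxK symG; exact: nuT.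
have rGT : \rank (G (X x) *m T^T) = p.
  by rewrite -[RHS]rankX -(mxrank_tr T) eqmxMfull// row_full_unit metric_unit.
have kE : (nu == kermx (G (X x) *m T^T))%MS.
  rewrite -(geq_leqif (mxrank_leqif_eq _)); last by apply/sub_kermxP.
  by rewrite mxrank_ker rGT rank_rV nu0 -pm subSnn.
have /sub_rVP[a wE] : (w <= nu)%MS.
  by rewrite (eqmxP kE); apply/sub_kermxP.
have : inner G (X x) w nu = inner G (X x) v nu.
  rewrite /w normal_partE /inner !mulmxBl [LHS]mxE [X in _ + X]mxE.
  have -> (B : 'M[R]_(1, p)) : B *m T *m G (X x) *m nu^T = 0.
    by rewrite -!(mulmxA B) nuT mulmx0.
  by rewrite [(0 : 'M[R]_1) 0 0]mxE subr0.
by rewrite wE innerZl => <-; rewrite mulfK// gt_eqF.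
Qed.

Lemma mean_curvature_line :
  mean_curvature G X x =
  ((\sum_i \sum_j invmx h i j * inner G (X x) (covariant G X i j x) nu)
    / inner G (X x) nu nu) *: nu.
Proof.
rewrite mulr_suml scaler_suml; apply: eq_bigr => i _.
rewrite mulr_suml scaler_suml; apply: eq_bigr => j _.
by rewrite /second_fundamental normal_part_line scalerA mulrA.
Qed.

Hypothesis dG : differentiable G (X x).
(* [d e v w] is (D_e G)(v, w). *)
Let d (e v w : 'rV[R]_m) : R := (v *m 'D_e G (X x) *m w^T) 0 0.

Let D_sym e : ('D_e G (X x))^T = 'D_e G (X x).
Proof.
apply/matrixP => i j; rewrite mxE !derive_entry//; apply: eq_bigr => b _.
rewrite (_ : (fun t => G t j i) = (fun t => G t i j))//.
by apply/funext => t; rewrite -{1}(symG t) mxE.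
Qed.

Let d_sym e v w : d e v w = d e w v.
Proof.
by rewrite /d [LHS]mx11_trE !trmx_mul trmxK D_sym mulmxA.
Qed.

Let dE e v w : d e v w =
  \sum_i \sum_j \sum_b v 0 i * w 0 j * e 0 b * partial b (fun t => G t i j) (X x).
Proof.
rewrite /d -mulmxA mxE; apply: eq_bigr => i _; rewrite mxE mulr_sumr.
apply: eq_bigr => j _; rewrite derive_entry// mulr_suml mulr_sumr.
by apply: eq_bigr => b _; rewrite mxE; ring.
Qed.

Let Gamma (v w : 'rV[R]_m) : 'rV[R]_m :=
  \row_a \sum_b \sum_c christoffel G a b c (X x) * v 0 b * w 0 c.

(** The Koszul formula for coordinate fields: lowering the index of the
    Christoffel symbols cancels the inverse metric in their definition. *)
Lemma inner_christoffel v w e :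
  inner G (X x) (Gamma v w) e = 2^-1 * (d v e w + d w e v - d e v w).
Proof.
pose K : 'rV[R]_m := \row_i \sum_b \sum_c
  (partial b (fun t => G t i c) (X x) + partial c (fun t => G t i b) (X x)
   - partial i (fun t => G t b c) (X x)) * v 0 b * w 0 c.
have -> : Gamma v w = 2^-1 *: (K *m invmx (G (X x))).
  apply/rowP => a; rewrite !mxE mulr_sumr.
  under [RHS]eq_bigr => i _.
    rewrite mxE mulr_suml mulr_sumr.
    under eq_bigr => b _ do rewrite mulr_suml mulr_sumr.
    over.
  rewrite [RHS]exchange_big; apply: eq_bigr => b _.
  rewrite [RHS]exchange_big; apply: eq_bigr => c _.
  rewrite /christoffel mulr_sumr !mulr_suml; apply: eq_bigr => i _.
  have -> : invmx (G (X x)) a i = invmx (G (X x)) i a.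
    by rewrite -{1}(metric_inv_sym (X x)) mxE.
  by ring.
rewrite innerZl; congr (_ * _).
rewrite /inner -(mulmxA K) mulVmx ?metric_unit// mulmx1 mxE.
rewrite !dE.
have -> : \sum_i \sum_j \sum_b e 0 i * w 0 j * v 0 b * partial b (fun t => G t i j) (X x)
  = \sum_i \sum_b \sum_j e 0 i * w 0 j * v 0 b * partial b (fun t => G t i j) (X x).
  by apply: eq_bigr => i _; rewrite exchange_big.
have -> : \sum_i \sum_j \sum_b v 0 i * w 0 j * e 0 b * partial b (fun t => G t i j) (X x)
  = \sum_b \sum_i \sum_j v 0 i * w 0 j * e 0 b * partial b (fun t => G t i j) (X x).
  under eq_bigr do rewrite exchange_big.
  by rewrite exchange_big.
rewrite -big_split -sumrB; apply: eq_bigr => i _.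
rewrite mxE mulr_suml -big_split -sumrB; apply: eq_bigr => b _.
rewrite mulr_suml -big_split -sumrB; apply: eq_bigr => c _.
by rewrite /= mxE; ring.
Qed.

Variable A : 'M[R]_m.
Hypothesis nuE : nu = X x *m A.
Hypothesis orth : \forall y \near x, forall i,
  inner G (X y) (partial i X y) (X y *m A) = 0.
Hypothesis ddX : forall i, differentiable (partial i X) x.

(** The first two terms are the derivative of the field w |-> w A acting on each
    argument of [G], the third is the derivative of the coefficients of [G]. *)
Definition lie_derivative (y : 'rV[R]_m) : 'M[R]_m :=
  A *m G y + G y *m A^T + 'D_(y *m A) G y.

(* Only the symmetric part in (i, j) survives the trace. *)
Let sum_antisym (s : 'M[R]_p) (f : 'I_p -> 'I_p -> R) : s^T = s ->
  \sum_i \sum_j s i j * (f i j - f j i) = 0.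
Proof.
move=> ss; under eq_bigr do under eq_bigr do rewrite mulrBr.
under eq_bigr do rewrite sumrB.
rewrite sumrB; apply/eqP; rewrite subr_eq0; apply/eqP.
rewrite [RHS]exchange_big; apply: eq_bigr => i _; apply: eq_bigr => j _.
by rewrite -[s in RHS]ss mxE.
Qed.

(* the derivative along [i] of the orthogonality of [partial j X] and the field *)
Let orth_derive i j :
  inner G (X x) (partial i (partial j X) x) nu +
  d (partial i X x) (partial j X x) nu +
  inner G (X x) (partial j X x) (partial i X x *m A) = 0.
Proof.
have h1 := is_derive_diff (delta_mx 0 i) (ddX j).
have h2 := is_derive_diffcomp (delta_mx 0 i) dX dG.
have h3 := is_derive_trmx (is_derive_mulmxr A (is_derive_diff (delta_mx 0 i) dX)).
have /is_derive_mxP/(_ 0 0) := is_derive_mulmx (is_derive_mulmx h1 h2) h3.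
have E : \forall y \near x, 0 = (partial j X y *m G (X y) *m (X y *m A)^T) 0 0.
  by move: orth; apply: filterS => y /(_ j).
move=> /(@derive_val _ _ _ _ _ _ _).
rewrite -(near_eq_derive _ E) derive_cst => ->.
have D00 (M N : 'M[R]_1) : (M + N) 0 0 = M 0 0 + N 0 0 by rewrite mxE.
by rewrite nuE mulmxDl !D00.
Qed.

(** [orth_derive] expresses g(D_i D_j X, nu) by first derivatives; added to the
    Koszul formula it leaves - (1/2) (L_nu g)(D_i X, D_j X) plus terms antisymmetric
    in (i, j), which the trace kills. *)
Lemma mean_curvature_lie :
  mean_curvature G X x =
  - (\tr (invmx h *m (T *m lie_derivative (X x) *m T^T)) /
      (2 * inner G (X x) nu nu)) *: nu.
Proof.
have nn : inner G (X x) nu nu != 0 by rewrite gt_eqF// posG.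
pose L i j := inner G (X x) (partial i X x *m A) (partial j X x) +
  inner G (X x) (partial i X x) (partial j X x *m A) +
  d nu (partial i X x) (partial j X x).
have AGE (vi vj : 'rV[R]_m) :
    (vj *m (A *m G (X x)) *m vi^T) 0 0 + (vj *m (G (X x) *m A^T) *m vi^T) 0 0 =
    inner G (X x) (vi *m A) vj + inner G (X x) vi (vj *m A).
  rewrite [RHS]addrC; congr (_ + _).
    by rewrite (inner_sym _ vi) /inner !mulmxA.
  by rewrite (inner_sym _ (vi *m A)) /inner trmx_mul !mulmxA.
have covA (vi vj w : 'rV[R]_m) :
  inner G (X x) w nu + d vi vj nu + inner G (X x) vj (vi *m A) = 0 ->
  inner G (X x) w nu + 2^-1 * (d vi nu vj + d vj nu vi - d nu vi vj) =
  2^-1 * (d vj nu vi - d vi nu vj)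
  + 2^-1 * (inner G (X x) vi (vj *m A) - inner G (X x) vj (vi *m A))
  - 2^-1 * (inner G (X x) (vi *m A) vj + inner G (X x) vi (vj *m A) + d nu vi vj).
  rewrite (d_sym vi vj) (inner_sym _ (vi *m A)).
  move: (inner _ _ w nu) (inner _ _ vj _) (inner _ _ vi _) => a b e.
  move: (d vi nu vj) (d vj nu vi) (d nu vi vj) => a1 a2 a3.
  by move/eqP; rewrite -addrA addr_eq0 => /eqP ->; field.
have trL : \tr (invmx h *m (T *m lie_derivative (X x) *m T^T)) =
    \sum_i \sum_j invmx h i j * L i j.
  rewrite /mxtrace; apply: eq_bigr => i _; rewrite mxE; apply: eq_bigr => j _.
  congr (_ * _); rewrite /lie_derivative !mulmxDr !mulmxDl -nuE.
  have E3 (M N P : 'M[R]_p) : (M + N + P) j i = M j i + N j i + P j i by rewrite !mxE.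
  have rowE3 (M : 'M[R]_m) : (T *m M *m T^T) j i =
      (partial j X x *m M *m (partial i X x)^T) 0 0.
    rewrite -!row_jacobian// -/T -row_mul [LHS]mxE [RHS]mxE.
    by apply: eq_bigr => a _; rewrite !mxE.
  rewrite E3 !rowE3 /L (d_sym _ (partial i X x)); congr (_ + _).
  exact: AGE.
have covE i j : inner G (X x) (covariant G X i j x) nu =
  2^-1 * (d (partial j X x) nu (partial i X x) - d (partial i X x) nu (partial j X x))
  + 2^-1 * (inner G (X x) (partial i X x) (partial j X x *m A)
      - inner G (X x) (partial j X x) (partial i X x *m A)) - 2^-1 * L i j.
  rewrite /covariant innerDl inner_christoffel /L.
  exact: covA (orth_derive i j).
rewrite mean_curvature_line; congr (_ *: _).
have -> : \sum_i \sum_j invmx h i j * inner G (X x) (covariant G X i j x) nu =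
    - 2^-1 * \tr (invmx h *m (T *m lie_derivative (X x) *m T^T)).
  have hs : (invmx h)^T = invmx h by rewrite trmx_inv induced_sym.
  pose f i j := 2^-1 * d (partial j X x) nu (partial i X x).
  pose g i j := 2^-1 * inner G (X x) (partial i X x) (partial j X x *m A).
  rewrite trL; transitivity (\sum_i \sum_j invmx h i j * (f i j - f j i) +
      \sum_i \sum_j invmx h i j * (g i j - g j i) +
      - 2^-1 * \sum_i \sum_j invmx h i j * L i j).
    rewrite mulr_sumr -!big_split/=; apply: eq_bigr => i _.
    rewrite mulr_sumr -!big_split/=; apply: eq_bigr => j _.
    rewrite covE -!mulrBr; move: (_ - _) (_ - _) (L i j) (invmx h i j) => a1 a2 a3 a4.
    by ring.
  by rewrite !sum_antisym// !add0r.
move: (\tr _) => a.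
by field.
Qed.

End Submanifold.

(** * The Lie derivative of the metric along the dilations *)

Section SphereTrace.
Variables (R : realType) (m p : nat).

(** [P] stands for the Jacobian of a parametrization of the sphere and [w] for J z.
    As w is tangent, w = a P for some a, so that a h = (a0 + b0 q) w P^T: the
    matrix h has the factor a0 + b0 q on w, and a0 on its orthogonal complement.
    The trace of h^-1 P P^T itself follows from tr (h^-1 h) = p. *)
Lemma mxtrace_sphere (P : 'M[R]_(p, m)) (z w : 'rV[R]_m) (a0 b0 a1 b1 q : R) :
  p.+1 = m -> \rank P = p -> z != 0 -> P *m z^T = 0 -> (w *m z^T) 0 0 = 0 ->
  (w *m w^T) 0 0 = q -> a0 != 0 -> a0 + b0 * q != 0 ->
  let h := P *m (a0%:M + b0 *: (w^T *m w)) *m P^T in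
  h \in unitmx ->
  \tr (invmx h *m (P *m (a1%:M + b1 *: (w^T *m w)) *m P^T)) =
  (p%:R - 1) * (a1 / a0) + (a1 + b1 * q) / (a0 + b0 * q).
Proof.
move=> pm rP z0 Pz wz wq a00 ab0 h hu.
have PE a b : P *m (a%:M + b *: (w^T *m w)) *m P^T =
    a *: (P *m P^T) + b *: ((P *m w^T) *m (w *m P^T)).
  rewrite mulmxDr mulmxDl mul_mx_scalar -scalemxAl; congr (_ + _).
  by rewrite -scalemxAr -scalemxAl !mulmxA.
have kE : (P == kermx z^T)%MS.
  rewrite -(geq_leqif (mxrank_leqif_eq _)); last exact/sub_kermxP.
  by rewrite mxrank_ker mxrank_tr rank_rV z0 rP -pm subn1.
have /submxP[a wE] : (w <= P)%MS.
  rewrite (eqmxP kE); apply/sub_kermxP; rewrite [LHS]mx11_scalar wz; exact: raddf0.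
have ab : a *m (P *m w^T) = q%:M by rewrite mulmxA -wE [LHS]mx11_scalar wq.
have ah : a *m h = (a0 + b0 * q) *: (w *m P^T).
  rewrite /h PE mulmxDr -!scalemxAr. rewrite !mulmxA. rewrite -wE.
  have -> : w *m w^T *m w *m P^T = q *: (w *m P^T).
    by rewrite [w *m w^T]mx11_scalar wq mul_scalar_mx scalemxAl.
  by rewrite scalerA -scalerDl.
have bh : w *m P^T *m invmx h = (a0 + b0 * q)^-1 *: a.
  by rewrite -[a in RHS](mulmxK hu) ah -scalemxAl scalerA mulVf// scale1r.
pose t := \tr (invmx h *m (P *m P^T)).
have tB : \tr (invmx h *m ((P *m w^T) *m (w *m P^T))) = q / (a0 + b0 * q).
  rewrite [invmx h *m _]mulmxA mxtrace_mulC [_ *m (invmx h *m _)]mulmxA.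
  rewrite bh -scalemxAl ab mxtraceZ mxtrace_scalar.
  by rewrite mulr1n mulrC.
have trE a' b' : \tr (invmx h *m (P *m (a'%:M + b' *: (w^T *m w)) *m P^T)) =
    a' * t + b' * (q / (a0 + b0 * q)).
  by rewrite PE mulmxDr mxtraceD -!scalemxAr !mxtraceZ tB.
have pE : p%:R = a0 * t + b0 * (q / (a0 + b0 * q)).
  by rewrite -trE mulVmx// mxtrace1.
rewrite trE.
have -> : t = (p%:R - b0 * (q / (a0 + b0 * q))) / a0 by rewrite pE addrK mulrC mulKf.
by field; rewrite a00 ab0.
Qed.

End SphereTrace.

Section Pullback.
Variables (R : realType) (m : nat).
Variables (G : 'rV[R]_m -> 'M[R]_m) (psi : 'rV[R]_m -> 'rV[R]_m).
Variables (U : set 'rV[R]_m) (S : R -> 'M[R]_m) (A : 'M[R]_m).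
Hypotheses (oU : open U) (U_cone : forall l z, 0 < l -> U z -> U (l *: z)).
Hypothesis dpsi : forall z, U z -> differentiable psi z.
Hypothesis psiS : forall l z, 0 < l -> U z -> psi (l *: z) = psi z *m S l.
Hypotheses (S1 : S 1 = 1%:M) (dS : is_derive (1 : R) (1 : R) S A).

Let one_near : \forall l \near (1 : R), 0 < l.
Proof. exact: lt_nbhsr. Qed.

Let is_derive_line (z : 'rV[R]_m) l : is_derive l (1 : R) (fun t : R => t *: z) z.
Proof.
have [h1 h2] := is_diff_scalel l z.
apply: DeriveDef; first exact: diff_derivable.
by rewrite deriveE// h2 scale1r.
Qed.

Let scale_congr (J J0 B C : 'M[R]_m) l : l *: J = J0 *m B ->
  l ^+ 2 *: (J *m C *m J^T) = J0 *m (B *m C *m B^T) *m J0^T.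
Proof.
move=> JB; transitivity (J0 *m B *m C *m (J0 *m B)^T); last first.
  by rewrite trmx_mul !mulmxA.
rewrite -JB; have -> : (l *: J)^T = l *: J^T by apply/matrixP => i j; rewrite !mxE.
by rewrite -!scalemxAl -scalemxAr scalerA expr2.
Qed.

(** The chain rule applied to both sides of psi (l z) = psi z S(l). *)
Lemma jacobian_scale l z : 0 < l -> U z -> l *: 'J psi (l *: z) = 'J psi z *m S l.
Proof.
move=> l0 Uz; apply/row_matrixP => i.
have Ulz := U_cone l0 Uz.
have dl : differentiable (fun y : 'rV[R]_m => l *: y) z.
  exact: (@ex_diff _ _ _ _ _ _ _ (is_diff_scaler l z)).
have E : \forall y \near z, psi (l *: y) = psi y *m S l.
  by have := open_nbhs_nbhs (conj oU Uz); apply: filterS => y Uy; exact: psiS.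
have h1 := is_derive_diffcomp (delta_mx 0 i) dl (dpsi Ulz).
have h2 := is_derive_mulmxr (S l) (is_derive_diff (delta_mx 0 i) (dpsi Uz)).
have := near_eq_derive (delta_mx 0 i) E.
have /@derive_val -> := h1; have /@derive_val -> := h2.
rewrite (deriveE _ dl) diff_val !(deriveEjacobian _ (dpsi _))// => E2.
by rewrite !rowE mulmxA -E2 -scalemxAl -scalemxAr.
Qed.

(** The derivative at l = 1 of psi (l z) = psi z S(l): the position field becomes the
    linear field w |-> w A in the coordinates psi. *)
Lemma euler_jacobian z : U z -> z *m 'J psi z = psi z *m A.
Proof.
move=> Uz; rewrite -deriveEjacobian; last exact: dpsi.
have dl : differentiable (fun t : R => t *: z) (1 : R).
  exact: (@ex_diff _ _ _ _ _ _ _ (is_diff_scalel (1 : R) z)).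
have dp : differentiable psi (1 *: z) by rewrite scale1r; exact: dpsi.
have h1 := is_derive_diffcomp (1 : R) dl dp.
have h2 := is_derive_mulmxl (psi z) dS.
have E : \forall l \near (1 : R), psi (l *: z) = psi z *m S l.
  by move: one_near; apply: filterS => l l0; exact: psiS.
have := near_eq_derive (1 : R) E.
have /@derive_val -> := h1; have /@derive_val -> := h2.
by have /@derive_val -> := is_derive_line z 1; rewrite scale1r.
Qed.

Variable K : 'rV[R]_m -> 'M[R]_m.
Hypothesis KE : forall z, U z -> K z = 'J psi z *m G (psi z) *m ('J psi z)^T.

(** By [jacobian_scale], l^2 K(l z) is the pullback by psi of the metric transported
    by S(l), whose derivative at l = 1 is the Lie derivative. *)
Lemma lie_pullback z (D : 'M[R]_m) : U z -> differentiable G (psi z) ->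
  is_derive (1 : R) (1 : R) (fun l => l ^+ 2 *: K (l *: z)) D ->
  'J psi z *m lie_derivative G A (psi z) *m ('J psi z)^T = D.
Proof.
move=> Uz dG hD.
have E : \forall l \near (1 : R), l ^+ 2 *: K (l *: z) =
   'J psi z *m (S l *m G (psi z *m S l) *m (S l)^T) *m ('J psi z)^T.
  move: one_near; apply: filterS => l l0.
  rewrite KE ?psiS//; last exact: U_cone.
  exact: scale_congr (jacobian_scale l0 Uz).
have dX : differentiable (fun l => psi z *m S l) (1 : R).
  apply/derivable1_diffP.
  exact: (@ex_derive _ _ _ _ _ _ _ (is_derive_mulmxl (psi z) dS)).
have dG1 : differentiable G (psi z *m S 1) by rewrite S1 mulmx1.
have h2 := is_derive_diffcomp (1 : R) dX dG1.
have h3 := is_derive_mulmx (is_derive_mulmx dS h2) (is_derive_trmx dS).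
have h4 := is_derive_mulmxr ('J psi z)^T (is_derive_mulmxl ('J psi z) h3).
have := near_eq_derive (1 : R) E.
have /@derive_val -> := hD; have /@derive_val -> := h4.
have /@derive_val -> := is_derive_mulmxl (psi z) dS.
rewrite S1 trmx1 !mulmx1 mul1mx => ->; congr (_ *m _ *m _).
by rewrite mul1mx /lie_derivative addrAC.
Qed.

End Pullback.

Section Conformal.
Variables (R : realType) (n : nat) (u : R -> R).
Hypothesis su : smooth1 u.
Hypothesis u1_gt0 : forall s, 0 < derive1 u s.
Hypothesis u2_gt0 : forall s, 0 < derive1n 2 u s.
Implicit Types z v : 'rV[R]_(n + n).

Let u1 : R -> R := derive1 u.
Let u2 : R -> R := derive1n 2 u.
Let u3 : R -> R := derive1n 3 u.

Definition radial_form (a b : R) z : 'M[R]_(n + n) :=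
  a%:M + b *: (z^T *m z + (mulJ z)^T *m mulJ z).

Lemma kahler_metric_scale l z : 0 < l -> z != 0 ->
  l ^+ 2 *: kahler_metric (kahler_potential u) (l *: z) =
  radial_form (2 / sqnorm z * u1 (ln (l ^+ 2 * sqnorm z)))
   (2 / sqnorm z ^+ 2 *
      (u2 (ln (l ^+ 2 * sqnorm z)) - u1 (ln (l ^+ 2 * sqnorm z)))) z.
Proof.
move=> l0 z0; have q0 : sqnorm z != 0 by rewrite gt_eqF// sqnorm_gt0.
have lz0 : l *: z != 0 by rewrite scaler_eq0 negb_or gt_eqF.
rewrite kahler_metricE// sqnormZ /radial_form mulJZ.
have -> : (l *: z)^T *m (l *: z) + (l *: mulJ z)^T *m (l *: mulJ z) =
    l ^+ 2 *: (z^T *m z + (mulJ z)^T *m mulJ z).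
  by apply/matrixP => i j; rewrite !mxE !big_ord1 !mxE; ring.
rewrite scalerDr scale_scalar_mx !scalerA /radial1 /radial2 -/(u1 _) -/(u2 _).
move: (u1 _) (u2 _) => a b.
by congr (_%:M + _ *: _); field; rewrite q0 gt_eqF.
Qed.

Lemma kahler_metric_radial z : z != 0 ->
  kahler_metric (kahler_potential u) z =
  radial_form (2 / sqnorm z * u1 (ln (sqnorm z)))
   (2 / sqnorm z ^+ 2 * (u2 (ln (sqnorm z)) - u1 (ln (sqnorm z)))) z.
Proof.
by move=> z0; have := kahler_metric_scale ltr01 z0; rewrite expr1n !scale1r mul1r.
Qed.

Lemma radial_formz a b z :
  radial_form a b z *m z^T = (a + b * sqnorm z) *: z^T.
Proof.
rewrite mulmxDl mul_scalar_mx -scalemxAl mulmxDl -!mulmxA.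
rewrite [z *m z^T]mx11_scalar -sqnormE.
have -> : mulJ z *m z^T = 0.
  rewrite [LHS]mx11_scalar.
  by rewrite mx11_trE trmx_mul trmxK mulJ_orth raddf0.
by rewrite mulmx0 addr0 mul_mx_scalar scalerA -scalerDl.
Qed.

(** The gradient of s is E / u''. *)
Lemma kahler_metricz z : z != 0 ->
  kahler_metric (kahler_potential u) z *m z^T = (2 * u2 (ln (sqnorm z)) / sqnorm z) *: z^T.
Proof.
move=> z0; have q0 : sqnorm z != 0 by rewrite gt_eqF// sqnorm_gt0.
rewrite kahler_metric_radial// radial_formz; congr (_ *: _).
by field.
Qed.

Lemma is_derive_radial_form (a b : R -> R) z l da db :
  is_derive l (1 : R) a da -> is_derive l (1 : R) b db ->
  is_derive l (1 : R) (fun t => radial_form (a t) (b t) z) (radial_form da db z).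
Proof.
move=> ha hb; apply/is_derive_mxP => i j.
pose t := (z^T *m z + (mulJ z)^T *m mulJ z) i j.
have E a' b' : radial_form a' b' z i j = a' * (i == j)%:R + b' * t.
  rewrite [LHS]mxE; congr (_ + _); first by rewrite mxE mulr_natr.
  by rewrite mxE.
under eq_fun do rewrite E.
rewrite E.
have h1 := is_derive1M ha (is_derive1_cst (i == j)%:R l).
have h2 := is_derive1M hb (is_derive1_cst t l).
by apply: (is_derive_eq (is_derive1D h1 h2)); rewrite !mulr0 !addr0.
Qed.

Lemma is_derive_kahler_metric z : z != 0 ->
  is_derive (1 : R) (1 : R)
    (fun l => l ^+ 2 *: kahler_metric (kahler_potential u) (l *: z))
    (radial_form (4 / sqnorm z * u2 (ln (sqnorm z)))
      (4 / sqnorm z ^+ 2 * (u3 (ln (sqnorm z)) - u2 (ln (sqnorm z)))) z).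
Proof.
move=> z0; have q0 : 0 < sqnorm z by rewrite sqnorm_gt0.
have hs : is_derive (1 : R) (1 : R) (fun l => ln (l ^+ 2 * sqnorm z)) 2.
  have h0 := is_derive_id (1 : R) (1 : R).
  have h1 := is_derive1M (is_derive1M h0 h0) (is_derive1_cst (sqnorm z) 1).
  have h2 : is_derive (1 * 1 * sqnorm z) (1 : R) (@ln R) (sqnorm z)^-1.
    by rewrite !mul1r; exact: is_derive1_ln.
  apply: (is_derive_eq (is_derive_fcomp h1 h2)).
  by field; rewrite gt_eqF.
have d1 s : is_derive s (1 : R) u1 (u2 s) by exact: smooth1_is_derive 1 s su.
have d2 s : is_derive s (1 : R) u2 (u3 s) by exact: smooth1_is_derive 2 s su.
have h1 := is_derive_fcomp hs (d1 _); have h2 := is_derive_fcomp hs (d2 _).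
have := is_derive_radial_form z (is_derive1Z (2 / sqnorm z) h1)
  (is_derive1Z (2 / sqnorm z ^+ 2) (is_derive1B h2 h1)).
rewrite expr1n mul1r => h.
have E : \forall l \near (1 : R), radial_form (2 / sqnorm z * u1 (ln (l ^+ 2 * sqnorm z)))
   (2 / sqnorm z ^+ 2 * (u2 (ln (l ^+ 2 * sqnorm z)) - u1 (ln (l ^+ 2 * sqnorm z)))) z =
    l ^+ 2 *: kahler_metric (kahler_potential u) (l *: z).
  have : \forall l \near (1 : R), 0 < l by exact: lt_nbhsr.
  by apply: filterS => l l0; rewrite kahler_metric_scale.
apply: near_eq_is_derive E (is_derive_eq h _).
move: (u2 _) (u3 _) => a b.
by congr (radial_form _ _ z); field; rewrite gt_eqF.
Qed.

(** K(v, v) is 2 u'/q times the squared length of the part of v orthogonal to z and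
    J z, plus 2 u''/q times that of the part along them. *)
Lemma kahler_metric_pos z v : z != 0 -> v != 0 ->
  0 < (v *m kahler_metric (kahler_potential u) z *m v^T) 0 0.
Proof.
move=> z0 v0; have q0 : 0 < sqnorm z by rewrite sqnorm_gt0.
pose a := (z *m v^T) 0 0; pose b := (mulJ z *m v^T) 0 0.
have a' : (v *m z^T) 0 0 = a by rewrite mx11_trE trmx_mul trmxK.
have b' : (v *m (mulJ z)^T) 0 0 = b by rewrite mx11_trE trmx_mul trmxK.
have zJ : (z *m (mulJ z)^T) 0 0 = 0 := mulJ_orth z.
have Jz : (mulJ z *m z^T) 0 0 = 0 by rewrite mx11_trE trmx_mul trmxK zJ.
have zz : (z *m z^T) 0 0 = sqnorm z by rewrite -sqnormE.
have JJ : (mulJ z *m (mulJ z)^T) 0 0 = sqnorm z by rewrite -sqnormE mulJ_sqnorm.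
have vv : (v *m v^T) 0 0 = sqnorm v by rewrite -sqnormE.
have E : (v *m kahler_metric (kahler_potential u) z *m v^T) 0 0 =
    2 / sqnorm z * u1 (ln (sqnorm z)) * (sqnorm v - (a ^+ 2 + b ^+ 2) / sqnorm z)
    + 2 / sqnorm z ^+ 2 * u2 (ln (sqnorm z)) * (a ^+ 2 + b ^+ 2).
  rewrite kahler_metric_radial// /radial_form mulmxDr mul_mx_scalar mulmxDl.
  rewrite -scalemxAl -scalemxAr -scalemxAl mulmxDr mulmxDl !mulmxA.
  have D00 (M N : 'M[R]_1) : (M + N) 0 0 = M 0 0 + N 0 0 by rewrite mxE.
  have Z00 t (M : 'M[R]_1) : (t *: M) 0 0 = t * M 0 0 by rewrite mxE.
  have M00 (M N : 'M[R]_1) : (M *m N) 0 0 = M 0 0 * N 0 0 by rewrite mxE big_ord1.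
  rewrite D00 !Z00 D00 -!(mulmxA _ z) -!(mulmxA _ (mulJ z)) !M00 a' b' -/a -/b vv.
  by move: (u1 _) (u2 _) => c d; field; rewrite gt_eqF.
have bessel : (a ^+ 2 + b ^+ 2) / sqnorm z <= sqnorm v.
  rewrite -subr_ge0.
  pose w := v - (a / sqnorm z) *: z - (b / sqnorm z) *: mulJ z.
  suff <- : sqnorm w = sqnorm v - (a ^+ 2 + b ^+ 2) / sqnorm z by exact: sqnorm_ge0.
  have D00 (M N : 'M[R]_1) : (M - N) 0 0 = M 0 0 - N 0 0 by rewrite !mxE.
  have Z00 t (M : 'M[R]_1) : (t *: M) 0 0 = t * M 0 0 by rewrite mxE.
  have trZ t (M : 'rV[R]_(n + n)) : (t *: M)^T = t *: M^T.
    by apply/matrixP => i j; rewrite !mxE.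
  have trB (M N : 'rV[R]_(n + n)) : (M - N)^T = M^T - N^T.
    by apply/matrixP => i j; rewrite !mxE.
  rewrite [sqnorm w]sqnormE /w !trB !trZ !(mulmxBl, mulmxBr).
  rewrite -!scalemxAl -!scalemxAr !(D00, Z00) vv a' b' -/a -/b zz zJ Jz JJ.
  by field; rewrite gt_eqF.
have s0 : 0 <= a ^+ 2 + b ^+ 2 by rewrite addr_ge0 ?sqr_ge0.
have c1 : 0 < 2 / sqnorm z * u1 (ln (sqnorm z)) by rewrite mulr_gt0 ?divr_gt0.
have c2 : 0 < 2 / sqnorm z ^+ 2 * u2 (ln (sqnorm z)).
  by rewrite mulr_gt0 ?divr_gt0 ?exprn_gt0.
rewrite E; have [s00|sn0] := eqVneq (a ^+ 2 + b ^+ 2) 0.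
  by rewrite s00 mul0r subr0 mulr0 addr0 mulr_gt0// sqnorm_gt0.
apply: ltr_wpDl; first by apply: mulr_ge0; [exact: ltW|rewrite subr_ge0].
by rewrite mulr_gt0// lt_def sn0.
Qed.

End Conformal.

(** * Spheres in a chart *)

(** [psi] is a chart of the soliton read in the coordinates z, [Y] a local
    parametrization of the sphere, and X = psi o Y. *)

Section SphereInChart.
Variables (R : realType) (n k : nat) (u : R -> R) (c : R).
Hypotheses (hn : (2 <= n)%N) (hk : (1 <= k <= n - 1)%N).
Hypothesis hu : cao_profile n k u c.

Let u1 : R -> R := derive1 u.
Let u2 : R -> R := derive1n 2 u.
Let u3 : R -> R := derive1n 3 u.
Let m := (n + n)%N.
Let p := (n + n).-1.
Let Phi := @kahler_potential R n u.

Let su : smooth1 u. Proof. exact: cao_smooth hu. Qed.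
Let u1_gt0 s : 0 < u1 s. Proof. exact: cao_d1 hu s. Qed.
Let u2_gt0 s : 0 < u2 s. Proof. exact: cao_d2 hu s. Qed.
Let pm : p.+1 = m.
Proof. by rewrite /p prednK// addn_gt0 (leq_trans _ hn). Qed.

Variables (G : 'rV[R]_m -> 'M[R]_m) (psi : 'rV[R]_m -> 'rV[R]_m).
Variables (U : set 'rV[R]_m) (S : R -> 'M[R]_m) (A : 'M[R]_m).
Variable f : 'rV[R]_m -> R.
Hypotheses (oU : open U) (U0 : forall z, U z -> z != 0).
Hypothesis U_cone : forall l z, 0 < l -> U z -> U (l *: z).
Hypothesis dpsi : forall z, U z -> differentiable psi z.
Hypothesis psiS : forall l z, 0 < l -> U z -> psi (l *: z) = psi z *m S l.
Hypotheses (S1 : S 1 = 1%:M) (dS : is_derive (1 : R) (1 : R) S A).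
Hypothesis KE : forall z, U z ->
  kahler_metric Phi z = 'J psi z *m G (psi z) *m ('J psi z)^T.
Hypothesis symG : forall y, (G y)^T = G y.
Hypothesis posG : forall y v, v != 0 -> 0 < inner G y v v.
Hypothesis dG : forall y, differentiable G y.
Hypothesis df : forall y, differentiable f y.
Hypothesis fE : forall z, U z -> f (psi z) = soliton_potential n u (ln (sqnorm z)).

(** The pullback of [G] by [psi] is positive definite. *)
Lemma jacobian_unit z : U z -> 'J psi z \in unitmx.
Proof.
move=> Uz; rewrite -row_free_unit -kermx_eq0; apply/eqP/row_matrixP => i.
rewrite row0; apply/eqP/negPn/negP => v0.
have := kahler_metric_pos su u1_gt0 u2_gt0 (U0 Uz) v0.
by rewrite KE// !mulmxA -row_mul mulmx_ker row0 !mul0mx mxE ltxx.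
Qed.

(** Both sides have the same inner product with every image of a vector under
    the Jacobian of [psi]: c u'' ds on one side by P' = c u'', c g(E, .) on the other by
    [kahler_metricz]. *)
Lemma gradient_potential z : U z -> gradient G f (psi z) = c *: (psi z *m A).
Proof.
move=> Uz; have z0 := U0 Uz.
have q0 : 0 < sqnorm z by rewrite sqnorm_gt0.
have Ju := jacobian_unit Uz.
rewrite -(euler_jacobian dpsi psiS dS Uz).
rewrite /gradient; set r := \row_b _.
have rD (v : 'rV[R]_m) : (v *m 'J psi z *m r^T) 0 0 =
    c * u2 (ln (sqnorm z)) * (2 * (z *m v^T) 0 0 / sqnorm z).
  have h1 := is_derive_diffcomp v (dpsi Uz) (df (psi z)).
  have E : \forall y \near z, f (psi y) = soliton_potential n u (ln (sqnorm y)).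
    by have := open_nbhs_nbhs (conj oU Uz); apply: filterS => y; exact: fE.
  have h2 : is_derive (sqnorm z) (1 : R) (fun t => soliton_potential n u (ln t))
      (c * u2 (ln (sqnorm z)) * (sqnorm z)^-1).
    exact: is_derive_fcomp (is_derive1_ln q0) (derive_soliton_potential hu _).
  have h3 := is_derive_radial v h2.
  have := near_eq_derive v E.
  have /@derive_val -> := h1; have /@derive_val -> := h3.
  rewrite (deriveEjacobian _ (dpsi Uz)) derive_linear_sum// => E2.
  rewrite mxE; transitivity (\sum_b (v *m 'J psi z) 0 b *: partial b f (psi z)).
    by apply: eq_bigr => b _; rewrite !mxE.
  by rewrite E2; ring.
have Kz := kahler_metricz su z0.
have rE : 'J psi z *m r^T = c *: ('J psi z *m (G (psi z) *m (z *m 'J psi z)^T)).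
  apply/colP => i.
  rewrite mulmx_entry rD trmx_mul !mulmxA -KE// Kz trmx_delta -colE !mxE -/(u2 _).
  by field; rewrite gt_eqF.
have rE' : r^T = c *: (G (psi z) *m (z *m 'J psi z)^T).
  by rewrite -[r^T](mulKmx Ju) rE -scalemxAr mulKmx.
have -> : r = c *: (z *m 'J psi z *m G (psi z)).
  rewrite -[r]trmxK rE' -[in RHS](symG (psi z)) -[X in c *: (X *m _)]trmxK -trmx_mul.
  by apply/matrixP => i j; rewrite !mxE.
by rewrite -scalemxAl mulmxK// metric_unit.
Qed.

Variables (Y X : 'rV[R]_p -> 'rV[R]_m) (O : set 'rV[R]_p) (q : R).
Hypotheses (oO : open O) (dY : forall x, O x -> differentiable Y x).
Hypotheses (YU : forall x, O x -> U (Y x)).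
Hypotheses (Yq : forall x, O x -> sqnorm (Y x) = q).
Hypothesis rY : forall x, O x -> \rank ('J Y x) = p.
Hypothesis XE : forall x, O x -> X x = psi (Y x).
Hypothesis sX : smooth_on O X.

Let mulmx_congr (J JY : 'M[R]_(p, m)) (Jp L D : 'M[R]_m) :
  J = JY *m Jp -> Jp *m L *m Jp^T = D -> J *m L *m J^T = JY *m D *m JY^T.
Proof. by move=> -> <-; rewrite trmx_mul !mulmxA. Qed.

Lemma jacobian_chart x : O x -> 'J X x = 'J Y x *m 'J psi (Y x).
Proof.
move=> Ox; apply/row_matrixP => i; rewrite row_mul.
have dX := smooth_on_differentiable sX Ox.
rewrite [LHS](row_jacobian i dX) [X in _ = X *m _](row_jacobian i (dY Ox)).
have E : \forall y \near x, psi (Y y) = X y.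
  by have := open_nbhs_nbhs (conj oO Ox); apply: filterS => y /XE.
have E2 := near_eq_derive (delta_mx 0 i) E.
have /@derive_val D := is_derive_diffcomp (delta_mx 0 i) (dY Ox) (dpsi (YU Ox)).
by rewrite /partial -[LHS]E2 D (deriveEjacobian _ (dpsi (YU Ox))).
Qed.

Lemma rank_jacobian_chart x : O x -> \rank ('J X x) = p.
Proof.
move=> Ox; rewrite jacobian_chart// mxrankMfree ?rY//.
by rewrite row_free_unit jacobian_unit//; exact: YU.
Qed.

Let nuE x : O x -> X x *m A = Y x *m 'J psi (Y x).
Proof. by move=> Ox; rewrite XE// (euler_jacobian dpsi psiS dS (YU Ox)). Qed.

Lemma euler_chart_neq0 x : O x -> X x *m A != 0.
Proof.
move=> Ox; rewrite nuE//; apply/eqP => Y0.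
have /negP := U0 (YU Ox); apply; apply/eqP.
by rewrite -(mulmxK (jacobian_unit (YU Ox)) (Y x)) Y0 mul0mx.
Qed.

Lemma jacobian_sphere x : O x -> 'J Y x *m (Y x)^T = 0.
Proof.
move=> Ox; apply/colP => i; rewrite [RHS]mxE.
rewrite mulmx_entry -deriveEjacobian; last exact: dY.
have E : \forall y \near x, sqnorm (Y y) = q.
  by have := open_nbhs_nbhs (conj oO Ox); apply: filterS => y /Yq.
have := near_eq_derive (delta_mx 0 i) E; rewrite derive_cst.
have /@derive_val -> :=
  is_derive_diffcomp (delta_mx 0 i) (dY Ox) (differentiable_sqnorm (Y x)).
have /@derive_val -> := is_derive_sqnorm (Y x) ('D_(delta_mx 0 i) Y x).
move=> /eqP; rewrite mulf_eq0 pnatr_eq0/= => /eqP D0.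
by rewrite mx11_trE trmx_mul trmxK.
Qed.

Lemma jacobian_euler_orth x : O x -> 'J X x *m G (X x) *m (X x *m A)^T = 0.
Proof.
move=> Ox; rewrite nuE// jacobian_chart// XE// trmx_mul.
transitivity ('J Y x *m kahler_metric Phi (Y x) *m (Y x)^T).
  by rewrite KE ?mulmxA//; exact: YU.
rewrite -mulmxA kahler_metricz//; last exact/U0/YU.
by rewrite -scalemxAr jacobian_sphere// scaler0.
Qed.

Let s := ln q.

Lemma euler_norm x : O x -> inner G (X x) (X x *m A) (X x *m A) = 2 * u2 s.
Proof.
move=> Ox; have z0 := U0 (YU Ox).
have q0 : 0 < q by rewrite -(Yq Ox) sqnorm_gt0.
rewrite /inner nuE// XE// trmx_mul.
transitivity ((Y x *m kahler_metric Phi (Y x) *m (Y x)^T) 0 0).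
  by rewrite KE ?mulmxA//; exact: YU.
rewrite -mulmxA kahler_metricz// -scalemxAr mxE -sqnormE Yq//.
by rewrite divfK// gt_eqF.
Qed.

(** The coefficients a0, b0 are those of the metric, so that a0 + b0 q = 2 u''/q;
    replacing (u', u'') by (2 u'', 2 u''') gives those of its Lie derivative. *)
Lemma mean_curvature_sphere x : O x ->
  mean_curvature G X x = - (log_volume_rate n u s / (2 * u2 s)) *: (X x *m A).
Proof.
move=> Ox; have z0 := U0 (YU Ox).
have q0 : 0 < q by rewrite -(Yq Ox) sqnorm_gt0.
have dX := smooth_on_differentiable sX Ox.
rewrite (mean_curvature_lie symG posG dX (rank_jacobian_chart Ox)
  (euler_chart_neq0 Ox) (jacobian_euler_orth Ox) pm (dG _) erefl); first last.
- by move=> i; exact: smooth_on_differentiable (smooth_on_partial i sX) Ox.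
- have := open_nbhs_nbhs (conj oO Ox); apply: filterS => y Oy i.
  have dXy := smooth_on_differentiable sX Oy.
  rewrite -row_jacobian// /inner -row_mul -(row_id 0 (X y *m A)).
  rewrite -/(inner G (X y) _ _).
  have := jacobian_euler_orth Oy => /matrixP/(_ i 0).
  by rewrite [RHS]mxE => <-; rewrite row_id -!row_mul [LHS]mxE.
congr (- _ *: _); rewrite euler_norm//.
have K1 := kahler_metric_radial su z0.
have D1 := is_derive_kahler_metric su z0.
have L1 := lie_pullback oU U_cone dpsi psiS S1 dS KE (YU Ox) (dG _) D1.
have hE : Defs.induced G X x = 'J Y x *m kahler_metric Phi (Y x) *m ('J Y x)^T.
  rewrite /Defs.induced (XE Ox); apply: mulmx_congr (jacobian_chart Ox) _.
  by rewrite KE//; exact: YU.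
have lE : 'J X x *m lie_derivative G A (X x) *m ('J X x)^T =
    'J Y x *m radial_form (4 / q * u2 s) (4 / q ^+ 2 * (u3 s - u2 s)) (Y x) *m ('J Y x)^T.
  rewrite (XE Ox); apply: mulmx_congr (jacobian_chart Ox) _.
  rewrite (Yq Ox) in L1.
  exact: L1.
have JY0 := jacobian_sphere Ox.
have rfE a b : 'J Y x *m radial_form a b (Y x) *m ('J Y x)^T =
    'J Y x *m (a%:M + b *: ((mulJ (Y x))^T *m mulJ (Y x))) *m ('J Y x)^T.
  rewrite /radial_form scalerDr addrCA addrC mulmxDr mulmxDl.
  by rewrite -scalemxAr -scalemxAl !mulmxA JY0 !mul0mx scaler0 addr0.
have hu' := induced_unit posG (rank_jacobian_chart Ox).
rewrite (Yq Ox) in K1.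
pose a0 := 2 / q * u1 s; pose b0 := 2 / q ^+ 2 * (u2 s - u1 s).
have hE2 : Defs.induced G X x =
    'J Y x *m (a0%:M + b0 *: ((mulJ (Y x))^T *m mulJ (Y x))) *m ('J Y x)^T.
  by rewrite hE K1; exact: rfE.
rewrite hE2 in hu'; rewrite lE hE2 rfE.
have J0 : (mulJ (Y x) *m (Y x)^T) 0 0 = 0.
  by rewrite mx11_trE trmx_mul trmxK mulJ_orth.
have JJ : (mulJ (Y x) *m (mulJ (Y x))^T) 0 0 = q by rewrite -sqnormE mulJ_sqnorm Yq.
have u1n : u1 s != 0 by rewrite gt_eqF.
have u2n : u2 s != 0 by rewrite gt_eqF.
have qn : q != 0 by rewrite gt_eqF.
have a0n : a0 != 0 by rewrite !mulf_neq0 ?invr_eq0 ?pnatr_eq0.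
have abE : a0 + b0 * q = 2 / q * u2 s by rewrite /a0 /b0; field.
have abn : a0 + b0 * q != 0 by rewrite abE !mulf_neq0 ?invr_eq0 ?pnatr_eq0.
have -> := mxtrace_sphere (4 / q * u2 s) (4 / q ^+ 2 * (u3 s - u2 s))
  pm (rY Ox) z0 JY0 J0 JJ a0n abn hu'.
rewrite abE /a0 /log_volume_rate -/(u1 s) -/(u2 s) -/(u3 s).
have -> : p%:R = 2 * n%:R - 1 :> R.
  by rewrite -[p%:R](addrK 1) natr1 pm /m natrD; congr (_ - _); rewrite mulr_natl.
move: (u1 s) (u2 s) (u3 s) u1n u2n => c1 c2 c3 c1n c2n.
by field; rewrite c1n c2n qn.
Qed.

Lemma normal_gradient_sphere x : O x ->
  normal_part G X x (gradient G f (X x)) = c *: (X x *m A).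
Proof.
move=> Ox; have dX := smooth_on_differentiable sX Ox.
rewrite (normal_part_line symG posG dX (rank_jacobian_chart Ox)
  (euler_chart_neq0 Ox) (jacobian_euler_orth Ox) pm).
have -> : gradient G f (X x) = c *: (X x *m A).
  by rewrite (XE Ox); exact: gradient_potential (YU Ox).
have -> : inner G (X x) (c *: (X x *m A)) (X x *m A) =
   c * inner G (X x) (X x *m A) (X x *m A).
  by rewrite innerZl.
by rewrite mulfK// gt_eqF// posG// euler_chart_neq0.
Qed.

End SphereInChart.

(** * Bundle charts in the coordinates z *)

Section ComplexSmooth.
Variables (R : realType) (p : nat) (U : set 'rV[R]_p).
Hypothesis oU : open U.
Implicit Types f g : 'rV[R]_p -> R[i].

Definition csmooth_on f :=
  smooth_on U (fun x => complex.Re (f x)) /\ smooth_on U (fun x => complex.Im (f x)).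

Lemma csmooth_on_cst (a : R[i]) : csmooth_on (fun=> a).
Proof. by split; exact: smooth_on_cst. Qed.

Lemma csmooth_onM f g : csmooth_on f -> csmooth_on g ->
  csmooth_on (fun x => f x * g x).
Proof.
move=> [f1 f2] [g1 g2]; split.
  have -> : (fun x => complex.Re (f x * g x)) = fun x =>
      complex.Re (f x) * complex.Re (g x) + - (complex.Im (f x) * complex.Im (g x)).
    by apply/funext => x; case: (f x) (g x) => [? ?] [].
  by apply: smooth_onD => //; [|apply: smooth_onN => //]; exact: smooth_onM.
have -> : (fun x => complex.Im (f x * g x)) = fun x =>
    complex.Re (f x) * complex.Im (g x) + complex.Im (f x) * complex.Re (g x).
  by apply/funext => x; case: (f x) (g x) => [? ?] [].
by apply: smooth_onD => //; exact: smooth_onM.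
Qed.

Lemma csmooth_onX f l : csmooth_on f -> csmooth_on (fun x => f x ^+ l).
Proof.
move=> sf; elim: l => [|l IH]; first exact: csmooth_on_cst.
by under eq_fun do rewrite exprS; exact: csmooth_onM.
Qed.

Lemma complex_sqr_neq0 (a : R[i]) : a != 0 ->
  complex.Re a * complex.Re a + complex.Im a * complex.Im a != 0.
Proof.
case: a => a b /=; apply: contra => /eqP ab.
rewrite eq_complex/= -(sqrf_eq0 a) -(sqrf_eq0 b) -paddr_eq0 ?sqr_ge0//.
by rewrite !expr2 ab.
Qed.

Lemma csmooth_onV f : (forall x, U x -> f x != 0) -> csmooth_on f ->
  csmooth_on (fun x => (f x)^-1).
Proof.
move=> f0 [f1 f2].
have sV : smooth_on U (fun x => (complex.Re (f x) * complex.Re (f x) +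
    complex.Im (f x) * complex.Im (f x))^-1).
  apply: smooth_onV => //; first by move=> x /f0; exact: complex_sqr_neq0.
  by apply: smooth_onD => //; exact: smooth_onM.
split.
  have -> : (fun x => complex.Re (f x)^-1) = fun x => complex.Re (f x) *
     (complex.Re (f x) * complex.Re (f x) + complex.Im (f x) * complex.Im (f x))^-1.
    by apply/funext => x; case: (f x) => a b /=; rewrite !expr2.
  exact: smooth_onM.
have -> : (fun x => complex.Im (f x)^-1) = fun x => - (complex.Im (f x) *
     (complex.Re (f x) * complex.Re (f x) + complex.Im (f x) * complex.Im (f x))^-1).
  by apply/funext => x; case: (f x) => a b /=; rewrite !expr2.
by apply: smooth_onN => //; exact: smooth_onM.
Qed.

Lemma smooth_on_of_zc n (w : 'rV[R]_p -> 'I_n -> R[i]) :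
  (forall j, csmooth_on (fun x => w x j)) -> smooth_on U (fun x => of_zc (w x)).
Proof.
move=> sw; apply/smooth_on_rowP => // i; rewrite -(splitK i).
case: (fintype.split i) => j /=.
  by under eq_fun do rewrite row_mxEl mxE; have [] := sw j.
by under eq_fun do rewrite row_mxEr mxE; have [] := sw j.
Qed.

Lemma csmooth_on_zc n (j : 'I_n) (Y : 'rV[R]_p -> 'rV[R]_(n + n)) :
  smooth_on U Y -> csmooth_on (fun x => zc j (Y x)).
Proof. by move=> sY; split; exact: smooth_on_coord. Qed.

End ComplexSmooth.

Section BundleCoordinates.
Variables (R : realType) (n k : nat).
Implicit Types (z : 'rV[R]_(n + n)) (j : 'I_n) (b : bool).

(** The chart (j, b) of the bundle composed with the embedding of C^n minus the
    origin; meaningful where z^j is nonzero. *)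
Definition bundle_coord j b z : 'rV[R]_(n + n) :=
  of_zc (fun i => if i == j then (if b then (zc j z ^+ k)^-1 else zc j z ^+ k)
                  else zc i z / zc j z).

Lemma smooth_on_bundle_coord p (U : set 'rV[R]_p) (Y : 'rV[R]_p -> 'rV[R]_(n + n)) j b :
  open U -> smooth_on U Y -> (forall x, U x -> zc j (Y x) != 0) ->
  smooth_on U (fun x => bundle_coord j b (Y x)).
Proof.
move=> oU sY Y0; apply: smooth_on_of_zc => // i.
have sz l : csmooth_on U (fun x => zc l (Y x)) by exact: csmooth_on_zc.
case: eqVneq => _.
  have sk := csmooth_onX oU k (sz j).
  case: b => //; apply: csmooth_onV => // x Ux.
  by rewrite expf_neq0// Y0.
by apply: csmooth_onM => //; exact: csmooth_onV.
Qed.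

Lemma open_zc_neq0 j : open [set z : 'rV[R]_(n + n) | zc j z != 0].
Proof.
pose N z := z 0 (lshift n j) * z 0 (lshift n j) + z 0 (rshift n j) * z 0 (rshift n j).
have -> : [set z : 'rV[R]_(n + n) | zc j z != 0] = N @^-1` [set t | t != 0].
  apply/seteqP; split=> z /=; first exact: complex_sqr_neq0.
  by apply: contra => /eqP[z1 z2]; rewrite /N z1 z2 mul0r addr0.
apply: open_comp; last exact: open_neq.
move=> z _; have sN : smooth_on setT N.
  have oT : open [set: 'rV[R]_(n + n)] by exact: openT.
  by apply: smooth_onD => //; apply: smooth_onM => //; exact: smooth_on_id_coord.
exact: (sN 0%N).
Qed.

Lemma smooth_on_id p (U : set 'rV[R]_p) : open U -> smooth_on U (fun x => x).
Proof. by move=> oU; apply/smooth_on_rowP => // i; exact: smooth_on_id_coord. Qed.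

Lemma differentiable_bundle_coord j b z : zc j z != 0 ->
  differentiable (bundle_coord j b) z.
Proof.
move=> z0; have oU := @open_zc_neq0 j.
apply: smooth_on_differentiable z0.
exact: smooth_on_bundle_coord oU (smooth_on_id oU) _.
Qed.

Lemma zcZ (l : R) z j : zc j (l *: z) = l%:C * zc j z.
Proof. by rewrite /zc !mxE; apply/eqP; rewrite eq_complex/= !mul0r subr0 addr0 !eqxx. Qed.

(** Multiplication by [t] of the [j]-th complex coordinate and by [s] of the others,
    acting on row vectors of real coordinates. *)
Definition fibre_scaling j (s t : R) : 'M[R]_(n + n) :=
  diag_mx (\row_i if (i == lshift n j) || (i == rshift n j) then t else s).

Lemma fibre_scalingE j (t : R) (w : 'I_n -> R[i]) :
  of_zc w *m fibre_scaling j 1 t =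
  of_zc (fun i => if i == j then t%:C * w i else w i).
Proof.
apply/rowP => i; rewrite mul_mx_diag mxE [(\row__ _) 0 i]mxE -(splitK i).
case: (fintype.split i) => l /=.
  rewrite !row_mxEl !mxE (inj_eq (@lshift_inj _ _)) eq_lrshift orbF.
  by case: eqVneq => _; [case: (w l) => a b /=; ring|rewrite mulr1].
rewrite !row_mxEr !mxE (inj_eq (@rshift_inj _ _)) eq_rlshift orFb.
by case: eqVneq => _; [case: (w l) => a b /=; ring|rewrite mulr1].
Qed.

Definition fibre_power b (l : R) : R := if b then (l ^+ k)^-1 else l ^+ k.

Lemma bundle_coordZ j b l z : 0 < l -> zc j z != 0 ->
  bundle_coord j b (l *: z) = bundle_coord j b z *m fibre_scaling j 1 (fibre_power b l).
Proof.
move=> l0 z0; rewrite fibre_scalingE; congr of_zc; apply/funext => i.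
have lC : l%:C != 0 :> R[i] by rewrite eq_complex/= eqxx andbT gt_eqF.
rewrite !zcZ; case: eqVneq => [_|_]; last first.
  by rewrite invfM mulrACA divff// mul1r.
rewrite /fibre_power exprMn; case: b; last by rewrite rmorphXn.
by rewrite invfM fmorphV rmorphXn.
Qed.

Lemma fibre_scaling1 j b : fibre_scaling j 1 (fibre_power b 1) = 1%:M.
Proof.
have -> : fibre_power b 1 = 1 by rewrite /fibre_power expr1n invr1 if_same.
apply/matrixP => i l; rewrite !mxE.
by rewrite if_same.
Qed.

Lemma is_derive_fibre_scaling j b :
  is_derive (1 : R) (1 : R) (fun l => fibre_scaling j 1 (fibre_power b l))
    (fibre_scaling j 0 (if b then - k%:R else k%:R)).
Proof.
have dX : is_derive (1 : R) (1 : R) (fun l : R => l ^+ k) k%:R.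
  apply: DeriveDef; first exact: exprn_derivable.
  by rewrite exp_derive /GRing.scale/= expr1n !mulr1.
have dP : is_derive (1 : R) (1 : R) (fibre_power b) (if b then - k%:R else k%:R).
  case: b; last exact: dX.
  have X0 : (1 : R) ^+ k != 0 by rewrite expr1n oner_neq0.
  have -> : fibre_power true = (fun l : R => (l ^+ k)^-1) by [].
  by have := is_derive1V (f := fun l => l ^+ k) X0 dX; rewrite !expr1n divr1 => h; exact: h.
apply/is_derive_mxP => i l; rewrite !mxE.
under eq_fun do rewrite !mxE.
case: (i == l) => /=; last first.
  by under eq_fun do rewrite mulr0n; rewrite mulr0n; exact: is_derive1_cst.
under eq_fun do rewrite mulr1n; rewrite mulr1n.
by case: ifP => _ //; exact: is_derive1_cst.
Qed.

End BundleCoordinates.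

Section BundlePoints.
Variables (R : realType) (n k : nat).

Lemma bundle_pt_eqP (z z' : 'rV[R]_(n + n)) (z0 : z != 0) (z0' : z' != 0)
    (a b a' b' : R[i]) (ab : (a != 0) || (b != 0)) (ab' : (a' != 0) || (b' != 0)) :
  bundle_pt k z0 ab = bundle_pt k z0' ab' <->
  exists mu nu : R[i], [/\ mu != 0, nu != 0,
    forall j, zc j z' = mu * zc j z, a' = nu * mu ^+ k * a & b' = nu * b].
Proof.
have E1 (c d : R[i]) : zc 0 (fibre_vec c d) = c by rewrite of_zcK.
have E2 (c d : R[i]) : zc 1 (fibre_vec c d) = d by rewrite of_zcK.
split.
  move=> /(@eqmodP _ _ _) /asboolP[mu [nu [mu0 nu0]]].
  rewrite !set_valE/= !E1 !E2 => h1 h2 h3.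
  by exists mu, nu.
move=> [mu [nu [mu0 nu0 h1 h2 h3]]].
apply/(@eqmodP _ _ _)/asboolP; exists mu, nu; split=> //.
- by rewrite !set_valE/= !E1.
- by rewrite !set_valE/= !E2.
Qed.

Lemma emb_eqP (z z' : punctured R n) : emb k z = emb k z' <->
  exists2 mu : R[i], mu ^+ k = 1 & forall j, zc j (set_val z') = mu * zc j (set_val z).
Proof.
split.
  move=> /bundle_pt_eqP[mu [nu [mu0 nu0 h1 h2 h3]]].
  exists mu => //; move: h3; rewrite mulr1 => nu1.
  by move: h2; rewrite -nu1 mul1r mulr1 => <-.
move=> [mu mu1 h1]; apply/bundle_pt_eqP.
have mu0 : mu != 0.
  apply/eqP => mu0; have /negP := set_mem (valP z'); apply; rewrite -set_valE.
  have h0 j : zc j (set_val z') = 0 by rewrite h1 mu0 mul0r.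
  apply/eqP/rowP => i; rewrite [RHS]mxE -(splitK i).
  by case: (fintype.split i) => j /=; have [] := h0 j.
by exists mu, 1; rewrite mu1 !mulr1 oner_neq0.
Qed.

Lemma zc_inj (z z' : 'rV[R]_(n + n)) : (forall j, zc j z = zc j z') -> z = z'.
Proof.
move=> zE; apply/rowP => i; rewrite -(splitK i).
by case: (fintype.split i) => j /=; have [] := zE j.
Qed.

(** The scaling factors (mu, nu) of the two representatives are forced: the [j]-th
    coordinate gives mu = z^j, then the fibre gives nu. *)
Lemma bundle_par_embP j b w (z : punctured R n) :
  bundle_par k (j, b) w = emb k z <->
  zc j (set_val z) != 0 /\ w = bundle_coord k j b (set_val z).
Proof.
set zv := set_val z.
have affE i v : zc i (affine j v) = if i == j then 1 else zc i v by rewrite of_zcK.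
have wE (t : R[i]) : zc j zv != 0 ->
  (forall i, zc i zv = zc j zv * zc i (affine j w)) ->
  (if b then (zc j zv ^+ k)^-1 else zc j zv ^+ k) = zc j w ->
  w = bundle_coord k j b zv.
  move=> zj0 h hj; apply: zc_inj => i; rewrite of_zcK; case: eqVneq => [->|ij]; first by [].
  by rewrite h affE (negPf ij) mulrC mulKf.
split.
- case: b wE => wE /bundle_pt_eqP[mu [nu [mu0 nu0 h1 h2 h3]]].
  + move: (h1 j); rewrite affE eqxx mulr1 => zj.
    have nu1 : nu = 1 by rewrite h3 mulr1.
    rewrite zj; split=> //; apply: (wE 1); rewrite ?zj//.
    apply: (mulfI (expf_neq0 k mu0)); rewrite divff ?expf_neq0//.
    by rewrite h2 nu1 mul1r.
  + move: (h1 j); rewrite affE eqxx mulr1 => zj.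
    rewrite zj; split=> //; apply: (wE 1); rewrite ?zj//.
    apply: (mulfI nu0); rewrite -h3.
    by rewrite h2 mulr1.
- move=> [zj0 ->].
  have E i : zc i zv = zc j zv * zc i (affine j (bundle_coord k j b zv)).
    rewrite affE of_zcK; case: eqVneq => [->|_]; first by rewrite mulr1.
    by rewrite mulrC divfK.
  case: b {wE} E => E; apply/bundle_pt_eqP.
  + exists (zc j zv), 1; rewrite oner_neq0 !mul1r of_zcK eqxx divff ?expf_neq0//.
  + exists (zc j zv), (zc j zv ^+ k)^-1.
    by rewrite invr_eq0 of_zcK eqxx !mulr1 mulVf ?expf_neq0//.
Qed.

Lemma coord_emb j b (z : punctured R n) : zc j (set_val z) != 0 ->
  Defs.coord (M := Nnk R n k) (j, b) (emb k z) = bundle_coord k j b (set_val z).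
Proof.
move=> z0; rewrite /Defs.coord; apply: xget_unique.
  by split=> //; apply/bundle_par_embP.
by move=> w [_ /bundle_par_embP[]].
Qed.

Lemma emb_in_chart j b (z : punctured R n) :
  (par (c := Nnk R n k) (j, b) @` dom (c := Nnk R n k) (j, b)) (emb k z) <->
  zc j (set_val z) != 0.
Proof.
split; first by move=> [w _ /bundle_par_embP[]].
by move=> z0; exists (bundle_coord k j b (set_val z)) => //; apply/bundle_par_embP.
Qed.

End BundlePoints.

Section JacobianNear.
Variables (R : realType) (p m : nat).

Lemma jacobian_near_eq (f g : 'rV[R]_p -> 'rV[R]_m) x :
  (\near x, f x = g x) -> differentiable f x -> 'J f x = 'J g x.
Proof.
move=> fg df; have dg := near_eq_differentiable fg df.
apply/row_matrixP => i; rewrite [LHS](row_jacobian i df) [RHS](row_jacobian i dg).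
exact: near_eq_derive.
Qed.

End JacobianNear.

(** * The soliton in a bundle chart *)

Section Soliton.
Variables (R : realType) (n k : nat) (u : R -> R).
Variable S : shrinking_soliton (Nnk R n k).
Hypothesis hS : is_cao_soliton u S.
Variables (j : 'I_n) (b : bool).

Let jb : chart (Nnk R n k) := (j, b).
Let G : 'rV[R]_(n + n) -> 'M[R]_(n + n) := metric S jb.
Let f : 'rV[R]_(n + n) -> R := potential S \o Defs.par (c := Nnk R n k) jb.
Let psi : 'rV[R]_(n + n) -> 'rV[R]_(n + n) := bundle_coord k j b.

Lemma soliton_metric_sym y : (G y)^T = G y.
Proof. by have [_ /(_ jb y I)[]] := metric_riemannian S. Qed.

Lemma soliton_metric_pos y v : v != 0 -> 0 < inner G y v v.
Proof. by have [_ /(_ jb y I)[_ h] _] := metric_riemannian S; exact: h. Qed.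

Lemma soliton_metric_diff y : differentiable G y.
Proof.
have [/(_ jb) sG _ _] := metric_riemannian S.
exact: (smooth_on_differentiable sG I).
Qed.

Lemma soliton_potential_diff y : differentiable f y.
Proof. exact: (smooth_on_differentiable (potential_smooth S jb) I). Qed.

(** Total as charts require; the value [affine j z] at z = 0 is arbitrary. *)
Definition punctured_pt (z : 'rV[R]_(n + n)) : punctured R n :=
  insubd (SigSub (mem_set (affine_neq0 j z : punctured_set (affine j z)))
            : @punctured_set R n) z.

Lemma punctured_ptE z : z != 0 -> set_val (punctured_pt z) = z.
Proof. by move=> z0; rewrite set_valE /punctured_pt insubdK//; exact/mem_set. Qed.

Definition punctured_id_chart : punctured_chart R n :=
  PuncturedChart (@open_punctured R (n + n)) punctured_ptE.

Lemma zc_neq0 (z : 'rV[R]_(n + n)) : zc j z != 0 -> z != 0.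
Proof. by apply: contraNneq => ->; rewrite zc0. Qed.

Lemma soliton_pullback z : zc j z != 0 ->
  kahler_metric (kahler_potential u) z = 'J psi z *m G (psi z) *m ('J psi z)^T.
Proof.
move=> zj; have z0 := zc_neq0 zj.
have zE := punctured_ptE z0.
have pb := hS.1 punctured_id_chart jb z.
have ld : loc_dom (emb k : punctured R n -> Nnk R n k) punctured_id_chart jb z.
  by split=> //; apply/emb_in_chart; rewrite zE.
have locE y : zc j y != 0 ->
    loc (emb k : punctured R n -> Nnk R n k) punctured_id_chart jb y = psi y.
  move=> yj; have yE := punctured_ptE (zc_neq0 yj).
  by rewrite /loc/= coord_emb yE.
have cg (J J' : 'M[R]_(n + n)) y y' : J = J' -> y = y' ->
  J *m G y *m J^T = J' *m G y' *m J'^T by move=> -> ->.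
apply: etrans (pb ld) (cg _ _ _ _ _ (locE z zj)).
apply/esym/jacobian_near_eq; last exact: differentiable_bundle_coord.
have := open_nbhs_nbhs (conj (@open_zc_neq0 R n j) zj).
by apply: filterS => y yj; rewrite locE.
Qed.

Lemma soliton_potentialE z : zc j z != 0 ->
  f (psi z) = soliton_potential n u (ln (sqnorm z)).
Proof.
move=> zj; have zE := punctured_ptE (zc_neq0 zj).
have h : bundle_par k (j, b) (psi z) = emb k (punctured_pt z).
  by apply/bundle_par_embP; rewrite zE.
have -> : f (psi z) = potential S (bundle_par k (j, b) (psi z)) by [].
by rewrite h hS.2 zE.
Qed.

End Soliton.

(** * Topology of the lens space and of its inclusion *)

Section Lens.
Variables (R : realType) (n k : nat) (r : {posnum R}).
Hypothesis k0 : (0 < k)%N.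

Lemma root_of_unityX l m :
  @Defs.root_of_unity R k l ^+ m = @Defs.root_of_unity R k (l * m%:Z).
Proof.
elim: m => [|m IH]; first by rewrite mulr0 root_of_unity0.
by rewrite exprS IH -root_of_unityD -[m.+1%:Z]/(Posz m.+1) -addn1 addrC PoszD mulrDr mulr1.
Qed.

Lemma cos_sin_2pi (m : nat) : cos (2 * pi * m%:R) = 1 :> R /\ sin (2 * pi * m%:R) = 0 :> R.
Proof.
elim: m => [|m [IHc IHs]]; first by rewrite mulr0 cos0 sin0.
rewrite -[m.+1%:R]natr1 mulrDr mulr1 mulr_natl.
by rewrite cosD2pi sinD2pi -(mulr_natl pi 2).
Qed.

Lemma root_of_unity_k l : @Defs.root_of_unity R k l ^+ k = 1.
Proof.
rewrite root_of_unityX /Defs.root_of_unity.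
have -> : 2 * pi * (l * k%:Z)%:~R / k%:R = 2 * pi * l%:~R :> R.
  by rewrite intrM -pmulrn; field; rewrite pnatr_eq0 -lt0n.
case: l => m.
  by have [c s] := cos_sin_2pi m; rewrite -pmulrn c s.
have [c s] := cos_sin_2pi m.+1.
by rewrite NegzE mulrNz mulrN -pmulrn cosN sinN c s oppr0.
Qed.

(** The chosen representative differs from [x] by a [k]-th root of unity, which the
    embedding ignores. *)
Lemma lens_incl_proj (x : @sphere R n r) :
  lens_incl n k r (lens_proj k x) = emb k (sphere_incl x).
Proof.
rewrite /lens_incl; apply/emb_eqP.
have : lens_rel k (repr (lens_proj k x)) x.
  apply/(@eqmodP _ _ _); exact: reprK.
move=> /asboolP[l h]; exists (@Defs.root_of_unity R k l); first exact: root_of_unity_k.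
by move=> i; have := h i; rewrite !set_valE.
Qed.

End Lens.

Section ComplexContinuity.
Variables (R : realType) (T : topologicalType).
Implicit Types f g : T -> R[i].

Definition ccontinuous f :=
  continuous (fun x => complex.Re (f x)) /\ continuous (fun x => complex.Im (f x)).

Lemma ccontinuousM f g : ccontinuous f -> ccontinuous g ->
  ccontinuous (fun x => f x * g x).
Proof.
move=> [f1 f2] [g1 g2]; split.
  have -> : (fun x => complex.Re (f x * g x)) = fun x =>
      complex.Re (f x) * complex.Re (g x) - complex.Im (f x) * complex.Im (g x).
    by apply/funext => x; case: (f x) (g x) => [? ?] [].
  by move=> x; apply: cvgB; apply: cvgM; [exact: f1|exact: g1|exact: f2|exact: g2].
have -> : (fun x => complex.Im (f x * g x)) = fun x =>
    complex.Re (f x) * complex.Im (g x) + complex.Im (f x) * complex.Re (g x).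
  by apply/funext => x; case: (f x) (g x) => [? ?] [].
by move=> x; apply: cvgD; apply: cvgM; [exact: f1|exact: g2|exact: f2|exact: g1].
Qed.

Lemma ccontinuousX f l : ccontinuous f -> ccontinuous (fun x => f x ^+ l).
Proof.
move=> cf; elim: l => [|l IH]; first by split=> x; exact: cvg_cst.
by under eq_fun do rewrite exprS; exact: ccontinuousM.
Qed.

Lemma ccontinuous_conj f : ccontinuous f -> ccontinuous (fun x => conjc (f x)).
Proof.
move=> [f1 f2]; split.
  have -> : (fun x => complex.Re (conjc (f x))) = fun x => complex.Re (f x).
    by apply/funext => x; case: (f x).
  exact: f1.
have -> : (fun x => complex.Im (conjc (f x))) = fun x => - complex.Im (f x).
  by apply/funext => x; case: (f x).
by move=> x; apply: cvgN; exact: f2.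
Qed.

Lemma ccontinuous_real (h : T -> R) : continuous h -> ccontinuous (fun x => (h x)%:C).
Proof. by move=> ch; split=> //= x; exact: cvg_cst. Qed.

Lemma ccontinuous_zc n (j : 'I_n) (Y : T -> 'rV[R]_(n + n)) :
  continuous Y -> ccontinuous (fun x => zc j (Y x)).
Proof.
move=> cY; split=> x.
  apply: (@continuous_comp _ _ _ Y (fun v : 'rV[R]_(n + n) => v 0 (lshift n j) : R)).
    exact: cY.
  exact: coord_continuous.
apply: (@continuous_comp _ _ _ Y (fun v : 'rV[R]_(n + n) => v 0 (rshift n j) : R)).
  exact: cY.
exact: coord_continuous.
Qed.

Lemma continuous_sum (V : normedModType R) I (s : seq I) (F : I -> T -> V) :
  (forall i, continuous (F i)) -> continuous (fun x => \sum_(i <- s) F i x).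
Proof.
move=> cF; elim: s => [|i s IH].
  by under eq_fun do rewrite big_nil; move=> x; exact: cvg_cst.
under eq_fun do rewrite big_cons; move=> x; apply: cvgD; first exact: cF.
exact: IH.
Qed.

Lemma continuous_mx m n (F : T -> 'M[R]_(m, n)) :
  (forall i j, continuous (fun x => F x i j : R)) -> continuous F.
Proof.
move=> cF.
have -> : F = fun x => \sum_i \sum_j F x i j *: delta_mx i j.
  by apply/funext => x; rewrite -matrix_sum_delta.
apply: continuous_sum => i; apply: continuous_sum => j x.
by apply: cvgZl; exact: cF.
Qed.

Lemma continuous_of_zc n (w : T -> 'I_n -> R[i]) (l : 'I_(n + n)) :
  (forall j, ccontinuous (fun x => w x j)) -> continuous (fun x => of_zc (w x) 0 l : R).
Proof.
move=> cw; rewrite -(splitK l); case: (fintype.split l) => j /=.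
  by under eq_fun do rewrite row_mxEl mxE; have [] := cw j.
by under eq_fun do rewrite row_mxEr mxE; have [] := cw j.
Qed.

End ComplexContinuity.

Section Separation.
Variables (R : realType) (n k : nat).
Hypothesis k0 : (0 < k)%N.

Definition csq (a : R[i]) : R := complex.Re a ^+ 2 + complex.Im a ^+ 2.

Lemma csqM a b : csq (a * b) = csq a * csq b.
Proof. by case: a b => [a1 a2] [b1 b2]; rewrite /csq /=; ring. Qed.

Lemma csqE a : (csq a)%:C = a * conjc a.
Proof.
case: a => a1 a2; apply/eqP; rewrite eq_complex/= /csq/=.
by apply/andP; split; apply/eqP; ring.
Qed.

Lemma csq_ge0 a : 0 <= csq a. Proof. by rewrite addr_ge0 ?sqr_ge0. Qed.

Lemma csq_eq0 a : (csq a == 0) = (a == 0).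
Proof. by case: a => a b; rewrite /csq/= paddr_eq0 ?sqr_ge0// !sqrf_eq0 eq_complex. Qed.

Lemma csqX a m : csq (a ^+ m) = csq a ^+ m.
Proof.
by elim: m => [|m IH]; [rewrite /csq/= !expr0 expr1n expr0n addr0|rewrite !exprS csqM IH].
Qed.

Lemma sqnorm_zc (z : 'rV[R]_(n + n)) : sqnorm z = \sum_j csq (zc j z).
Proof. by rewrite /sqnorm big_split_ord/= -big_split. Qed.

Lemma sqnorm_zcM (z z' : 'rV[R]_(n + n)) mu :
  (forall j, zc j z' = mu * zc j z) -> sqnorm z' = csq mu * sqnorm z.
Proof.
by move=> h; rewrite !sqnorm_zc mulr_sumr; apply: eq_bigr => j _; rewrite h csqM.
Qed.

Implicit Types q : @bundle_set R n.

Let za q := zc 0 (set_val q).2.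
Let zb q := zc 1 (set_val q).2.

(** Under a change of representative by (mu, nu) this is multiplied by
    |nu|^2 |mu|^(2k). *)
Definition bundle_norm q : R := csq (za q) + csq (zb q) * sqnorm (set_val q).1 ^+ k.

Lemma bundle_norm_neq0 q : bundle_norm q != 0.
Proof.
have [z0 v0] := set_mem (valP q); rewrite -set_valE in z0 v0.
rewrite /bundle_norm paddr_eq0 ?mulr_ge0 ?csq_ge0 ?exprn_ge0 ?sqnorm_ge0//.
rewrite csq_eq0 mulf_eq0 expf_eq0 k0 csq_eq0 /= (gt_eqF (x := sqnorm _)) ?sqnorm_gt0// orbF.
apply: contra v0 => /andP[/eqP a0 /eqP b0].
apply/eqP/zc_inj => j; rewrite zc0; have := ltn_ord j.
case: j => -[|[|//]] hj _.
  by rewrite -[RHS]a0; congr zc; exact/val_inj.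
by rewrite -[RHS]b0; congr zc; exact/val_inj.
Qed.

(** (z^i)^(k-1) z^l b conj(a) / (|a|^2 + |b|^2 |z|^(2k)): homogeneous of degree 0, so a
    function on the bundle. *)
Definition sep_entry q (i l : 'I_n) : R[i] :=
  zc i (set_val q).1 ^+ k.-1 * zc l (set_val q).1 * zb q * conjc (za q) *
  ((bundle_norm q)^-1)%:C.

Definition separating q : 'M[R]_(n, n + n) :=
  \matrix_(i, l) of_zc (sep_entry q i) 0 l.

Lemma separating_rel q q' : bundle_rel k q q' -> separating q = separating q'.
Proof.
move=> /asboolP[mu [nu [mu0 nu0 h1 h2 h3]]].
suff E i l : sep_entry q i l = sep_entry q' i l.
  apply/matrixP => i l; rewrite [LHS]mxE [RHS]mxE.
  by rewrite (_ : sep_entry q i = sep_entry q' i)//; exact/funext.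
have nE : bundle_norm q' = csq nu * csq mu ^+ k * bundle_norm q.
  rewrite /bundle_norm /za /zb h2 h3 (sqnorm_zcM h1) !csqM csqX exprMn; ring.
rewrite /sep_entry nE /za /zb h1 h1 h2 h3.
pose w := nu * mu ^+ k; have w0 : w != 0 by rewrite mulf_neq0 ?expf_neq0.
have wC : conjc w != 0 by rewrite conjc_eq0.
rewrite -/w.
have -> : csq nu * csq mu ^+ k = csq w by rewrite csqM csqX.
have -> : ((csq w * bundle_norm q)^-1)%:C = w^-1 * (conjc w)^-1 * ((bundle_norm q)^-1)%:C.
  by rewrite -[w^-1 * _]invfM -csqE invfM [LHS]rmorphM fmorphV.
have conjM (x y : R[i]) : conjc (x * y) = conjc x * conjc y by exact: rmorphM.
rewrite conjM.
have wE : w = nu * (mu * mu ^+ k.-1) by rewrite /w -exprS prednK.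
have cancel_w (x ac B : R[i]) :
    x * ac * B = w * x * (conjc w * ac) * (w^-1 * (conjc w)^-1 * B).
  by field; rewrite w0 wC.
rewrite cancel_w exprMn; congr (_ * _ * _).
by rewrite wE; ring.
Qed.

Lemma continuous_separating : continuous separating.
Proof.
have cz : continuous (fun q : @bundle_set R n => (set_val q).1).
  move=> q; apply: (@continuous_comp _ _ _ set_val fst); first exact: initial_continuous.
  exact: cvg_fst.
have cv : continuous (fun q : @bundle_set R n => (set_val q).2).
  move=> q; apply: (@continuous_comp _ _ _ set_val snd); first exact: initial_continuous.
  exact: cvg_snd.
have ca := ccontinuous_zc 0 cv; have cb := ccontinuous_zc 1 cv.
have ccsq (f : @bundle_set R n -> R[i]) : ccontinuous f -> continuous (fun q => csq (f q)).
  move=> [f1 f2]; have -> : (fun q => csq (f q)) = fun q =>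
      complex.Re (f q) * complex.Re (f q) + complex.Im (f q) * complex.Im (f q).
    by apply/funext => q; rewrite /csq !expr2.
  by move=> q; exact: (cvgD (cvgM (f1 q) (f1 q)) (cvgM (f2 q) (f2 q))).
have cN : continuous bundle_norm.
  have hA := ccsq _ ca; have hB := ccsq _ cb.
  have hS : continuous (fun q : @bundle_set R n => sqnorm (set_val q).1 ^+ k).
    move=> q; apply: (@continuous_comp _ _ _
       (fun q : @bundle_set R n => sqnorm (set_val q).1) (fun t : R => t ^+ k));
      last exact: exprn_continuous.
    apply: (@continuous_comp _ _ _ (fun q : @bundle_set R n => (set_val q).1)
       (@sqnorm R (n + n))); first exact: cz.
    exact/differentiable_continuous/differentiable_sqnorm.
  move=> q; exact: (cvgD (hA q) (cvgM (hB q) (hS q))).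
apply: continuous_mx => i l.
under eq_fun do rewrite mxE.
apply: continuous_of_zc => j; rewrite /sep_entry.
apply: ccontinuousM; last first.
  by apply: ccontinuous_real => q; exact: (cvgV (bundle_norm_neq0 q) (cN q)).
apply: ccontinuousM; last exact: ccontinuous_conj.
apply: ccontinuousM; last exact: cb.
by apply: ccontinuousM; [apply: ccontinuousX|]; exact: ccontinuous_zc.
Qed.

Definition sepN (y : Nnk R n k) : 'M[R]_(n, n + n) :=
  separating (repr (y : bundle_space R n k)).

Lemma continuous_sepN : continuous sepN.
Proof.
apply: (@repr_comp_continuous _ _ _ separating continuous_separating) => a b /eqP ab.
apply/eqP/separating_rel; exact/(@eqmodP _ _ _).
Qed.

End Separation.

Section LensTopology.
Variables (R : realType) (n k : nat).
Hypothesis k0 : (0 < k)%N.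

(** cos t = 1 - 2 sin^2 (t/2). *)
Lemma cos_lt1 (t : R) : 0 < t < 2 * pi -> cos t != 1.
Proof.
move=> /andP[t0 tpi]; have s0 : 0 < sin (t / 2).
  by apply: sin_gt0_pi; rewrite divr_gt0//= ltr_pdivrMr// mulrC.
have -> : cos t = 1 - 2 * sin (t / 2) ^+ 2.
  rewrite [in LHS](splitr t) cosD -!expr2 cos2sin2; ring.
rewrite -subr_eq0 addrAC subrr sub0r oppr_eq0 mulf_neq0 ?pnatr_eq0//.
by rewrite expf_neq0// gt_eqF.
Qed.

(** e^(2 pi i/k) is a primitive [k]-th root of unity by [cos_lt1], and the powers of a
    primitive root exhaust the roots of unity. *)
Lemma unity_rootP (z : R[i]) : z ^+ k = 1 -> exists l, z = Defs.root_of_unity R k l.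
Proof.
move=> zk.
have [m pm mk] := prim_order_exists k0 (root_of_unity_k R k0 1).
have m0 := prim_order_gt0 pm.
have mE : m = k.
  apply/eqP; rewrite eqn_leq dvdn_leq//= leqNgt; apply/negP => mlt.
  have := prim_expr_order pm; rewrite root_of_unityX mul1r => /eqP.
  rewrite eq_complex/= => /andP[/eqP c1 _].
  have /eqP := c1; apply/negP; apply: cos_lt1.
  rewrite -pmulrn divr_gt0 ?mulr_gt0 ?pi_gt0 ?ltr0n//=.
  by rewrite ltr_pdivrMr ?ltr0n// ltr_pM2l ?mulr_gt0 ?pi_gt0// ltr_nat.
rewrite mE in pm; have [i ->] := prim_rootP pm zk.
by exists (1 * i%:Z); rewrite root_of_unityX.
Qed.

Variable r : {posnum R}.

Lemma lens_incl_inj : injective (lens_incl n k r).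
Proof.
move=> q q' /emb_eqP[mu mu1 h].
have [l muE] := unity_rootP mu1.
have : lens_rel k (repr (q : lens_space n k r)) (repr (q' : lens_space n k r)).
  by apply/asboolP; exists l => j; have := h j; rewrite !set_valE -muE.
rewrite -[RHS](reprK (q' : lens_space n k r)) -[LHS](reprK (q : lens_space n k r)).
by move=> h'; exact/(@eqmodP _ _ _).
Qed.

Lemma sepN_emb (z : punctured R n) : sepN (emb k z) =
  separating k (SigSub (mem_set (conj (set_mem (valP z) : set_val z != 0)
     (fibre_vec_neq0 (one_l 1)) : @bundle_set R n (set_val z, fibre_vec 1 1)))).
Proof.
rewrite /sepN; apply: separating_rel => //; apply/(@eqmodP _ _ _).
by rewrite reprK.
Qed.

(** On the sphere the denominators agree, so the monomials (z^i)^(k-1) z^l do. For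
    an i with z^i nonzero, the quotient of the two i-th coordinates is a root of
    unity mu, and the monomials with this i give z' = mu z. *)
Lemma sepN_inj (z z' : punctured R n) :
  sqnorm (set_val z) = sqnorm (set_val z') ->
  sepN (emb k z) = sepN (emb k z') -> emb k z = emb k z'.
Proof.
move=> zz'; rewrite !sepN_emb => /matrixP sE.
set q := SigSub _ in sE; set q' := SigSub _ in sE.
have eE i l : sep_entry k q i l = sep_entry k q' i l.
  rewrite -[LHS](of_zcK (sep_entry k q i)) -[RHS](of_zcK (sep_entry k q' i)).
  have h t : of_zc (sep_entry k q i) 0 t = of_zc (sep_entry k q' i) 0 t.
    by have := sE i t; rewrite [LHS]mxE [RHS]mxE.
  by rewrite /zc !h.
have q1 : (set_val q).1 = set_val z by [].
have nE : bundle_norm k q = bundle_norm k q'.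
  by rewrite /bundle_norm/= !set_valE/= zz'.
have n0 : ((bundle_norm k q')^-1)%:C != 0.
  by rewrite eq_complex/= eqxx andbT invr_eq0 bundle_norm_neq0.
have mE i l : zc i (set_val z) ^+ k.-1 * zc l (set_val z) =
              zc i (set_val z') ^+ k.-1 * zc l (set_val z').
  have := eE i l; rewrite /sep_entry nE => /(mulIf n0).
  have f0 (t : 'I_2) : zc t (fibre_vec (1 : R[i]) 1) = 1 by rewrite of_zcK if_same.
  have -> : (set_val q).2 = fibre_vec 1 1 by [].
  have -> : (set_val q').2 = fibre_vec 1 1 by [].
  by rewrite !f0 conjc1 !mulr1.
have kE i : zc i (set_val z) ^+ k = zc i (set_val z') ^+ k.
  by rewrite -(prednK k0) !exprSr.
have [i zi0] : exists i, zc i (set_val z) != 0.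
  apply: contrapT => h; have /negP := set_mem (valP z); apply; rewrite -set_valE.
  apply/eqP/zc_inj => i; rewrite zc0; apply/eqP/negPn/negP => zi.
  by apply: h; exists i.
have zi0' : zc i (set_val z') != 0.
  by have := expf_neq0 k zi0; rewrite kE expf_eq0 k0.
apply/emb_eqP; exists (zc i (set_val z') / zc i (set_val z)).
  by rewrite expr_div_n -kE divff// expf_neq0.
move=> l; apply: (mulfI (expf_neq0 k.-1 zi0')); rewrite -mE.
have kk : zc i (set_val z') ^+ k.-1 * zc i (set_val z') =
    zc i (set_val z) ^+ k.-1 * zc i (set_val z) by rewrite -!exprSr prednK// kE.
by rewrite !mulrA kk mulfK.
Qed.

Lemma continuous_emb : continuous (emb k : punctured R n -> Nnk R n k).
Proof.
pose g (z : punctured R n) : @bundle_set R n :=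
  SigSub (mem_set (conj (set_mem (valP z) : set_val z != 0)
     (fibre_vec_neq0 (one_l 1)) : @bundle_set R n (set_val z, fibre_vec 1 1))).
have cg : continuous g.
  apply: (@continuous_comp_initial _ _ _ set_val).
  have -> : set_val \o g = fun z => (set_val z, fibre_vec 1 1) by [].
  move=> z; have cz : continuous (set_val : punctured R n -> 'rV[R]_(n + n)).
    exact: initial_continuous.
  exact: (cvg_pair (cz z) (cvg_cst (fibre_vec 1 1))).
have -> : (emb k : punctured R n -> Nnk R n k) =
    \pi_(quotient_topology {eq_quot bundle_rel (R := R) (n := n) k}) \o g by [].
move=> z; apply: continuous_comp; first exact: cg.
exact: pi_continuous.
Qed.

Lemma continuous_sphere_incl : continuous (@sphere_incl R n r : _ -> punctured R n).
Proof.
apply: (@continuous_comp_initial _ _ _ set_val).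
exact: initial_continuous.
Qed.

Lemma continuous_lens_proj : continuous (@lens_proj R n k r).
Proof. exact: pi_continuous. Qed.

Lemma continuous_lens_incl : continuous (lens_incl n k r).
Proof.
apply/(@quotient_continuous _ {eq_quot lens_rel (n := n) k (r := r)}).
have -> : lens_incl n k r \o
    \pi_(quotient_topology {eq_quot (lens_rel (n := n) k (r := r))}) =
    emb k \o (@sphere_incl R n r).
  by apply/funext => x /=; rewrite -lens_incl_proj.
move=> x; apply: continuous_comp; first exact: continuous_sphere_incl.
exact: continuous_emb.
Qed.

Lemma compact_sphere : compact (@sphere R n r).
Proof.
apply: bounded_closed_compact.
  exists r%:num; split; first exact: num_real.
  move=> M rM x; rewrite /sphere/= => xr.
  rewrite [leLHS]/Num.norm/= mx_normrE; apply: bigmax_le.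
    by rewrite (le_trans _ (ltW rM)).
  move=> [i j] _ /=; rewrite (le_trans _ (ltW rM))//.
  rewrite -(@ler_pXn2r _ 2)// ?nnegrE// real_normK ?num_real// -xr /sqnorm ord1.
  by rewrite (bigD1 j)//= lerDl sumr_ge0// => l _; exact: sqr_ge0.
have -> : @sphere R n r = @sqnorm R (n + n) @^-1` [set r%:num ^+ 2] by [].
apply: closed_comp; last exact: closed_eq.
by move=> x _; exact/differentiable_continuous/differentiable_sqnorm.
Qed.

(** The image of the sphere under the quotient map, extended by a constant to
    the whole of C^n. *)
Lemma compact_lens : (0 < n)%N -> compact [set: lens n k r].
Proof.
move=> n0.
pose x0 : 'rV[R]_(n + n) := r%:num *: delta_mx 0 (lshift n (Ordinal n0)).
have x0r : @sphere R n r x0.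
  rewrite /sphere/= sqnormZ [sqnorm _](_ : _ = 1) ?mulr1// /sqnorm.
  rewrite (bigD1 (lshift n (Ordinal n0)))//= !mxE !eqxx expr1n big1 ?addr0// => i ni.
  by rewrite mxE (negPf ni) andbF expr0n.
pose h (z : 'rV[R]_(n + n)) : lens_space n k r :=
  lens_proj k (insubd (SigSub (mem_set x0r) : @sphere R n r) z).
have hE (x : @sphere R n r) : h (set_val x) = lens_proj k x.
  by rewrite /h set_valE valKd.
have -> : [set: lens n k r] = h @` (@sphere R n r).
  apply/seteqP; split=> // q _; exists (set_val (repr (q : lens_space n k r))).
    exact: set_valP.
  by rewrite hE; exact: reprK.
apply: continuous_compact compact_sphere.
apply/subspace_sigL_continuousP.
have -> : sigL (@sphere R n r) h = (@lens_proj R n k r).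
  by apply/funext => x; exact: hE.
exact: continuous_lens_proj.
Qed.

(** For U open the image of the complement of U under [sepN] is compact, hence
    closed; V is the preimage of its complement. *)
Lemma lens_incl_open (U : set (lens n k r)) : (0 < n)%N -> open U ->
  exists2 V : set (Nnk R n k), open V &
    lens_incl n k r @` U = V `&` range (lens_incl n k r).
Proof.
move=> n0 oU.
pose C := (@sepN R n k \o lens_incl n k r) @` (~` U).
have cU : compact (~` U).
  apply: subclosed_compact (compact_lens n0) _ => //; exact: open_closedC.
have cC : closed C.
  apply: compact_closed; first exact: norm_hausdorff.
  apply: continuous_compact cU; apply: continuous_subspaceT => q.
  by apply: continuous_comp; [exact: continuous_lens_incl|exact: continuous_sepN].
exists (@sepN R n k @^-1` (~` C)).
  have cs : continuous (@sepN R n k) by exact: continuous_sepN.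
  apply: open_comp; last exact: closed_openC.
  by move=> y _; exact: (cs y).
apply/seteqP; split=> [y [q Uq <-]|y [/= nC [q _ qE]]].
  split; last by exists q.
  move=> [q' nUq' /sepN_inj h]; apply: nUq'.
  suff -> : q' = q by [].
  apply: lens_incl_inj; apply: h.
  have sr (x : @sphere R n r) : sqnorm (set_val (sphere_incl x)) = r%:num ^+ 2.
    by have := set_mem (valP x).
  by rewrite !sr.
exists q => //; apply: contrapT => nU; apply: nC; rewrite -qE.
by exists q.
Qed.

End LensTopology.

(** * A chart of the lens space *)

Section Stereographic.
Variables (R : realType) (p : nat) (r : R).
Hypothesis r0 : 0 < r.
Implicit Types x : 'rV[R]_p.

(** Inverse stereographic projection; the chart is rational, hence smooth, and the
    origin goes to the pole (r, 0, ..., 0). *)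
Definition stereo x : 'rV[R]_(p.+1) :=
  \row_i if unlift ord0 i is Some l then 2 * r * x 0 l * (1 + sqnorm x)^-1
         else r * (1 - sqnorm x) * (1 + sqnorm x)^-1.

Let q1_neq0 x : 1 + sqnorm x != 0.
Proof. by rewrite gt_eqF// ltr_pwDl// sqnorm_ge0. Qed.

Lemma stereo0 x : stereo x 0 ord0 = r * (1 - sqnorm x) * (1 + sqnorm x)^-1.
Proof. by rewrite mxE unlift_none. Qed.

Lemma stereoS x l : stereo x 0 (lift ord0 l) = 2 * r * x 0 l * (1 + sqnorm x)^-1.
Proof. by rewrite mxE liftK. Qed.

Lemma sqnorm_stereo x : sqnorm (stereo x) = r ^+ 2.
Proof.
rewrite {1}/sqnorm big_ord_recl stereo0.
under eq_bigr do rewrite stereoS.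
have -> : \sum_(i < p) (2 * r * x 0 i * (1 + sqnorm x)^-1) ^+ 2 =
    (2 * r * (1 + sqnorm x)^-1) ^+ 2 * sqnorm x.
  by rewrite mulr_sumr; apply: eq_bigr => l _; ring.
by field; exact: q1_neq0.
Qed.

Lemma smooth_stereo : smooth_on setT stereo.
Proof.
have oT : open [set: 'rV[R]_p] by exact: openT.
have sq := smooth_on_sqnorm oT.
have sV : smooth_on setT (fun x => (1 + sqnorm x)^-1).
  apply: smooth_onV => //.
  by apply: smooth_onD => //; exact: smooth_on_cst.
apply/smooth_on_rowP => // i; case: (unliftP ord0 i) => [l ->|->].
  under eq_fun do rewrite stereoS.
  apply: smooth_onM => //; apply: smooth_onM => //; first exact: smooth_on_cst.
  exact: smooth_on_id_coord.
under eq_fun do rewrite stereo0.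
apply: smooth_onM => //; apply: smooth_onM => //; first exact: smooth_on_cst.
by apply: smooth_onD => //; [exact: smooth_on_cst|exact: smooth_onN].
Qed.

Definition stereo_inv (w : 'rV[R]_(p.+1)) : 'rV[R]_p :=
  \row_l (w 0 (lift ord0 l) * (r + w 0 ord0)^-1).

Let stereo_den x : r + stereo x 0 ord0 != 0.
Proof.
rewrite stereo0; have -> : r + r * (1 - sqnorm x) * (1 + sqnorm x)^-1 =
    2 * r * (1 + sqnorm x)^-1 by field; exact: q1_neq0.
by rewrite !mulf_neq0 ?invr_eq0 ?pnatr_eq0// gt_eqF.
Qed.

Lemma stereoK : cancel stereo stereo_inv.
Proof.
move=> x; apply/rowP => l; rewrite mxE stereoS stereo0.
field; rewrite q1_neq0 /=.
have -> : r * (1 + sqnorm x) + r * (1 - sqnorm x) = 2 * r by ring.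
by rewrite mulf_neq0 ?pnatr_eq0// gt_eqF.
Qed.

(** A differentiable left inverse makes the Jacobian of full rank. *)
Lemma rank_stereo x : \rank ('J stereo x) = p.
Proof.
have dS : differentiable stereo x := smooth_on_differentiable smooth_stereo I.
have dI : differentiable stereo_inv (stereo x).
  pose U : set 'rV[R]_(p.+1) := [set w | r + w 0 ord0 != 0].
  have oT : open [set: 'rV[R]_(p.+1)] by exact: openT.
  have sc : smooth_on setT (fun w : 'rV[R]_(p.+1) => r + w 0 ord0).
    by apply: smooth_onD => //; [exact: smooth_on_cst|exact: smooth_on_id_coord].
  have oU : open U.
    have -> : U = (fun w : 'rV[R]_(p.+1) => r + w 0 ord0) @^-1` [set t | t != 0].
      by [].
    apply: open_comp; last exact: open_neq.
    by move=> w _; exact: (sc 0%N w I).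
  have sI : smooth_on U stereo_inv.
    apply/smooth_on_rowP => // l; under eq_fun do rewrite mxE.
    apply: smooth_onM => //; first exact: smooth_on_id_coord.
    by apply: smooth_onV => //; exact: smooth_on_sub sc.
  exact: smooth_on_differentiable sI (stereo_den x).
apply/eqP; rewrite eqn_leq rank_leq_row /=.
have JJ : 'J stereo x *m 'J stereo_inv (stereo x) = 1%:M.
  apply/row_matrixP => i; rewrite row_mul (row_jacobian i dS) row1.
  have /@derive_val := is_derive_diffcomp (delta_mx 0 i) dS dI.
  rewrite (_ : (fun y => _) = id); last by apply/funext => y; exact: stereoK.
  by rewrite derive_id deriveEjacobian.
by rewrite -[X in (X <= _)%N](mxrank1 R p) -JJ mxrankM_maxl.
Qed.

End Stereographic.

Section UnityNear1.
Variables (R : realType) (k : nat).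
Hypothesis k0 : (0 < k)%N.

(** If z is not 1 then 1 + z + ... + z^(k-1) = 0, so k = |sum_i (z^i - 1)|, which is at
    most k^2 |z - 1|. *)
Lemma unity_near1 (z : R[i]) : z ^+ k = 1 -> `|z - 1| < k%:R^-1 -> z = 1.
Proof.
move=> zk zn; apply/eqP; rewrite -subr_eq0; apply: contraTT zn => z1.
have nz : `|z| = 1.
  by apply/eqP; rewrite -(pexpr_eq1 k0)// -normrX zk normr1.
have P0 : \sum_(i < k) z ^+ i = 0.
  by apply: (mulfI z1); rewrite mulr0 -subrX1 zk subrr.
have le1 i : `|z ^+ i - 1| <= i%:R * `|z - 1|.
  rewrite subrX1 normrM mulrC ler_wpM2r//.
  apply: le_trans (ler_norm_sum _ _ _) _.
  rewrite (eq_bigr (fun=> 1)) => [|l _]; last by rewrite normrX nz expr1n.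
  by rewrite sumr_const card_ord.
have kE : k%:R = `|\sum_(i < k) (z ^+ i - 1)|.
  by rewrite sumrB P0 sub0r normrN sumr_const card_ord normr_nat.
have kle : k%:R <= k%:R * (k%:R * `|z - 1|).
  rewrite {1}kE; apply: le_trans (ler_norm_sum _ _ _) _.
  rewrite [leRHS]mulr_natl -[X in _ *+ X](card_ord k) -sumr_const.
  apply: ler_sum => i _; apply: le_trans (le1 i) _.
  by rewrite ler_wpM2r// ler_nat ltnW.
apply/negP => zn; have k1 : 0 < k%:R :> R[i] by rewrite ltr0n.
have : k%:R * (k%:R * `|z - 1|) < k%:R.
  by rewrite gtr_pMr// -[ltRHS](divff (lt0r_neq0 k1)) ltr_pM2l.
by move=> /(le_lt_trans kle); rewrite ltxx.
Qed.

End UnityNear1.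

Section LensChartExists.
Variables (R : realType) (n k : nat) (r : {posnum R}).
Hypotheses (n0 : (0 < n)%N) (k0 : (0 < k)%N).

Let p := (n + n).-1.
Let pm : p.+1 = (n + n)%N. Proof. by rewrite /p prednK// addn_gt0 n0. Qed.

Lemma sqnorm_cast m m' (e : m = m') (v : 'rV[R]_m) :
  sqnorm (castmx (erefl, e) v) = sqnorm v.
Proof. by case: m' / e; rewrite castmx_id. Qed.

Lemma jacobian_cast m m' (e : m = m') (f : 'rV[R]_p -> 'rV[R]_m) x :
  \rank ('J (fun y => castmx (erefl, e) (f y)) x) = \rank ('J f x).
Proof.
by case: m' / e; rewrite (_ : (fun y => _) = f)//; apply/funext => y; rewrite castmx_id.
Qed.

Lemma smooth_cast m m' (e : m = m') (f : 'rV[R]_p -> 'rV[R]_m) U :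
  smooth_on U f -> smooth_on U (fun y => castmx (erefl, e) (f y)).
Proof.
by case: m' / e; rewrite (_ : (fun y => _) = f)//; apply/funext => y; rewrite castmx_id.
Qed.

Let Y (x : 'rV[R]_p) : 'rV[R]_(n + n) := castmx (erefl, pm) (stereo r%:num x).

Let Y_inj : injective Y.
Proof.
have r0 : 0 < r%:num by [].
by move=> x y /(can_inj (castmxK _ _))/(can_inj (stereoK r0)). Qed.

Let Y_sphere x : @sphere R n r (Y x).
Proof. by rewrite /sphere/= sqnorm_cast sqnorm_stereo. Qed.

Let sY : smooth_on setT Y. Proof. by apply: smooth_cast; exact: smooth_stereo. Qed.

Let i0 : 'I_n := Ordinal n0.

Let z0 x : R[i] := zc i0 (Y x).

(** Small enough for the projection to the lens space to be injective: two points
    of it in one orbit differ by a root of unity at distance less than 1/k from 1. *)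
Definition near_pole : set 'rV[R]_p :=
  [set x | csq (z0 x - r%:num%:C) < (r%:num / (4 * k%:R)) ^+ 2].

Lemma near_pole_open : open near_pole.
Proof.
have sz : csmooth_on setT (fun x => z0 x - r%:num%:C).
  have oT : open [set: 'rV[R]_p] by exact: openT.
  have [s1 s2] := csmooth_on_zc oT i0 sY.
  split.
    by rewrite /z0 /=; apply: smooth_onD => //; exact: smooth_on_cst.
  by rewrite /z0 /=; apply: smooth_onD => //; exact: smooth_on_cst.
have cs : smooth_on setT (fun x => csq (z0 x - r%:num%:C)).
  have oT : open [set: 'rV[R]_p] by exact: openT.
  case: sz => s1 s2; rewrite /csq; under eq_fun do rewrite !expr2.
  by apply: smooth_onD => //; apply: smooth_onM.
apply: (@open_comp _ _ (fun x => csq (z0 x - r%:num%:C))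
  [set t | t < (r%:num / (4 * k%:R)) ^+ 2]).
  by move=> x _; exact: (cs 0%N x I).
exact: open_lt.
Qed.

Lemma near_pole0 : near_pole 0.
Proof.
have S0 i : stereo r%:num (0 : 'rV[R]_p) 0 i = if i == ord0 then r%:num else 0.
  have q0 : sqnorm (0 : 'rV[R]_p) = 0.
    by rewrite /sqnorm big1// => l _; rewrite mxE expr0n.
  case: (unliftP ord0 i) => [l ->|->].
    by rewrite stereoS mxE mulr0 mul0r.
  by rewrite stereo0 q0 subr0 addr0 invr1 !mulr1 eqxx.
have z00 : z0 0 = r%:num%:C.
  rewrite /z0 /zc /Y !castmxE !cast_ord_id !S0 -!val_eqE /=.
  by rewrite addn0 eqn0Ngt n0.
rewrite /near_pole/= z00 subrr /csq/= expr0n addr0 exprn_gt0// divr_gt0// mulr_gt0//.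
by rewrite ltr0n.
Qed.

Lemma csq_norm_lt (a : R[i]) (b : R) : 0 <= b -> csq a < b ^+ 2 -> `|a| < b%:C.
Proof.
move=> b0 ab; rewrite -(@ltr_pXn2r _ 2)// ?nnegrE ?ler0c//.
by rewrite normCK -rmorphXn /= -[_ * _](csqE a) ltcR.
Qed.

Lemma near_pole_inj : {in near_pole &, injective (@lens_proj R n k r \o
  (fun x => SigSub (mem_set (Y_sphere x)) : @sphere R n r))}.
Proof.
move=> x y; rewrite !inE => xP yP.
move=> /(@eqmodP _ _ _)/asboolP[l h].
set zeta := Defs.root_of_unity R k l in h.
have zk : zeta ^+ k = 1 by exact: root_of_unity_k.
suff z1 : zeta = 1.
  apply: Y_inj; apply: zc_inj => j; have := h j.
  by rewrite z1 mul1r !set_valE /= => ->.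
apply: (unity_near1 k0 zk).
have k1 : 0 < k%:R :> R by rewrite ltr0n.
pose d : R := r%:num / (4 * k%:R).
have d0 : 0 < d by rewrite divr_gt0// mulr_gt0.
have xn : `|z0 x - r%:num%:C| < d%:C := csq_norm_lt (ltW d0) xP.
have yn : `|z0 y - r%:num%:C| < d%:C := csq_norm_lt (ltW d0) yP.
have zy : z0 y = zeta * z0 x by have := h i0; rewrite !set_valE.
have dr : d <= r%:num / 4.
  by rewrite /d invfM mulrA ler_piMr ?divr_ge0// invf_le1// ler1n.
have zx : (r%:num / 2)%:C <= `|z0 x|.
  apply: (@le_trans _ _ (r%:num%:C - d%:C)).
    by rewrite -rmorphB /= lecR; lra.
  rewrite lerBlDr; apply: (@le_trans _ _ (`|z0 x| + `|z0 x - r%:num%:C|)); last first.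
    by rewrite lerD2l ltW.
  have {1}-> : r%:num%:C = `|z0 x - (z0 x - r%:num%:C)|.
    by rewrite opprB addrC subrK ger0_norm// ler0c.
  exact: ler_normB.
have zx0 : 0 < `|z0 x| by apply: lt_le_trans zx; rewrite -[0]/(0%:C) ltcR divr_gt0.
rewrite -(ltr_pM2r zx0) -normrM mulrBl mul1r -zy.
apply: (@lt_le_trans _ _ (d%:C + d%:C)).
  rewrite -(subrKA r%:num%:C) (le_lt_trans (ler_normD _ _))// ltrD//.
  by rewrite distrC.
have -> : d%:C + d%:C = k%:R^-1 * (r%:num / 2)%:C.
  rewrite -[k%:R](rmorph_nat (real_complex R)) -fmorphV -rmorphM -rmorphD /=.
  by congr (_%:C); rewrite /d; field; rewrite gt_eqF.
by rewrite ler_wpM2l// invr_ge0 ler0n.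
Qed.

Lemma lens_chart_exists : exists (i : lens_chart n k r) x, ldom i x.
Proof.
have sm : smooth_on near_pole
    (fun x => set_val (SigSub (mem_set (Y_sphere x)) : @sphere R n r)).
  exact: smooth_on_sub sY.
have rk x : near_pole x ->
    \rank ('J (fun x => set_val (SigSub (mem_set (Y_sphere x)) : @sphere R n r)) x) = p.
  by move=> _; rewrite [LHS]jacobian_cast rank_stereo.
by exists (LensChart near_pole_open sm rk near_pole_inj), 0; exact: near_pole0.
Qed.

End LensChartExists.

(** * The lens spaces in the soliton *)

Section LensInSoliton.
Variables (R : realType) (n k : nat) (u : R -> R) (c : R).
Hypotheses (hn : (2 <= n)%N) (hk : (1 <= k <= n - 1)%N).
Hypothesis hu : cao_profile n k u c.
Variable S : shrinking_soliton (Nnk R n k).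
Hypothesis hS : is_cao_soliton u S.
Variable r : {posnum R}.

Let k0 : (0 < k)%N. Proof. by case/andP: hk. Qed.
Let n0 : (0 < n)%N. Proof. by rewrite (leq_trans _ hn). Qed.
Let F := lens_incl n k r.

Section Chart.
Variables (i : lens_chart n k r) (j : 'I_n) (b : bool).

Let Y (x : 'rV[R]_((n + n).-1)) : 'rV[R]_(n + n) := set_val (lpar i x).
Let O : set 'rV[R]_((n + n).-1) := [set x | ldom i x /\ zc j (Y x) != 0].
Let jb : chart (Nnk R n k) := (j, b).
Let X := loc (M := lens n k r) (N := Nnk R n k) F i jb.

Lemma loc_dom_lens : loc_dom (M := lens n k r) (N := Nnk R n k) F i jb = O.
Proof.
apply/seteqP; split=> x [ix].
  by rewrite /F /= lens_incl_proj// => /emb_in_chart.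
by move=> xj; split=> //; rewrite /F /= lens_incl_proj//; apply/emb_in_chart.
Qed.

Lemma loc_lens x : O x -> X x = bundle_coord k j b (Y x).
Proof. by move=> [ix xj]; rewrite /X /loc /F /= lens_incl_proj// coord_emb. Qed.

Lemma open_loc_dom_lens : open O.
Proof.
rewrite openE => x [ix xj]; rewrite /interior /O.
have nx := open_nbhs_nbhs (conj (@ldom_open _ _ _ _ i) ix).
have cY : {for x, continuous Y} := @lpar_smooth _ _ _ _ i 0%N x ix.
have nj : nbhs (Y x) [set z | zc j z != 0].
  by apply: open_nbhs_nbhs; split => //; exact: open_zc_neq0.
have := cY _ nj; rewrite nbhs_simpl/= => nYj.
by near=> y; split; [near: y|near: y].
Unshelve. all: by end_near. Qed.

Let sYO : smooth_on O Y.
Proof. by apply: smooth_on_sub (lpar_smooth i) => x []. Qed.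

Lemma smooth_loc_lens : smooth_on O X.
Proof.
have oO := open_loc_dom_lens.
apply: (smooth_on_eq (f := fun x => bundle_coord k j b (Y x)) oO).
  by move=> x; rewrite inE => Ox; rewrite loc_lens.
by apply: smooth_on_bundle_coord => // x [].
Qed.

Let U : set 'rV[R]_(n + n) := [set z | zc j z != 0].
Let psi := @bundle_coord R n k j b.
Let Sc l := fibre_scaling j 1 (fibre_power (R := R) k b l) : 'M[R]_(n + n).
Let A : 'M[R]_(n + n) := fibre_scaling j 0 (if b then - k%:R else k%:R).

Let oU : open U. Proof. exact: open_zc_neq0. Qed.
Let U0 z : U z -> z != 0. Proof. exact: zc_neq0. Qed.
Let Ucone l z : 0 < l -> U z -> U (l *: z).
Proof.
move=> l0 zj; rewrite /U/= zcZ mulf_neq0// eq_complex/= eqxx andbT gt_eqF//.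
Qed.
Let dpsi z : U z -> differentiable psi z.
Proof. exact: differentiable_bundle_coord. Qed.
Let psiS l z : 0 < l -> U z -> psi (l *: z) = psi z *m Sc l.
Proof. exact: bundle_coordZ. Qed.
Let S1 : Sc 1 = 1%:M. Proof. exact: fibre_scaling1. Qed.
Let dS : is_derive (1 : R) (1 : R) Sc A. Proof. exact: is_derive_fibre_scaling. Qed.
Let KE z : U z -> kahler_metric (kahler_potential u) z =
  'J psi z *m metric S jb (psi z) *m ('J psi z)^T.
Proof. exact: soliton_pullback. Qed.
Let dY x : O x -> differentiable Y x.
Proof. exact: smooth_on_differentiable. Qed.
Let YU x : O x -> U (Y x). Proof. by case. Qed.
Let Yq x : O x -> sqnorm (Y x) = r%:num ^+ 2.
Proof. by move=> _; have := set_mem (valP (lpar i x)). Qed.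
Let rY x : O x -> \rank ('J Y x) = (n + n).-1.
Proof. by move=> [ix _]; exact: lpar_regular. Qed.

Lemma rank_loc_lens x : O x -> \rank ('J X x) = (n + n).-1.
Proof.
move=> Ox.
exact: (@rank_jacobian_chart R n k u c hu (metric S jb) psi U U0 dpsi KE
  Y X O open_loc_dom_lens dY YU rY loc_lens smooth_loc_lens x Ox).
Qed.

Let e x := X x *m A.

Lemma euler_lens_neq0 x : O x -> e x != 0.
Proof.
move=> Ox; exact: (@euler_chart_neq0 R n k u c hu (metric S jb) psi U Sc A U0 dpsi psiS
  dS KE Y X O YU loc_lens x Ox).
Qed.

Lemma mean_curvature_lens x : O x ->
  mean_curvature (metric S jb) X x =
  - (log_volume_rate n u (ln (r%:num ^+ 2)) / (2 * derive1n 2 u (ln (r%:num ^+ 2)))) *: e x.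
Proof.
move=> Ox.
exact: (@mean_curvature_sphere R n k u c hn hu (metric S jb) psi U Sc A oU U0 Ucone dpsi
  psiS S1 dS KE (soliton_metric_sym S j b) (@soliton_metric_pos _ _ _ S j b)
  (soliton_metric_diff S j b)
  Y X O (r%:num ^+ 2) open_loc_dom_lens dY YU Yq rY loc_lens smooth_loc_lens x Ox).
Qed.

Lemma normal_gradient_lens x : O x ->
  normal_part (metric S jb) X x
    (gradient (metric S jb) (potential S \o Defs.par (c := Nnk R n k) jb) (X x)) = c *: e x.
Proof.
move=> Ox.
exact: (@normal_gradient_sphere R n k u c hn hu (metric S jb) psi U Sc A
  (potential S \o Defs.par (c := Nnk R n k) jb) oU U0 dpsi
  psiS dS KE (soliton_metric_sym S j b) (@soliton_metric_pos _ _ _ S j b)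
  (soliton_potential_diff S j b) (fun z => @soliton_potentialE _ _ _ _ _ hS j b z)
  Y X O (r%:num ^+ 2) open_loc_dom_lens dY YU Yq rY loc_lens smooth_loc_lens x Ox).
Qed.

End Chart.

Lemma immersion_lens : immersion (M := lens n k r) (N := Nnk R n k) F.
Proof.
split; first split.
- exact: continuous_lens_incl.
- by move=> i [j b]; rewrite loc_dom_lens; exact: smooth_loc_lens.
- by move=> i [j b] x; rewrite loc_dom_lens => Ox; exact: rank_loc_lens.
Qed.

Lemma embedding_lens : embedding (M := lens n k r) (N := Nnk R n k) F.
Proof.
split; [exact: immersion_lens|exact: lens_incl_inj|].
by move=> V oV; exact: lens_incl_open.
Qed.

Let s := ln (r%:num ^+ 2).

Definition lens_coefficient : R := - log_volume_rate n u s / (2 * derive1n 2 u s * c).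

Lemma self_similar_lens : self_similar (M := lens n k r) S F lens_coefficient.
Proof.
have c0 := cao_const_gt0 hn hk hu.
have u2 : derive1n 2 u s != 0 by rewrite gt_eqF//; exact: cao_d2 hu s.
split; first exact: immersion_lens.
move=> i [j b] x; rewrite loc_dom_lens => Ox.
rewrite mean_curvature_lens// normal_gradient_lens// scalerA; congr (_ *: _).
rewrite /lens_coefficient -/s; move: (log_volume_rate _ _ _) (derive1n _ _ _) u2 => a d d0.
by field; rewrite d0 gt_eqF.
Qed.

(** The mean curvature is a multiple of a nonzero vector, by a factor proportional
    to Q; some point of the lens space lies in a chart. *)
Lemma minimal_lens : minimal (M := lens n k r) S F <-> log_volume_rate n u s = 0.
Proof.
split=> [[_ H0]|Q0]; last first.
  split; first exact: immersion_lens.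
  move=> i [j b] x; rewrite loc_dom_lens => Ox.
  by rewrite mean_curvature_lens// -/s Q0 mul0r oppr0 scale0r.
have [i [x ix]] := lens_chart_exists r n0 k0.
have [j xj] : exists j, zc j (set_val (lpar i x)) != 0.
  apply: contrapT => h; have := sphere_punctured (lpar i x) => /negP; apply.
  apply/eqP/zc_inj => j; rewrite zc0; apply/eqP/negPn/negP => zj.
  by apply: h; exists j.
have := H0 i (j, false) x; rewrite loc_dom_lens => /(_ (conj ix xj)).
rewrite mean_curvature_lens//= => /eqP; rewrite scaler_eq0.
rewrite (negPf (euler_lens_neq0 _ _)) ?orbF// oppr_eq0 mulf_eq0 invr_eq0.
rewrite mulf_eq0 pnatr_eq0/=.
by rewrite [X in _ || X](gt_eqF (cao_d2 hu _)) orbF => /eqP.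
Qed.

End LensInSoliton.

Theorem theorem2p1 (R : realType) (n k : nat)
  (hn : (2 <= n)%N) (hk : (1 <= k <= n - 1)%N)
  (u : R -> R) (c : R) (hu : cao_profile n k u c)
  (S : shrinking_soliton (Nnk R n k)) (hS : is_cao_soliton u S) :
  (forall r : {posnum R},
     compact [set: lens n k r] /\
     exists lam : R, self_similar S (lens_incl n k r) lam) /\
  exists! r2 : {posnum R},
    [/\ forall r : {posnum R}, r%:num < r2%:num ->
          self_shrinker S (lens_incl n k r) /\ ~ minimal S (lens_incl n k r),
        minimal S (lens_incl n k r2) /\ embedding (lens_incl n k r2)
      & forall r : {posnum R}, r2%:num < r%:num ->
          self_expander S (lens_incl n k r) /\ ~ minimal S (lens_incl n k r)].
Proof.
have n0 : (0 < n)%N by rewrite (leq_trans _ hn).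
have k0 : (0 < k)%N by case/andP: hk.
have c0 := cao_const_gt0 hn hk hu.
have u2 s : 0 < derive1n 2 u s := cao_d2 hu s.
split=> [r|].
  split; first exact: compact_lens.
  by exists (lens_coefficient n u c r); exact: (self_similar_lens hn hk hu hS r).
have [s0 [Q0 Qpos Qneg]] := log_volume_rate_sign hn hk hu.
have r2_gt0 : 0 < expR (s0 / 2) by exact: expR_gt0.
(* s = ln (r ^ 2), so r = e^(s / 2) *)
pose r2 : {posnum R} := PosNum r2_gt0.
have r2s : ln (r2%:num ^+ 2) = s0.
  by rewrite -expRM_natl expRK mulrC divfK.
have ln_lt (r r' : {posnum R}) : r%:num < r'%:num -> ln (r%:num ^+ 2) < ln (r'%:num ^+ 2).
  by move=> rr; rewrite ltr_ln ?posrE// ltr_pXn2r ?nnegrE.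
have minimal_nlt (r r' : {posnum R}) : minimal S (lens_incl n k r) ->
    minimal S (lens_incl n k r') -> ~ r%:num < r'%:num.
  move=> /(minimal_lens hn hk hu hS) m1 /(minimal_lens hn hk hu hS) m2 /ln_lt.
  have z s : log_volume_rate n u s = 0 -> s = s0.
    move=> Qs; have [/Qpos|/Qneg|//] := ltgtP s s0; rewrite Qs ltxx//.
  by rewrite (z _ m1) (z _ m2) ltxx.
have m2 : minimal S (lens_incl n k r2) by apply/(minimal_lens hn hk hu hS); rewrite r2s.
exists r2; split; first split.
- move=> r /ln_lt; rewrite r2s => /Qpos Qr; split; last first.
    by move=> /(minimal_lens hn hk hu hS) Q0'; rewrite Q0' ltxx in Qr.
  exists (lens_coefficient n u c r); last exact: (self_similar_lens hn hk hu hS r).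
  by rewrite /lens_coefficient mulNr oppr_lt0 divr_gt0// !mulr_gt0.
- by split=> //; exact: (embedding_lens hn hk hu hS r2).
- move=> r /ln_lt; rewrite r2s => /Qneg Qr; split; last first.
    by move=> /(minimal_lens hn hk hu hS) Q0'; rewrite Q0' ltxx in Qr.
  exists (lens_coefficient n u c r); last exact: (self_similar_lens hn hk hu hS r).
  by rewrite /lens_coefficient divr_gt0 ?oppr_gt0// !mulr_gt0.
move=> r' [_ [m' _] _]; apply/val_inj => /=.
have [lt|lt|//] := ltgtP r2%:num r'%:num.
  by have := minimal_nlt _ _ m2 m' lt.
by have := minimal_nlt _ _ m' m2 lt.
Qed.
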